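(* Let $P=-\Delta+V$ on $\mathbb{R}^n$ with $V$ a real-valued smooth function such that $V=V_\infty+V_s$, where $V_\infty$ is real-valued, smooth, and satisfies $V_\infty(x)=V_\infty(x/|x|)$ for $|x|\ge1$, and $V_s(x)=o(|x|^{-1})$ as $|x|\to\infty$. Let $E\in\mathbb{R}$ and, for $h\in(0,1)$, let $u_h\in\mathcal{D}(P)$ satisfy $(P-E)u_h=R_h$ and $\|u_h\|_{L^2(\mathbb{R}^n)}=1$. Write $j_\varepsilon(x)=j(\varepsilon|x|)$ for $\varepsilon>0$. Assume: (i) there exist $c_1,c_2:(0,1)\to(0,\infty)$ such that $c_2$ is (strictly) monotone increasing, $0\le c_1\le c_2$, and $c_2(h)\to0$ as $h\to0$; (ii) $u_h=j_{c_2(h)}u_h+R_h'$ with $\|R_h'\|_{L^2(\mathbb{R}^n)}=o(1)$ as $h\to0$; (iii) there exist $h_0>0$ and $\delta\in(1,2)$ such that $c_2(h)^\delta<c_1(h)$ for each $h\in(0,h_0)$; (iv) $\|R_h\|_{L^2(\mathbb{R}^n)}=o(c_1(h))$ as $h\to0$. Then at least one of the following holds: (1) $E$ is a critical value of $V_\infty|_{S^{n-1}}$; (2) $(1-j_{c_2(h)})u_h\to0$ in $L^2(\mathbb{R}^n)$ as $h\to0$ implies $(1-j_{c_1(h)})u_h\to0$ in $L^2(\mathbb{R}^n)$ as $h\to0$.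
   Context: $V_\infty$ is also regarded as a function on $S^{n-1}$ by restriction. $\mathcal{D}(P)$ is the domain of the self-adjoint operator $P$ on $L^2(\mathbb{R}^n)$. Here $j\in C^\infty(\mathbb{R};[0,1])$ is fixed with $j(r)=0$ for $r\le \frac12$ and $j(r)=1$ for $r\ge 1$. *)

(* Defs.v *)
From HB Require Import structures.
From mathcomp Require Import all_boot all_order all_algebra.
From mathcomp Require Import all_classical all_reals all_analysis.
From mathcomp Require Import complex.

Set Implicit Arguments.
Unset Strict Implicit.
Unset Printing Implicit Defensive.

Import Order.TTheory GRing.Theory Num.Theory.
Import numFieldNormedType.Exports.

Local Open Scope classical_set_scope.
Local Open Scope ring_scope.
Local Open Scope complex_scope.

(* R^n is 'rV[R]_n.  Its sigma-algebra is the one generated by the coordinate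
   functions, i.e. the Borel sigma-algebra. *)

Section measurable_rV.
Context {R : realType} {n : nat}.

Let coord (i : 'I_n) (x : 'rV[R]_n) : measurableTypeR R := x ord0 i.

Let rV_set0 : g_sigma_preimage coord set0.
Proof. exact: sigma_algebra0. Qed.

Let rV_setC A : g_sigma_preimage coord A -> g_sigma_preimage coord (~` A).
Proof. exact: sigma_algebraC. Qed.

Let rV_bigcup (F : (set 'rV[R]_n)^nat) :
  (forall i, g_sigma_preimage coord (F i)) ->
  g_sigma_preimage coord (\bigcup_i (F i)).
Proof. exact: sigma_algebra_bigcup. Qed.

HB.instance Definition _ :=
  @isMeasurable.Build (measure_tuple_display default_measure_display)
    'rV[R]_n (g_sigma_preimage coord) rV_set0 rV_setC rV_bigcup.

Lemma measurable_coord (i : 'I_n) :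
  measurable_fun [set: 'rV[R]_n] (fun x => x ord0 i : measurableTypeR R).
Proof.
move=> _ Y mY; rewrite setTI; apply: sub_sigma_algebra => /=.
rewrite -bigcup_seq/=; exists i => /=; first by rewrite mem_index_enum.
by exists Y => //; rewrite setTI.
Qed.

Lemma measurable_fun_rVP d (T : measurableType d) (f : T -> 'rV[R]_n) :
  (forall i, measurable_fun [set: T] (fun t => f t ord0 i : measurableTypeR R)) ->
  measurable_fun [set: T] f.
Proof.
move=> mf _ A mA; rewrite setTI.
have : <<s preimage_set_system [set: T] f
        (\big[setU/set0]_(i < n) preimage_set_system setT (coord i) measurable) >>
      `<=` @measurable _ T.
  apply: smallest_sub; first exact: sigma_algebra_measurable.
  move=> _ [B + <-]; rewrite -bigcup_seq/= => -[i _ [C mC <-]].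
  by rewrite setTI; apply: mf.
apply; rewrite g_sigma_preimageE; exists A => //.
by rewrite setTI.
Qed.

End measurable_rV.

Section lebesgue_rV.
Context {R : realType}.
Local Open Scope ereal_scope.

Definition rV_cons n (p : measurableTypeR R * 'rV[R]_n) : 'rV[R]_n.+1 :=
  row_mx (p.1 : R)%:M p.2.

Definition rV_head n (x : 'rV[R]_n.+1) : measurableTypeR R := x ord0 ord0.
Definition rV_tail n (x : 'rV[R]_n.+1) : 'rV[R]_n := col' ord0 x.

Lemma rV_consE0 n p : @rV_cons n p ord0 ord0 = p.1.
Proof.
rewrite /rV_cons; have -> : @ord0 n = lshift n (ord0 : 'I_1) by exact: val_inj.
by apply: etrans (row_mxEl _ _ _ _) _; rewrite mxE eqxx mulr1n.
Qed.

Lemma rV_consES n p (i : 'I_n) : rV_cons p ord0 (lift ord0 i) = p.2 ord0 i.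
Proof.
rewrite /rV_cons; have -> : lift ord0 i = rshift 1 i by exact: val_inj.
exact: row_mxEr.
Qed.

Lemma rV_headK n (p : measurableTypeR R * 'rV[R]_n) : rV_head (rV_cons p) = p.1.
Proof. exact: rV_consE0. Qed.

Lemma rV_tailK n (p : measurableTypeR R * 'rV[R]_n) : rV_tail (rV_cons p) = p.2.
Proof. by apply/rowP => i; rewrite mxE rV_consES. Qed.

Lemma measurable_rV_head n : measurable_fun [set: 'rV[R]_n.+1] (@rV_head n).
Proof. exact: measurable_coord. Qed.

Lemma measurable_rV_tail n : measurable_fun [set: 'rV[R]_n.+1] (@rV_tail n).
Proof.
apply: measurable_fun_rVP => i.
rewrite (_ : (fun _ => _) = (fun x : 'rV[R]_n.+1 => x ord0 (lift ord0 i))).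
  exact: measurable_coord.
by apply/funext => x; rewrite mxE.
Qed.

Lemma measurable_rV_cons n :
  measurable_fun [set: measurableTypeR R * 'rV[R]_n] (@rV_cons n).
Proof.
apply: measurable_fun_rVP => i; case: (unliftP ord0 i) => [j|] ->.
  rewrite (_ : (fun _ => _) = (fun x : 'rV[R]_n => x ord0 j) \o snd).
    exact: measurableT_comp (measurable_coord j) measurable_snd.
  by apply/funext => p /=; rewrite rV_consES.
rewrite (_ : (fun _ => _) = fst); first exact: measurable_fst.
by apply/funext => p; rewrite rV_consE0.
Qed.

Section step.
Context {n : nat} (mu : {sigma_finite_measure set 'rV[R]_n -> \bar R}).

Definition lebesgue_step : set 'rV[R]_n.+1 -> \bar R :=
  pushforward (lebesgue_measure \x mu) (@rV_cons n).

Let step0 : lebesgue_step set0 = 0.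
Proof. by have mf := @measurable_rV_cons n; exact: measure0. Qed.

Let step_ge0 A : 0 <= lebesgue_step A.
Proof. by have mf := @measurable_rV_cons n; exact: measure_ge0. Qed.

Let step_sigma_additive : semi_sigma_additive lebesgue_step.
Proof.
by have mf := @measurable_rV_cons n; exact: measure_semi_sigma_additive.
Qed.

HB.instance Definition _ := isMeasure.Build _ _ _ lebesgue_step
  step0 step_ge0 step_sigma_additive.

Let lebesgue_step_sigma_finite : sigma_finite setT lebesgue_step.
Proof.
pose leb : {sigma_finite_measure set (measurableTypeR R) -> \bar R} :=
  lebesgue_measure.
have /sigma_finiteP[F [TF ndF Foo]] := sigma_finiteT leb.
have /sigma_finiteP[G [TG ndG Goo]] := sigma_finiteT mu.
exists (fun k => [set x | F k (rV_head x) /\ G k (rV_tail x)]) => [|k].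
  rewrite predeqE => x; split=> // _.
  have : setT (rV_head x) by [].
  have : setT (rV_tail x) by [].
  rewrite TF TG => -[k _ Gk] [l _ Fl]; exists (maxn k l) => //; split.
  - by move: Fl; apply/subsetPset/ndF/leq_maxr.
  - by move: Gk; apply/subsetPset/ndG/leq_maxl.
have [mF Fk] := Foo k; have [mG Gk] := Goo k; split.
  rewrite (_ : [set x | _] = (@rV_head n @^-1` F k) `&` (@rV_tail n @^-1` G k))//.
  apply: measurableI; rewrite -[X in measurable X]setTI.
    exact: measurable_rV_head.
  exact: measurable_rV_tail.
rewrite /lebesgue_step /pushforward (_ : _ @^-1` _ = F k `*` G k).
  by rewrite product_measure1E// lte_mul_pinfty// ge0_fin_numE.
by apply/seteqP; split => -[a b] /=; rewrite rV_headK rV_tailK.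
Qed.

HB.instance Definition _ :=
  @Measure_isSigmaFinite.Build _ _ _ lebesgue_step lebesgue_step_sigma_finite.

End step.

Fixpoint lebesgue_rV n : {sigma_finite_measure set 'rV[R]_n -> \bar R} :=
  match n with
  | 0 => \d_(0%R : 'rV[R]_0)
  | n'.+1 => lebesgue_step (lebesgue_rV n')
  end.

Lemma lebesgue_rV_box n (A : 'I_n -> set (measurableTypeR R)) :
  (forall i, measurable (A i)) ->
  lebesgue_rV n [set x | forall i, A i (x ord0 i)] =
  \prod_(i < n) lebesgue_measure (A i).
Proof.
elim: n A => [|n IHn] A mA.
  by rewrite big_ord0 /= diracE mem_set// => -[].
rewrite big_ord_recl -(IHn (fun i => A (lift ord0 i)))// -product_measure1E//.
  rewrite /= /lebesgue_step /pushforward; congr (_ _).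
  apply/seteqP; split => [[a b]|[a b] [/= Aa Ab] i] /=.
    move=> H; split; first by have := H ord0; rewrite rV_consE0.
    by move=> i; have := H (lift ord0 i); rewrite rV_consES.
  by case: (unliftP ord0 i) => [j|] ->; rewrite ?rV_consES ?rV_consE0//; exact: Ab.
rewrite [X in measurable X](_ : _ =
  \bigcap_(i in [set: 'I_n]) [set x : 'rV[R]_n | A (lift ord0 i) (x ord0 i)]).
  apply: fin_bigcap_measurable; first exact: finite_finset.
  by move=> i _; rewrite -[X in measurable X]setTI; exact: measurable_coord.
by apply/seteqP; split => x /= Ax i => [_|]; exact: Ax.
Qed.

End lebesgue_rV.

Section smooth.
Context {R : realType} {n : nat}.
Implicit Types (f : 'rV[R]_n -> R) (x v : 'rV[R]_n).

(* The library norm on 'rV[R]_n is the sup norm, so the Euclidean structure is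
   introduced separately. *)
Definition dotrV x v : R := \sum_(i < n) x ord0 i * v ord0 i.
Definition enorm x : R := Num.sqrt (dotrV x x).

Definition partial (i : 'I_n) f : 'rV[R]_n -> R := 'D_(delta_mx ord0 i) f.

Fixpoint Ck (k : nat) f : Prop :=
  match k with
  | 0 => continuous f
  | k'.+1 => continuous f /\ forall i : 'I_n,
      (forall x, derivable f x (delta_mx ord0 i)) /\ Ck k' (partial i f)
  end.

Definition smooth f := forall k, Ck k f.

Definition laplacian f : 'rV[R]_n -> R :=
  fun x => \sum_(i < n) partial i (partial i f) x.

Definition cutoff (j : R -> R) (e : R) x : R := j (e * enorm x).

(* For |w| = 1 the tangent space T_w S^(n-1) is the orthogonal of w, and the
   differential of f restricted to the sphere at w is v |-> 'D_v f w there. *)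
Definition critical_value_sphere f (E : R) :=
  exists w, [/\ enorm w = 1, f w = E &
    forall v, dotrV w v = 0 -> 'D_v f w = 0].

End smooth.

Definition smooth1 {R : realType} (f : R -> R) :=
  forall k x, derivable (derive1n k f) x 1.

Section L2.
Context {R : realType} {n : nat}.
Implicit Types (u f : 'rV[R]_n -> R[i]) (V : 'rV[R]_n -> R).

Definition L2norm_ext u : \bar R :=
  Lnorm (lebesgue_rV n) 2%:E (fun x => (ComplexField.Normc.normc (u x))%:E).

Definition L2 u :=
  [/\ measurable_fun [set: 'rV[R]_n] (fun x => complex.Re (u x)),
      measurable_fun [set: 'rV[R]_n] (fun x => complex.Im (u x)) &
      (L2norm_ext u < +oo)%E].

Definition L2norm u : R := fine (L2norm_ext u).

Definition test_function u :=
  [/\ smooth (fun x => complex.Re (u x)),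
      smooth (fun x => complex.Im (u x)) &
      exists M, forall x, M < enorm x -> u x = 0].

Definition schroedinger0 V u : 'rV[R]_n -> R[i] := fun x =>
  Complex (- laplacian (fun y => complex.Re (u y)) x)
          (- laplacian (fun y => complex.Im (u y)) x) + (V x)%:C * u x.

(* [schroedinger V u f]: u belongs to the domain of the self-adjoint operator
   P = - Delta + V on L^2(R^n), and P u = f.  For V smooth and bounded,
   - Delta + V is essentially self-adjoint on C_c^oo(R^n); P is its closure, the
   graph of which is the L^2 x L^2 closure of the graph of - Delta + V on
   C_c^oo(R^n). *)
Definition schroedinger V u f :=
  [/\ L2 u, L2 f &
    exists phi : nat -> 'rV[R]_n -> R[i],
      [/\ forall k, test_function (phi k),
          L2norm (fun x => phi k x - u x) @[k --> \oo] --> (0 : R) &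
          L2norm (fun x => schroedinger0 V (phi k) x - f x) @[k --> \oo]
            --> (0 : R)]].

End L2.

(* Main.v *)
Require Import Defs.
From HB Require Import structures.
From mathcomp Require Import all_boot all_order all_algebra.
From mathcomp Require Import all_classical all_reals all_analysis.
From mathcomp Require Import complex.
From mathcomp Require Import measurable_realfun.
From mathcomp Require Import ring lra.

Set Implicit Arguments.
Unset Strict Implicit.
Unset Printing Implicit Defensive.

Import Order.TTheory GRing.Theory Num.Theory.
Import numFieldNormedType.Exports.

Local Open Scope classical_set_scope.
Local Open Scope ring_scope.
Local Open Scope complex_scope.

(* If E is not critical, then (Vinf - E)^2 + |x|^2 |grad Vinf|^2 is bounded below
   for |x| >= 2, by homogeneity and compactness of the sphere.  So it suffices to
   show that this density, weighted by w^3 with w = (1 + c1^2 |x|^2)^(-1/2), has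
   small mass against |u|^2.  Multiplying the equation by Y.grad u + 1/2 (div Y) u
   with Y = x w, a vector field bounded by 1/c1 along which Vinf does not vary,
   bounds the integral of w^3 |grad u|^2: the error terms are o(1) because
   R = o(c1), because |x| Vs tends to 0 at infinity, and because u has little mass
   on bounded sets.  Knowing that the gradient is small, the multiplier
   w^3 (Vinf - E) u shows that w^3 (Vinf - E)^2 |u|^2 has a small integral, and
   then the multiplier w^3 |x|^2 grad Vinf . grad u does the same for
   w^3 |x|^2 |grad Vinf|^2 |u|^2.  All this is done for real test functions, to
   which approximation in the graph norm reduces the domain of the operator. *)

(** * Euclidean space and measurability *)

(** The field [Y = x w] is [c^-2] times the gradient of [sqrt (1 + c^2 |x|^2)]. Its Jacobian
    [w Id - c^2 w^3 x x^T] has eigenvalue [w] across [x] and [w^3] along [x]; this is the origin of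
    the exponent 3. A compactly supported truncation of [x] would have a negative radial eigenvalue
    somewhere. Since [w^3] is bounded below on [|x| <= 1/c1], where [1 - j_{c1}] lives, a small
    [w^3]-mass suffices. The order of the multipliers is forced: the energy identity leaves
    [w^3 |grad u|^2] with a coefficient that is bounded but not small, and the force identity leaves
    both this term and [w^3 (Vinf - E)^2 |u|^2]. Smallness is kept quantitative: each error is an
    arbitrarily small multiple of the full [H^1] mass, plus a constant times quantities that vanish
    in the limit. Bounded sets enter through the weight [(1 + |x|^2)^-1], which a cutoff at scale
    [1/c2] controls up to [O(c2^2)]. Real and imaginary parts can be treated separately because [V]
    and [E] are real. *)

Section euclidean.
Context {R : realType} {n : nat}.
Implicit Types (x v : 'rV[R]_n).

Lemma dotrV_ge0 x : 0 <= dotrV x x.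
Proof. by apply: sumr_ge0 => i _; rewrite -expr2 sqr_ge0. Qed.

Lemma enorm_ge0 x : 0 <= enorm x.
Proof. exact: sqrtr_ge0. Qed.

Lemma enorm_sqr x : enorm x ^+ 2 = dotrV x x.
Proof. by rewrite sqr_sqrtr ?dotrV_ge0. Qed.

Lemma coord_le_enorm x i : `|x ord0 i| <= enorm x.
Proof.
rewrite -(@ler_pXn2r _ 2%N) ?nnegrE ?enorm_ge0// enorm_sqr (real_normK (num_real _))//.
rewrite /dotrV (bigD1 i)//= -expr2 lerDl; apply: sumr_ge0 => k _.
by rewrite -expr2 sqr_ge0.
Qed.

Lemma enormZ (s : R) x : enorm (s *: x) = `|s| * enorm x.
Proof.
rewrite /enorm (_ : dotrV _ _ = s ^+ 2 * dotrV x x).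
  by rewrite sqrtrM ?sqr_ge0// sqrtr_sqr.
by rewrite /dotrV mulr_sumr; apply: eq_bigr => i _; rewrite !mxE; ring.
Qed.

Lemma continuous_coord (i : 'I_n) : continuous (fun x => x ord0 i).
Proof. exact: coord_continuous. Qed.

Lemma continuous_sum (T : topologicalType) I (r : seq I) (F : I -> T -> R) :
  (forall i, continuous (F i)) -> continuous (fun t => \sum_(i <- r) F i t).
Proof.
move=> cF; elim: r => [|i r IHr].
  under eq_fun do rewrite big_nil; exact: cst_continuous.
under eq_fun do rewrite big_cons; move=> t.
by apply: continuousD; [exact: cF|exact: IHr].
Qed.

Lemma continuous_dotrV : continuous (fun x => dotrV x x).
Proof.
by apply: continuous_sum => i x; apply: continuousM; exact: continuous_coord.
Qed.

Lemma continuous_enorm : continuous (@enorm R n).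
Proof.
move=> x; apply: (@continuous_comp _ _ _ (fun y => dotrV y y) Num.sqrt).
  exact: continuous_dotrV.
exact: sqrt_continuous.
Qed.

Lemma compact_enorm_le (M : R) : compact [set x : 'rV[R]_n | enorm x <= M].
Proof.
apply: bounded_closed_compact.
  exists (Num.max M 0); split; first exact: num_real.
  move=> K MK x /= xM; apply: le_trans (ltW MK).
  rewrite [leLHS]/Num.Def.normr /= mx_normrE.
  apply/bigmax_leP; split => [|[i k] _]; first by rewrite le_max lexx orbT.
  by rewrite le_max (ord1 i) (le_trans (coord_le_enorm x k)).
apply: (@closed_comp _ _ (@enorm R n) [set r | r <= M]).
  by move=> x _; exact: continuous_enorm.
exact: closed_le.
Qed.

Lemma continuous_bounded_enorm_le (f : 'rV[R]_n -> R) (M : R) : continuous f ->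
  exists2 K, 0 <= K & forall x, enorm x <= M -> `|f x| <= K.
Proof.
move=> cf.
have /compact_bounded[K [_ fK]] : compact (f @` [set x | enorm x <= M]).
  apply: continuous_compact; last exact: compact_enorm_le.
  exact: continuous_subspaceT.
exists (`|K| + 1); first by rewrite addr_ge0.
move=> x xM; apply: fK; last by exists x.
by rewrite (le_lt_trans (ler_norm _))// ltrDl.
Qed.

End euclidean.

Section measurability.
Context {R : realType} {n : nat}.

Let grid (k : nat) (x : 'rV[R]_n) : 'rV[int]_n :=
  \row_i Num.floor (x ord0 i * k.+1%:R).
Let ungrid (k : nat) (z : 'rV[int]_n) : 'rV[R]_n :=
  \row_i ((z ord0 i)%:~R / k.+1%:R).

Let measurable_grid k z : measurable [set x | grid k x = z].
Proof.
rewrite (_ : [set x | _] = \bigcap_(i in [set: 'I_n])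
   [set x : 'rV[R]_n |
      [set` `[(z ord0 i)%:~R / k.+1%:R, ((z ord0 i) + 1)%:~R / k.+1%:R[ ]
      (x ord0 i)]).
  apply: fin_bigcap_measurable; first exact: finite_finset.
  move=> i _; rewrite -[X in measurable X]setTI.
  by apply: (measurable_coord i) => //; exact: measurable_itv.
apply/seteqP; split => x /=.
  move=> <- i _ /=; rewrite in_itv/= mxE ler_pdivrMr// ltr_pdivlMr//.
  by rewrite floor_le floorD1_gt.
move=> H; apply/rowP => i; rewrite mxE; apply/floor_def.
by have := H i I; rewrite /= in_itv/= ler_pdivrMr// ltr_pdivlMr.
Qed.

Let cvg_grid x : ungrid k (grid k x) @[k --> \oo] --> x.
Proof.
apply/cvgrPdist_lt => e e0.
near=> k.
rewrite [ltLHS]/Num.Def.normr /= mx_normrE; apply/bigmax_ltP; split=> //= -[i l] _.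
rewrite (ord1 i) {i} !mxE /= -(@ltr_pM2r _ k.+1%:R)//.
rewrite -[X in _ * X < _](ger0_norm (ler0n R k.+1)).
rewrite -normrM mulrBl divfK ?pnatr_eq0//.
have /andP[h1 h2] := floor_itv (x ord0 l * k.+1%:R).
rewrite ger0_norm ?subr_ge0//; move: h2; rewrite intrD -ltrBlDl => /lt_trans; apply.
rewrite -ltr_pdivrMr// div1r; near: k.
exact: (near_infty_natSinv_lt (PosNum e0)).
Unshelve. all: by end_near.
Qed.

(* [f] is a pointwise limit of functions that are constant on the cells of
   countable grids. *)
Lemma continuous_measurable_rV (f : 'rV[R]_n -> R) :
  continuous f -> measurable_fun [set: 'rV[R]_n] f.
Proof.
move=> cf.
apply: (@measurable_fun_cvg _ _ _ _ (fun k x => f (ungrid k (grid k x)))).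
  move=> k _ Y mY; rewrite setTI.
  rewrite (_ : _ @^-1` _ = \bigcup_(z : 'rV[int]_n)
     ([set x | grid k x = z] `&` [set _ | Y (f (ungrid k z))])).
    apply: countable_bigcupT_measurable; first exact: countableP.
    move=> z; apply: measurableI => //.
    have [h|h] := pselect (Y (f (ungrid k z))).
      by rewrite (_ : [set _ | _] = setT)//; apply/seteqP; split.
    by rewrite (_ : [set _ | _] = set0)//; apply/seteqP; split.
  apply/seteqP; split => x /=; first by exists (grid k x).
  by move=> [z _ [-> ]].
by move=> x _; apply: (cvg_comp _ _ (@cvg_grid x)); exact: cf.
Qed.

End measurability.

Section continuous_arith.
Context {R : realType} {T : topologicalType}.
Implicit Types f g : T -> R.

Lemma continuous_add f g : continuous f -> continuous g ->
  continuous (fun x => f x + g x).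
Proof. by move=> cf cg x; apply: cvgD; [exact: cf|exact: cg]. Qed.

Lemma continuous_mul f g : continuous f -> continuous g ->
  continuous (fun x => f x * g x).
Proof. by move=> cf cg x; apply: cvgM; [exact: cf|exact: cg]. Qed.

Lemma continuous_opp f : continuous f -> continuous (fun x => - f x).
Proof. by move=> cf x; apply: cvgN; exact: cf. Qed.

Lemma continuous_exp f k : continuous f -> continuous (fun x => f x ^+ k).
Proof.
move=> cf; elim: k => [|k IHk]; first exact: cst_continuous.
by under eq_fun do rewrite exprS; exact: continuous_mul.
Qed.

Lemma continuous_inv f : continuous f -> (forall x, f x != 0) ->
  continuous (fun x => (f x)^-1).
Proof. by move=> cf f0 x; apply: cvgV; [exact: f0|exact: cf]. Qed.

End continuous_arith.

(** The two difference quotients coincide. This moves directional derivatives to one real variable,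
    where the chain rule, the mean value theorem and equality near a point are available. *)
Lemma is_derive_lineP {R : realType} {V : normedModType R} (f : V -> R)
    (x v : V) (df : R) :
  is_derive x v f df <-> is_derive (0 : R) (1 : R) (fun t => f (t *: v + x)) df.
Proof.
have E : (fun h : R => h^-1 *: ((f \o shift x) (h *: v) - f x)) =
    (fun h => h^-1 *: (((fun t => f (t *: v + x)) \o shift 0) (h *: (1 : R)) -
                 (fun t => f (t *: v + x)) 0)).
  by apply/funext => h /=; rewrite !addr0 scale0r add0r [h *: 1]mulr1.
by split=> -[d1 d2]; split; move: d1 d2; rewrite /derivable /derive E.
Qed.

Lemma is_derive_line {R : realType} {V : normedModType R} (f : V -> R)
    (x v : V) (t df : R) : is_derive (t *: v + x) v f df ->
  is_derive t (1 : R) (fun t => f (t *: v + x)) df.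
Proof.
move=> /is_derive_lineP df0; apply/is_derive_lineP => /=.
rewrite (_ : (fun s : R => _) = (fun s => f (s *: v + (t *: v + x))))//.
by apply/funext => s; rewrite addrA -scalerDl [s *: 1]mulr1.
Qed.

Lemma continuous_line {R : realType} {V : normedModType R} (x v : V) :
  continuous (fun t : R => t *: v + x).
Proof.
by move=> t; apply: cvgD; [apply: cvgZr_tmp; exact: cvg_id|exact: cvg_cst].
Qed.


Lemma continuous_to_rV {R : realType} {n : nat} (T : topologicalType)
    (F : T -> 'rV[R]_n) :
  (forall i, continuous (fun t => F t ord0 i)) -> continuous F.
Proof.
move=> cF t; apply/cvgrPdist_lt => e e0.
have H : \forall s \near t, forall i, `|F t ord0 i - F s ord0 i| < e.
  apply: filter_forall => i.
  by have /cvgrPdist_lt := cF i t; exact.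
near=> s.
rewrite [ltLHS]/Num.Def.normr /= mx_normrE; apply/bigmax_ltP; split=> //= -[k l] _.
by rewrite (ord1 k) !mxE; move: l; near: s.
Unshelve. all: by end_near.
Qed.

(** * Continuous functions of compact support *)

Section compact_support.
Context {R : realType} {n : nat}.
Implicit Types (f g : 'rV[R]_n -> R).

Definition ccont f := continuous f /\ exists M, forall x, M < enorm x -> f x = 0.

Lemma ccontM f g : ccont f -> continuous g -> ccont (fun x => f x * g x).
Proof.
move=> [cf [M fM]] cg; split; first exact: continuous_mul.
by exists M => x /fM ->; rewrite mul0r.
Qed.

Lemma ccontMl f g : continuous f -> ccont g -> ccont (fun x => f x * g x).
Proof.
by move=> cf cg; under eq_fun do rewrite mulrC; exact: ccontM.
Qed.

Lemma ccontD f g : ccont f -> ccont g -> ccont (fun x => f x + g x).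
Proof.
move=> [cf [M fM]] [cg [N gN]]; split; first exact: continuous_add.
exists (Num.max M N) => x; rewrite gt_max => /andP[xM xN].
by rewrite fM// gN// addr0.
Qed.

Lemma ccontN f : ccont f -> ccont (fun x => - f x).
Proof.
move=> [cf [M fM]]; split; first exact: continuous_opp.
by exists M => x /fM ->; rewrite oppr0.
Qed.

Lemma ccont0 : ccont (fun=> 0).
Proof. by split; [exact: cst_continuous|exists 0]. Qed.

Lemma ccont_sum I (r : seq I) (F : I -> 'rV[R]_n -> R) :
  (forall i, ccont (F i)) -> ccont (fun x => \sum_(i <- r) F i x).
Proof.
move=> cF; elim: r => [|i r IHr].
  by under eq_fun do rewrite big_nil; exact: ccont0.
by under eq_fun do rewrite big_cons; exact: ccontD.
Qed.

(** A Euclidean ball lies in a cube, whose measure is a finite product by [lebesgue_rV_box], and [f]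
    is bounded on it. *)
Lemma ccont_integrable f : ccont f ->
  (lebesgue_rV n).-integrable [set: 'rV[R]_n] (EFin \o f).
Proof.
move=> [cf [M fM]]; pose N := Num.max M 0.
pose B := [set x : 'rV[R]_n | forall i, [set` `[- N, N]%R] (x ord0 i)].
have mB : measurable B.
  rewrite (_ : B = \bigcap_(i in [set: 'I_n])
      [set x : 'rV[R]_n | [set` `[- N, N]%R] (x ord0 i)]).
    apply: fin_bigcap_measurable; first exact: finite_finset.
    move=> i _; rewrite -[X in measurable X]setTI.
    by apply: (measurable_coord i) => //; exact: measurable_itv.
  by apply/seteqP; split => x Bx i => [_|]; exact: Bx.
rewrite (_ : EFin \o f = (EFin \o f) \_ B); last first.
  apply/funext => x; rewrite /patch; case: ifPn => //.
  rewrite notin_setE /B /= => nB; congr EFin; apply: fM.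
  rewrite ltNge; apply/negP => xM; apply: nB => i.
  rewrite in_itv/= -ler_norml (le_trans (coord_le_enorm x i))// le_max xM.
  by [].
apply/(integrable_mkcond _ mB).
apply: (@measurable_bounded_integrable _ _ R (lebesgue_rV n) f B mB).
- have EB : lebesgue_rV n B =
      (\prod_(i < n) lebesgue_measure [set` `[- N, N]%R])%E.
    by apply: lebesgue_rV_box => i; exact: measurable_itv.
  apply: (@le_lt_trans _ _ (\prod_(i < n) lebesgue_measure [set` `[- N, N]%R])%E).
    by rewrite -EB.
  have := @prode_fin_num R _ (index_enum 'I_n) xpredT
    (fun=> lebesgue_measure [set` `[- N, N]%R]).
  move=> /(_ _)/fin_numPlt => /(_ _)/andP[] // i _.
  by rewrite lebesgue_measure_itv /=; case: ifPn.
- by apply: measurable_funTS; exact: continuous_measurable_rV.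
have [K K0 fK] := continuous_bounded_enorm_le (Num.max M 0) cf.
exists K; split; first exact: num_real.
move=> L KL x _; apply: le_trans (ltW KL).
have [xM|/fM ->] := leP (enorm x) M; last by rewrite normr0.
by apply: fK; rewrite le_max xM.
Qed.

End compact_support.

(** * Divergence theorem for compactly supported functions *)

Lemma integral_derive_compact_support {R : realType} (F f : R -> R) (M : R) :
  (forall t, is_derive t (1 : R) F (f t)) -> continuous f ->
  (forall t, M < `|t| -> F t = 0) ->
  (\int[lebesgue_measure]_t (f t)%:E = 0)%E.
Proof.
(* [F] is known to vanish only where [|t| > M], so the endpoints must lie strictly beyond [M]; the
   added 1 also makes the interval nondegenerate. *)
move=> dF cf FM; pose N := Num.max M 0 + 1.
have N0 : 0 < N by rewrite ltr_wpDl// le_max lexx orbT.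
have MN : M < N by rewrite ltr_pwDr// le_max lexx.
have f0 t : M < `|t| -> f t = 0.
  move=> Mt; have d := dF t; rewrite -(@derive_val _ _ _ _ _ _ _ d).
  have : \forall s \near t, F s = cst 0 s.
    have ot : \forall s \near t, M < `|s|.
      have /cvgr_gt : (`|s| @[s --> t] --> `|t|) by exact: norm_continuous.
      exact.
    by apply: filterS ot => s /FM.
  by move=> /near_eq_derive ->; rewrite derive_cst.
rewrite (_ : (fun t => (f t)%:E) = (EFin \o f) \_ [set` `[- N, N]%R]); last first.
  apply/funext => t; rewrite /patch; case: ifPn => //.
  rewrite notin_setE /= in_itv/= -ler_norml => /negP; rewrite -ltNge => Nt.
  by rewrite f0// (lt_trans MN).
rewrite -integral_mkcond (@continuous_FTC2 R f F).
- by rewrite !FM ?subee// ?normrN gtr0_norm.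
- by rewrite -subr_gt0 opprK addr_gt0.
- exact: continuous_subspaceT.
- have cF : continuous F.
    by move=> t; apply: differentiable_continuous; apply/derivable1_diffP; case: (dF t).
  by split => [t _||]; [case: (dF t)|apply: cvg_at_right_filter; exact: cF|
    apply: cvg_at_left_filter; exact: cF].
- by move=> t _; rewrite derive1E; case: (dF t).
Qed.

Section slices.
Context {R : realType} {n : nat}.
Implicit Types (t : R) (y : 'rV[R]_n).

Lemma rV_cons_shift_tail t y (i : 'I_n) (s : R) :
  rV_cons (t, s *: delta_mx ord0 i + y) =
  s *: delta_mx ord0 (lift ord0 i) + rV_cons (t, y).
Proof.
apply/rowP => k; rewrite [RHS]mxE [X in _ = X + _]mxE [X in _ = _ * X + _]mxE.
case: (unliftP ord0 k) => [l|] ->.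
  by rewrite !rV_consES !mxE eqxx (inj_eq lift_inj).
by rewrite !rV_consE0 /= mulr0 add0r.
Qed.

Lemma rV_cons_shift_head t y s :
  rV_cons (s *: 1 + t, y) = s *: delta_mx ord0 ord0 + rV_cons (t, y).
Proof.
apply/rowP => k; rewrite [RHS]mxE [X in _ = X + _]mxE [X in _ = _ * X + _]mxE.
case: (unliftP ord0 k) => [l|] ->.
  by rewrite !rV_consES /= mulr0 add0r.
by rewrite !rV_consE0.
Qed.

Lemma dotrV_cons t y :
  dotrV (rV_cons (t, y)) (rV_cons (t, y)) = t ^+ 2 + dotrV y y.
Proof.
rewrite /dotrV big_ord_recl rV_consE0 expr2; congr (_ + _).
by apply: eq_bigr => i _; rewrite rV_consES.
Qed.

Lemma enorm_cons_ge_head t y : `|t| <= enorm (rV_cons (t, y)).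
Proof.
by have := coord_le_enorm (rV_cons (t, y)) ord0; rewrite rV_consE0.
Qed.

Lemma enorm_cons_ge_tail t y : enorm y <= enorm (rV_cons (t, y)).
Proof. by apply: ler_wsqrtr; rewrite dotrV_cons lerDr sqr_ge0. Qed.

Lemma continuous_cons_tail t : continuous (fun y => rV_cons (t, y)).
Proof.
apply: continuous_to_rV => k; case: (unliftP ord0 k) => [l|] ->.
  by under eq_fun do rewrite rV_consES; exact: continuous_coord.
by under eq_fun do rewrite rV_consE0; exact: cst_continuous.
Qed.

Lemma continuous_cons_head y : continuous (fun t : R => rV_cons (t, y)).
Proof.
apply: continuous_to_rV => k; case: (unliftP ord0 k) => [l|] ->.
  by under eq_fun do rewrite rV_consES; exact: cst_continuous.
by under eq_fun do rewrite rV_consE0; move=> t; exact: cvg_id.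
Qed.

End slices.

(** The exterior of a closed ball is open, so where [f] vanishes it vanishes nearby and its
    derivative is 0. *)
Lemma partial_ccont {R : realType} {n : nat} (f f' : 'rV[R]_n -> R) i :
  ccont f -> (forall x, is_derive x (delta_mx ord0 i) f (f' x)) ->
  continuous f' -> ccont f'.
Proof.
move=> [cf [M fM]] df cf'; split=> //; exists M => x Mx.
have d := df x; rewrite -(@derive_val _ _ _ _ _ _ _ d).
have : \forall y \near x, f y = cst 0 y.
  have : \forall y \near x, M < enorm y.
    have /cvgr_gt : (enorm y @[y --> x] --> enorm x) by exact: continuous_enorm.
    exact.
  by apply: filterS => y /fM.
by move=> /near_eq_derive ->; rewrite derive_cst.
Qed.

(** Induction on the dimension by Fubini. A derivative in the first coordinate is integrated in that
    coordinate first, by the fundamental theorem of calculus; for any other coordinate the first one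
    is frozen and the induction hypothesis applies to the slice. *)
Lemma integral_partial0 {R : realType} {n : nat} (f f' : 'rV[R]_n -> R) i :
  ccont f -> (forall x, is_derive x (delta_mx ord0 i) f (f' x)) ->
  continuous f' ->
  (\int[lebesgue_rV n]_x (f' x)%:E = 0)%E.
Proof.
elim: n f f' i => [f f' []//|n IHn] f f' i cf df cf'.
have cf'' := partial_ccont cf df cf'.
have intf' := ccont_integrable cf''.
have mcons := @measurable_rV_cons R n.
have mf' : measurable_fun [set: 'rV[R]_n.+1] (fun x => (f' x)%:E).
  by apply/measurable_EFinP; exact: continuous_measurable_rV.
have intfc : (lebesgue_measure \x lebesgue_rV n)%E.-integrable setT
    (fun z => (f' (@rV_cons R n z))%:E).
  apply/integrableP; split; first exact: (measurableT_comp mf' mcons).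
  have /integrableP[_] := intf'; rewrite /= /lebesgue_step.
  rewrite ge0_integral_pushforward//.
  by apply/measurable_EFinP; apply: measurableT_comp => //; exact/measurable_EFinP.
apply: (@etrans _ _ (\int[(lebesgue_measure \x lebesgue_rV n)%E]_z
    (f' (@rV_cons R n z))%:E)%E).
  by rewrite /= /lebesgue_step integral_pushforward.
have [M fM] := cf.2.
case: (unliftP ord0 i) df => [k|] -> df.
  rewrite -integral12_prod_meas1//; apply: integral0_eq => t _.
  apply: (IHn (fun y => f (rV_cons (t, y))) (fun y => f' (rV_cons (t, y))) k).
  - split; last by exists M => y My; rewrite fM// (lt_le_trans My)// enorm_cons_ge_tail.
    by move=> y; apply: continuous_comp; [exact: continuous_cons_tail|exact: cf.1].
  - move=> y; apply/is_derive_lineP; under eq_fun do rewrite rV_cons_shift_tail.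
    exact: (is_derive_lineP _ _ _ _).1 (df _).
  - by move=> y; apply: continuous_comp; [exact: continuous_cons_tail|exact: cf'].
rewrite -integral21_prod_meas1//; apply: integral0_eq => y _.
apply: (@integral_derive_compact_support _ (fun t => f (rV_cons (t, y)))
    (fun t => f' (rV_cons (t, y))) M).
- move=> t; apply/is_derive_lineP; under eq_fun do rewrite rV_cons_shift_head.
  exact: (is_derive_lineP _ _ _ _).1 (df _).
- by move=> t; apply: continuous_comp; [exact: continuous_cons_head|exact: cf'].
- by move=> t Mt; rewrite fM// (lt_le_trans Mt)// enorm_cons_ge_head.
Qed.

(** * Directional derivatives *)

Lemma continuous_near_shift {R : realType} {V : normedModType R} (g : V -> R)
    (x : V) (e : R) : continuous g -> 0 < e ->
  exists2 d, 0 < d & forall y, `|y| < d -> `|g (y + x) - g x| < e.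
Proof.
move=> cg e0; have /cvgrPdist_lt/(_ e e0) := cg x.
move=> /nbhs_ballP[d /= d0 dg]; exists d => // y yd.
by rewrite distrC; apply: dg; rewrite -ball_normE /= opprD addrCA subrr addr0 normrN.
Qed.

Lemma mvt_line {R : realType} {V : normedModType R} (f f' : V -> R) (x v : V)
    (h : R) : (forall y, is_derive y v f (f' y)) ->
  exists2 s : R, `|s| <= `|h| & f (h *: v + x) - f x = h * f' (s *: v + x).
Proof.
move=> df; pose F (t : R) := f (t *: v + x).
have dF t : is_derive t (1 : R) F (f' (t *: v + x)) by exact: is_derive_line.
have cF : continuous F.
  move=> t; apply: differentiable_continuous; apply/derivable1_diffP.
  by case: (dF t).
have F0 : F 0 = f x by rewrite /F scale0r add0r.
have [h0|h0] := leP 0 h.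
  have [s] := @MVT_segment _ F _ 0 h h0 (fun t _ => dF t) (continuous_subspaceT cF).
  rewrite in_itv/= => /andP[s0 sh] E; exists s; first by rewrite !ger0_norm.
  by rewrite -/(F h) -F0 E subr0 mulrC.
have [s] := @MVT_segment _ F _ h 0 (ltW h0) (fun t _ => dF t) (continuous_subspaceT cF).
rewrite in_itv/= => /andP[sh s0] E; exists s.
  by rewrite (ler0_norm s0) (ltr0_norm h0) lerN2.
by rewrite -/(F h) -F0 -[LHS]opprB E sub0r mulrN opprK mulrC.
Qed.

Lemma is_derive_comp {R : realType} {V : normedModType R} (phi : R -> R)
    (g : V -> R) (x v : V) (a b : R) :
  is_derive (g x) (1 : R) phi a -> is_derive x v g b ->
  is_derive x v (fun y => phi (g y)) (a * b).
Proof.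
move=> dphi /is_derive_lineP dg; apply/is_derive_lineP.
apply: (@is_derive1_comp _ phi (fun t => g (t *: v + x))) => //.
by rewrite scale0r add0r.
Qed.

Lemma is_derive_scale_dir {R : realType} {V : normedModType R} (f : V -> R)
    (x v : V) (a b : R) :
  is_derive x v f b -> is_derive x (a *: v) f (a * b).
Proof.
move=> /is_derive_lineP df; apply/is_derive_lineP.
rewrite (_ : (fun t : R => _) = (fun t => f (t *: v + x)) \o (fun t => t * a)).
  rewrite mulrC; apply: is_derive1_comp; first by rewrite mul0r.
  by apply: is_derive_eq; rewrite scaler0 add0r; exact: mulr1.
by apply/funext => t /=; rewrite scalerA.
Qed.

(** The increment along [v + w] is split at [h w + x]. The part along [v] is, by the mean value
    theorem, [h] times [f'] at a point that tends to [x], so continuity of [f'] gives its limit. *)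
Lemma is_derive_add_dir {R : realType} {V : normedModType R} (f f' : V -> R)
    (x v w : V) (b : R) :
  (forall y, is_derive y v f (f' y)) -> continuous f' ->
  is_derive x w f b -> is_derive x (v + w) f (f' x + b).
Proof.
move=> dv cf' [dw wE].
have cvg_vw : h^-1 *: ((f \o shift x) (h *: (v + w)) - f x) @[h --> 0^'] -->
    f' x + b.
  have -> : (fun h : R => h^-1 *: ((f \o shift x) (h *: (v + w)) - f x)) =
    (fun h => h^-1 *: (f (h *: v + (h *: w + x)) - f (h *: w + x)) +
       h^-1 *: ((f \o shift x) (h *: w) - f x)).
    apply/funext => h /=; rewrite -scalerDr [in RHS]addrA subrK.
    by rewrite [h *: (v + w)]scalerDr addrA.
  have D0 : 0 < `|v| + `|w| + 1 by rewrite ltr_wpDl// addr_ge0.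
  apply: cvgD; last by rewrite -wE; exact: dw.
  apply/cvgrPdist_lt => e e0.
  have [d d0 fd] := continuous_near_shift x cf' e0.
  near=> h.
  have h0 : h != 0 by near: h; exact: nbhs_dnbhs_neq.
  have [s sh ->] := mvt_line (h *: w + x) h dv.
  rewrite [_^-1 *: _]mulrA mulVf// mul1r distrC addrA; apply: fd.
  rewrite (le_lt_trans (ler_normD _ _))// !normrZ.
  have hd : `|h| < d / (`|v| + `|w| + 1).
    by near: h; apply: dnbhs0_lt; exact: divr_gt0.
  move: hd; rewrite ltr_pdivlMr//; apply: le_lt_trans.
  rewrite !mulrDr mulr1 -addrA; apply: lerD; first exact: ler_wpM2r.
  by rewrite lerDl.
by split; [apply/cvg_ex; exists (f' x + b)|exact/cvg_lim].
Unshelve. all: by end_near. Qed.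

Section gradient.
Context {R : realType} {n : nat}.
Implicit Types (f g : 'rV[R]_n -> R).
Notation gradfield := ('I_n -> 'rV[R]_n -> R).

(** The gradient is an explicit family rather than [partial i f]: the rules below then compute
    gradients of products and sums by unification, and [has_grad_eq] rewrites them into the desired
    form. *)
Definition has_grad f (f' : gradfield) :=
  continuous f /\ forall i, continuous (f' i) /\
  forall x, is_derive x (delta_mx ord0 i : 'rV[R]_n) f (f' i x).

Lemma has_grad_eq f (f' g' : gradfield) :
  (forall i x, f' i x = g' i x) -> has_grad f f' ->
  has_grad f g'.
Proof. by move=> fg; rewrite (_ : f' = g')//; apply/funext => i; apply/funext. Qed.

Lemma has_grad_cst (a : R) : has_grad (fun=> a) (fun _ _ => 0).
Proof.
by split=> [|i]; [|split=> [|x]]; [exact: cst_continuous..|exact: is_derive_cst].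
Qed.

Lemma has_gradD f g (f' g' : gradfield) : has_grad f f' -> has_grad g g' ->
  has_grad (fun x => f x + g x) (fun i x => f' i x + g' i x).
Proof.
move=> [cf df] [cg dg]; split=> [|i]; first exact: continuous_add.
split=> [|x]; first by apply: continuous_add; [exact: (df i).1|exact: (dg i).1].
by apply: is_deriveD; [exact: (df i).2|exact: (dg i).2].
Qed.

Lemma has_gradM f g (f' g' : gradfield) : has_grad f f' -> has_grad g g' ->
  has_grad (fun x => f x * g x) (fun i x => f' i x * g x + f x * g' i x).
Proof.
move=> [cf df] [cg dg]; split=> [|i]; first exact: continuous_mul.
have [[cf' df'] [cg' dg']] := (df i, dg i).
split=> [|x]; first by apply: continuous_add; exact: continuous_mul.
rewrite addrC [f' i x * _]mulrC.
exact: (@is_deriveM _ _ f g x _ _ _ (df' x) (dg' x)).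
Qed.

Lemma has_grad_coord (k : 'I_n) :
  has_grad (fun x => x ord0 k) (fun i _ => (i == k)%:R).
Proof.
split=> [|i]; first exact: continuous_coord.
split=> [|x]; first exact: cst_continuous.
apply/is_derive_lineP.
rewrite (_ : (fun t : R => _) = (fun t => (i == k)%:R * t + x ord0 k)).
  apply: is_derive_eq; rewrite addr0.
  exact: mulr1.
by apply/funext => t; rewrite !mxE eqxx /= mulrC eq_sym.
Qed.

Lemma has_grad_sum I (r : seq I) (F : I -> 'rV[R]_n -> R)
    (F' : I -> 'I_n -> 'rV[R]_n -> R) : (forall k, has_grad (F k) (F' k)) ->
  has_grad (fun x => \sum_(k <- r) F k x) (fun i x => \sum_(k <- r) F' k i x).
Proof.
move=> dF; elim: r => [|k r IHr].
  under eq_fun do rewrite big_nil.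
  by apply: has_grad_eq (has_grad_cst 0) => i x; rewrite big_nil.
under eq_fun do rewrite big_cons.
by apply: has_grad_eq (has_gradD (dF k) IHr) => i x; rewrite big_cons.
Qed.

Lemma has_grad_dotrV : has_grad (fun x => dotrV x x) (fun i x => 2 * x ord0 i).
Proof.
apply: has_grad_eq (has_grad_sum _ (fun k => has_gradM (has_grad_coord k)
  (has_grad_coord k))) => i x.
rewrite (bigD1 i)//= big1 ?addr0 => [|k ki].
  by rewrite eqxx mulr1 mul1r mulr2n mulrDl mul1r.
by rewrite eq_sym (negPf ki) mulr0 mul0r addr0.
Qed.

Lemma smooth_grad f : smooth f -> has_grad f (fun i => partial i f).
Proof.
move=> /(_ 1%N) [cf df]; split=> // i; have [dfi cfi] := df i; by split.
Qed.

Lemma smooth_partial i f : smooth f -> smooth (partial i f).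
Proof. by move=> sf k; have [_ /(_ i)[]] := sf k.+1. Qed.

Lemma smooth_continuous f : smooth f -> continuous f.
Proof. by move=> /(_ 0%N). Qed.

(** The coordinate components of [v] are added one at a time with [is_derive_add_dir], which is
    where continuity of the partial derivatives enters. *)
Lemma has_grad_dir f (f' : gradfield) x v : has_grad f f' ->
  is_derive x v f (\sum_(i < n) v ord0 i * f' i x).
Proof.
move=> [cf df].
have H (r : seq 'I_n) y : is_derive y (\sum_(i <- r) v ord0 i *: delta_mx ord0 i) f
    (\sum_(i <- r) v ord0 i * f' i y).
  elim: r y => [|i r IHr] y; first by rewrite !big_nil; exact: is_derive0.
  rewrite !big_cons.
  apply: (@is_derive_add_dir _ _ f (fun z => v ord0 i * f' i z)) => //.
    by move=> z; apply: is_derive_scale_dir; exact: (df i).2.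
  by apply: continuous_mul; [exact: cst_continuous|exact: (df i).1].
by rewrite [X in is_derive _ X](row_sum_delta v); exact: H.
Qed.

(** Both mixed derivatives, taken at suitable points near [x], equal the same second difference of
    [f] divided by [h^2]; continuity then compares them at [x]. *)
Lemma partialC f i k x : smooth f ->
  partial i (partial k f) x = partial k (partial i f) x.
Proof.
move=> sf; pose e i : 'rV[R]_n := delta_mx ord0 i.
have [cf df] := smooth_grad sf.
have [ci di] := smooth_grad (smooth_partial i sf).
have [ck dk] := smooth_grad (smooth_partial k sf).
apply/eqP; rewrite -subr_eq0 -normr_le0; apply/ler_addgt0Pr => eps eps0.
rewrite add0r; have eps2 : 0 < eps / 2 by rewrite divr_gt0.
have [d1 d10 fd1] := continuous_near_shift x (dk i).1 eps2.
have [d2 d20 fd2] := continuous_near_shift x (di k).1 eps2.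
pose D := `|e i| + `|e k| + 1.
have D0 : 0 < D by rewrite ltr_wpDl// addr_ge0.
(* With this side length, every intermediate point of the square stays within [d1] and [d2] of
   [x]. *)
pose h := Num.min d1 d2 / D.
have h0 : 0 < h by rewrite divr_gt0// lt_min d10.
have small s t a b : `|s| <= `|h| -> `|t| <= `|h| -> a + b < D ->
    0 <= a -> 0 <= b -> `|s| * a + `|t| * b < Num.min d1 d2.
  move=> sh th abD a0 b0.
  rewrite (@le_lt_trans _ _ (h * (a + b)))//.
    move: sh th; rewrite (gtr0_norm h0) mulrDr => sh th.
    by apply: lerD; exact: ler_wpM2r.
  by rewrite /h mulrAC ltr_pdivrMr// ltr_pM2l// lt_min d10.
(* The mean value theorem is applied along [e a] to the increment of [f] in direction [e b], then
   along [e b] to [partial a f]. *)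
have second (a b : 'I_n) : exists s t : R, [/\ `|s| <= `|h|, `|t| <= `|h| &
    f (h *: e a + h *: e b + x) - f (h *: e b + x) - (f (h *: e a + x) - f x) =
    h * (h * partial b (partial a f) (t *: e b + (s *: e a + x)))].
  have dG y : is_derive y (e a) (fun z => f (h *: e b + z) - f z)
      (partial a f (h *: e b + y) - partial a f y).
    apply: is_deriveB; last exact: (df a).2.
    apply/is_derive_lineP; under eq_fun do rewrite addrCA.
    by apply: (is_derive_lineP _ _ _ _).1; exact: (df a).2.
  have [s sh E] := mvt_line x h dG; exists s.
  have [_ da] := smooth_grad (smooth_partial a sf).
  have [t th E'] := mvt_line (s *: e a + x) h (da b).2.
  exists t; split => //.
  have -> : h *: e a + h *: e b + x = h *: e b + (h *: e a + x).
    by rewrite addrA [h *: e b + _]addrC.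
  by rewrite -E' -E /=; ring.
have [s [t [sh th E]]] := second k i.
have [s' [t' [sh' th' E']]] := second i k.
(* The second difference does not depend on the order of the two directions, and [h] can be
   cancelled twice. *)
have : partial i (partial k f) (t *: e i + (s *: e k + x)) =
       partial k (partial i f) (t' *: e k + (s' *: e i + x)).
  apply: (mulfI (lt0r_neq0 h0)); apply: (mulfI (lt0r_neq0 h0)).
  apply: (etrans (esym E)); apply: etrans E'.
  rewrite [h *: e k + _]addrC; ring.
move: (fd1 (t *: e i + s *: e k)) (fd2 (t' *: e k + s' *: e i)).
rewrite -!addrA => F1 F2 EE.
have {}F1 : `|partial i (partial k f) (t *: e i + (s *: e k + x))
              - partial i (partial k f) x| < eps / 2.
  apply: F1; apply: (@lt_le_trans _ _ (Num.min d1 d2)); last first.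
    by rewrite ge_min lexx.
  apply: (le_lt_trans (ler_normD _ _)); rewrite (normrZ t (e i)) (normrZ s (e k)).
  apply: small th sh _ (normr_ge0 _) (normr_ge0 _).
  by rewrite /D ltrDl.
have {}F2 : `|partial k (partial i f) (t' *: e k + (s' *: e i + x))
              - partial k (partial i f) x| < eps / 2.
  apply: F2; apply: (@lt_le_trans _ _ (Num.min d1 d2)); last first.
    by rewrite ge_min lexx orbT.
  apply: (le_lt_trans (ler_normD _ _)); rewrite (normrZ t' (e k)) (normrZ s' (e i)).
  apply: small th' sh' _ (normr_ge0 _) (normr_ge0 _).
  by rewrite /D [X in X < _]addrC ltrDl.
move: F1 F2; rewrite EE.
move: (partial i (partial k f) x) (partial k (partial i f) x) => P Q.
move: (partial k _ _) => Z F1 F2.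
rewrite (_ : P - Q = (Z - Q) - (Z - P)); last by ring.
apply: (le_trans (ler_normB _ _)); rewrite [leRHS]splitr.
by apply: lerD; exact: ltW.
Qed.

End gradient.

(** * The potential *)

Section homogeneity.
Context {R : realType} {n : nat}.
Implicit Types (f : 'rV[R]_n -> R) (x : 'rV[R]_n).

(** Homogeneity of degree [-k] outside the unit ball. The strict inequalities make the domain open,
    so that the relation can be differentiated. *)
Definition homogeneous_outside (k : nat) f := forall x (s : R), 0 < s ->
  1 < enorm x -> 1 < enorm (s *: x) -> f x = s ^+ k * f (s *: x).

Lemma near_line_enorm_gt x v (M : R) : M < enorm x ->
  \forall t \near (0 : R), M < enorm (t *: v + x).
Proof.
move=> Mx.
have /cvgr_gt : enorm (t *: v + x) @[t --> (0 : R)] --> enorm x.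
  rewrite [X in _ --> enorm X](_ : x = (0 : R) *: v + x); last first.
    by rewrite scale0r add0r.
  apply: (@continuous_comp _ _ _ (fun t : R => t *: v + x) (@enorm R n)).
    exact: continuous_line.
  exact: continuous_enorm.
exact.
Qed.

(** The relation persists along short segments through [x] and [s *: x]; differentiating it brings
    out one more factor [s]. *)
Lemma homogeneous_derive k f f' (v : 'rV[R]_n) : homogeneous_outside k f ->
  (forall x, is_derive x v f (f' x)) -> homogeneous_outside k.+1 f'.
Proof.
move=> hf df x s s0 x1 sx1.
have d := df x; rewrite -(@derive_val _ _ _ _ _ _ _ d).
have nf : \forall t \near (0 : R),
    f (t *: v + x) = s ^+ k * f ((t * s) *: v + s *: x).
  have h1 := near_line_enorm_gt v x1; have h2 := near_line_enorm_gt (s *: v) sx1.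
  near=> t; rewrite [t * s]mulrC -scalerA -scalerDr; apply: hf => //; first by near: t.
  by rewrite scalerDr scalerA [s * t]mulrC -scalerA; near: t.
apply: (@derive_val _ _ _ _ _ _ _ _); apply/is_derive_lineP.
apply: (near_eq_is_derive (f := fun t : R => s ^+ k * f ((t * s) *: v + s *: x))).
  by apply: filterS nf => t ->.
have -> : s ^+ k.+1 * f' (s *: x) = s ^+ k * (f' (s *: x) * s).
  by rewrite exprS; ring.
have dl : is_derive (0 : R) (1 : R) (fun t : R => f ((t * s) *: v + s *: x))
    (f' (s *: x) * s).
  apply: (@is_derive1_comp _ (fun t => f (t *: v + s *: x)) (fun t => t * s)).
    by rewrite mul0r; exact: (is_derive_lineP _ _ _ _).1 (df _).
  by apply: is_derive_eq; rewrite scaler0 add0r; exact: mulr1.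
have := @is_deriveZ _ _ _ (fun t : R => f ((t * s) *: v + s *: x) : R^o)
  (s ^+ k) 0 1 _ dl.
exact.
Unshelve. all: by end_near. Qed.

(** Points beyond radius 2 are rescaled to the sphere of radius 2, which lies strictly outside the
    unit ball; compactness bounds [f] on the closed ball of that radius. *)
Lemma homogeneous_bound k f : homogeneous_outside k f -> continuous f ->
  exists2 K, 0 <= K & forall x, enorm x ^+ k * `|f x| <= K.
Proof.
move=> hf cf; have [K K0 fK] := continuous_bounded_enorm_le 2 cf.
exists (2 ^+ k * K) => [|x]; first by rewrite mulr_ge0// exprn_ge0.
have [x2|x2] := leP (enorm x) 2.
  by rewrite ler_pM ?exprn_ge0 ?enorm_ge0 ?fK// lerXn2r ?nnegrE ?enorm_ge0.
have x0 : 0 < enorm x by rewrite (lt_trans _ x2).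
have s0 : 0 < 2 / enorm x by rewrite divr_gt0.
have sx : enorm ((2 / enorm x) *: x) = 2.
  by rewrite enormZ gtr0_norm// divfK// gt_eqF.
rewrite (hf _ _ s0) ?sx//; [|by rewrite (lt_trans _ x2)// ltr1n|by rewrite ltr1n].
rewrite normrM mulrA ger0_norm ?exprn_ge0 ?(ltW s0)// -exprMn mulrCA divff ?gt_eqF//.
by rewrite mulr1 ler_wpM2l ?exprn_ge0// fK// sx.
Qed.

Lemma normalizeZ x (s : R) : 0 < s -> (enorm (s *: x))^-1 *: (s *: x) =
  (enorm x)^-1 *: x.
Proof.
by move=> s0; rewrite enormZ gtr0_norm// scalerA invfM mulrAC mulVf ?mul1r// gt_eqF.
Qed.

End homogeneity.

Section potential.
Context {R : realType} {n : nat}.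
Implicit Types x : 'rV[R]_n.
Context (Vinf : 'rV[R]_n -> R) (smooth_Vinf : smooth Vinf).
Context (Vinf_homog :
  forall x, 1 <= enorm x -> Vinf x = Vinf ((enorm x)^-1 *: x)).

Lemma Vinf_scale x (s : R) : 0 < s -> 1 <= enorm x -> 1 <= enorm (s *: x) ->
  Vinf x = Vinf (s *: x).
Proof.
move=> s0 x1 sx1; rewrite (Vinf_homog x1) (Vinf_homog sx1).
by rewrite normalizeZ.
Qed.

Lemma Vinf_homogeneous : homogeneous_outside 0 Vinf.
Proof. by move=> x s s0 /ltW x1 /ltW sx1; rewrite mul1r; exact: Vinf_scale. Qed.

Lemma Vinf_partial_homogeneous i : homogeneous_outside 1 (partial i Vinf).
Proof.
apply: homogeneous_derive Vinf_homogeneous _.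
by move=> x; apply: ((smooth_grad smooth_Vinf).2 i).2.
Qed.

Lemma Vinf_partial2_homogeneous i k :
  homogeneous_outside 2 (partial k (partial i Vinf)).
Proof.
apply: homogeneous_derive (Vinf_partial_homogeneous i) _.
by move=> x; apply: ((smooth_grad (smooth_partial i smooth_Vinf)).2 k).2.
Qed.

(** Euler's relation in degree 0: [Vinf] is constant along [x + t x] for small [t]. *)
Lemma Vinf_radial x : 1 < enorm x -> \sum_(i < n) x ord0 i * partial i Vinf x = 0.
Proof.
move=> x1.
have d := has_grad_dir x x (smooth_grad smooth_Vinf).
rewrite -(@derive_val _ _ _ _ _ _ _ d).
apply: (@derive_val _ _ _ _ _ _ _ _); apply/is_derive_lineP.
apply: (near_eq_is_derive (f := cst (Vinf x))).
have h1 := near_line_enorm_gt x x1.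
(* This keeps the dilation factor [1 + t] positive. *)
have h2 : \forall t \near (0 : R), -1 < t.
  have /cvgr_gt : t @[t --> (0 : R)] --> (0 : R) by exact: cvg_id.
  by apply; rewrite oppr_lt0.
near=> t; rewrite /= -[X in _ + X]scale1r -scalerDl; apply: Vinf_scale.
- by rewrite -ltrBlDr sub0r; near: t.
- exact: ltW.
- by rewrite scalerDl scale1r; apply: ltW; near: t.
Unshelve. all: by end_near. Qed.

(** The right-hand side is invariant under dilations outside the unit ball, so its infimum over
    [|x| >= 2] is a minimum over the sphere of radius 2. There a zero would give a critical point of
    [Vinf] on the unit sphere at level [E]. *)
Lemma noncritical_lower_bound (E : R) : ~ critical_value_sphere Vinf E ->
  exists2 k, 0 < k & forall x, 2 <= enorm x ->
   k <= (Vinf x - E) ^+ 2 + dotrV x x * \sum_(i < n) partial i Vinf x ^+ 2.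
Proof.
move=> ncrit.
pose G x := (Vinf x - E) ^+ 2 + dotrV x x * \sum_(i < n) partial i Vinf x ^+ 2.
have cG : continuous G.
  apply: continuous_add; first apply: continuous_exp.
    by apply: continuous_add; [exact: smooth_continuous|exact: cst_continuous].
  apply: continuous_mul; first exact: continuous_dotrV.
  apply: continuous_sum => i; apply: continuous_exp.
  by apply: smooth_continuous; exact: smooth_partial.
have sum_ge0 x : 0 <= \sum_(i < n) partial i Vinf x ^+ 2.
  by apply: sumr_ge0 => i _; exact: sqr_ge0.
have G_gt0 c : enorm c = 2 -> 0 < G c.
  move=> c2; rewrite lt_neqAle addr_ge0 ?sqr_ge0 ?mulr_ge0 ?dotrV_ge0// andbT.
  apply/eqP => /esym/eqP; rewrite paddr_eq0 ?sqr_ge0 ?mulr_ge0 ?dotrV_ge0//.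
  rewrite sqrf_eq0 subr_eq0 mulf_eq0 -enorm_sqr c2 sqrf_eq0 pnatr_eq0 /=.
  move=> /andP[/eqP VcE]; rewrite psumr_eq0; last by move=> i _; exact: sqr_ge0.
  move=> /allP dVc.
  have {}dVc i : partial i Vinf c = 0.
    by have := dVc i; rewrite mem_index_enum sqrf_eq0 => /(_ isT)/eqP.
  (* The minimum is taken at radius 2, strictly outside the unit ball, whereas critical points are
     defined on the unit sphere; hence the halving. *)
  apply: ncrit; exists (2^-1 *: c); split.
  - by rewrite enormZ c2 ger0_norm// mulVf.
  - by rewrite -VcE [RHS]Vinf_homog c2// ler1n.
  - move=> v wv.
    have d := has_grad_dir c (2 *: v) (smooth_grad smooth_Vinf).
    move: d; rewrite big1 => [d|i _]; last by rewrite dVc mulr0.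
    apply: (@derive_val _ _ _ _ _ _ _ _); apply/is_derive_lineP.
    rewrite (_ : (fun t : R => _) = (fun t : R => Vinf (t *: (2 *: v) + c))).
      exact: (is_derive_lineP _ _ _ _).1 d.
    (* The tangent line at the unit vector [c / 2] stays outside the unit ball,
       where [Vinf] is homogeneous: dilating it by 2 does not change [Vinf]. *)
    apply/funext => t.
    have -> : t *: (2 *: v) + c = 2 *: (t *: v + 2^-1 *: c).
      by rewrite scalerDr !scalerA mulrC divff ?pnatr_eq0// scale1r.
    have ge1 : 1 <= enorm (t *: v + 2^-1 *: c).
      rewrite -(@ler_pXn2r _ 2%N) ?nnegrE ?enorm_ge0// expr1n enorm_sqr.
      have -> : dotrV (t *: v + 2^-1 *: c) (t *: v + 2^-1 *: c) =
          t ^+ 2 * dotrV v v + 2 * t * dotrV (2^-1 *: c) v +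
          dotrV (2^-1 *: c) (2^-1 *: c).
        rewrite /dotrV !mulr_sumr -!big_split /=; apply: eq_bigr => i _.
        by rewrite !mxE; ring.
      rewrite wv mulr0 addr0 -(enorm_sqr (2^-1 *: c)) enormZ c2.
      rewrite ger0_norm// mulVf// expr1n.
      by rewrite lerDr mulr_ge0 ?sqr_ge0 ?dotrV_ge0.
    apply: Vinf_scale => //.
    by rewrite enormZ ger0_norm// (le_trans ge1)// ler_peMl ?enorm_ge0 ?ler1n.
have scale x : 2 <= enorm x -> exists2 c, enorm c = 2 & G x = G c.
  move=> x2; have x0 : 0 < enorm x by rewrite (lt_le_trans _ x2).
  have s0 : 0 < 2 / enorm x by rewrite divr_gt0.
  have sx : enorm ((2 / enorm x) *: x) = 2.
    by rewrite enormZ gtr0_norm// divfK// gt_eqF.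
  have x1 : 1 < enorm x by rewrite (lt_le_trans _ x2)// ltr1n.
  exists ((2 / enorm x) *: x) => //.
  rewrite /G (Vinf_homogeneous s0) ?sx ?ltr1n// mul1r; congr (_ + _).
  rewrite -!enorm_sqr sx (eq_bigr (fun i => (2 / enorm x) ^+ 2 *
    partial i Vinf ((2 / enorm x) *: x) ^+ 2)) => [|i _].
    by rewrite -mulr_sumr mulrA -exprMn mulrCA divff ?mulr1// gt_eqF.
  by rewrite (Vinf_partial_homogeneous i s0) ?sx ?ltr1n// expr1 exprMn.
(* In dimension 0 the sphere is empty; then no [x] has norm at least 2 and any positive constant
   will do. *)
have [[c0 c02]|S0] := pselect (exists c : 'rV[R]_n, enorm c = 2); last first.
  by exists 1 => // x /scale[c c2]; exfalso; apply: S0; exists c.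
have cS : compact [set c : 'rV[R]_n | enorm c = 2].
  apply: (subclosed_compact _ (@compact_enorm_le R n 2)).
    apply: (@closed_comp _ _ (@enorm R n) [set r | r = 2]).
      by move=> x _; exact: continuous_enorm.
    exact: closed_eq.
  by move=> c /= ->.
have [c] := EVT_min_rV (ex_intro _ c0 c02) cS (continuous_subspaceT cG).
rewrite inE /= => c2 cmin; exists (G c); first exact: G_gt0.
by move=> x /scale[c' c'2 GE]; rewrite -/(G x) GE; apply: cmin; rewrite inE.
Qed.

End potential.

(** The decay of [|x| Vs] in the form that the estimates consume: a small constant at infinity, and
    on a bounded set a large constant multiplied by the weight that measures mass near the
    origin. *)
Lemma short_range_bound {R : realType} {n : nat} (Vs : 'rV[R]_n -> R) :
  continuous Vs ->
  (forall e : R, 0 < e ->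
     exists M : R, forall x, M <= enorm x -> `|Vs x| <= e * (enorm x)^-1) ->
  forall e : R, 0 < e -> exists2 C : R, 0 <= C &
    forall x, (1 + dotrV x x) * Vs x ^+ 2 <= e + C * (1 + dotrV x x)^-1.
Proof.
move=> cVs decay e e0.
(* The factor 2 is lost in [1 + |x|^2 <= 2 |x|^2], valid because [M] is also taken at least 1. *)
have e1 : 0 < Num.sqrt (e / 2) by rewrite sqrtr_gt0 divr_gt0.
have [M0 VM0] := decay _ e1; pose M := Num.max M0 1.
have [K K0 VK] := continuous_bounded_enorm_le M cVs.
exists ((1 + M ^+ 2) ^+ 2 * K ^+ 2); first by rewrite mulr_ge0 ?sqr_ge0.
move=> x; have d0 := dotrV_ge0 x.
have p0 : 0 < 1 + dotrV x x by rewrite ltr_pwDl.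
have [xM|xM] := leP (enorm x) M.
  have NM : dotrV x x <= M ^+ 2.
    by rewrite -enorm_sqr lerXn2r ?nnegrE ?enorm_ge0// (le_trans _ xM) ?enorm_ge0.
  have VK2 : Vs x ^+ 2 <= K ^+ 2.
    by rewrite -real_normK ?num_real// lerXn2r ?nnegrE ?VK.
  rewrite ler_wpDl ?(ltW e0)// ler_pdivlMr// mulrAC -expr2.
  rewrite ler_pM ?sqr_ge0// lerXn2r ?nnegrE ?lerD2l//; first exact: ltW.
  by rewrite addr_ge0// sqr_ge0.
have M1 : 1 <= M by rewrite le_max lexx orbT.
have x1 : 1 < enorm x by rewrite (le_lt_trans M1).
have x0 : 0 < enorm x by rewrite (lt_trans _ x1).
rewrite ler_wpDr//; first by rewrite mulr_ge0 ?invr_ge0 ?(ltW p0)// mulr_ge0 ?sqr_ge0.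
have V1 : Vs x ^+ 2 <= e / 2 / dotrV x x.
  have : `|Vs x| <= Num.sqrt (e / 2) / enorm x.
    by apply: VM0; rewrite (le_trans _ (ltW xM))// le_max lexx.
  rewrite -(@ler_pXn2r _ 2%N) ?nnegrE//; last by rewrite divr_ge0 ?sqrtr_ge0 ?enorm_ge0.
  rewrite real_normK ?num_real// expr_div_n sqr_sqrtr ?divr_ge0 ?(ltW e0)//.
  by rewrite enorm_sqr.
have N1 : 1 <= dotrV x x by rewrite -enorm_sqr exprn_ege1// ltW.
have N0 : 0 < dotrV x x by rewrite (lt_le_trans _ N1).
apply: (@le_trans _ _ ((2 * dotrV x x) * (e / 2 / dotrV x x))).
  by rewrite ler_pM ?sqr_ge0 ?(ltW p0)//; lra.
rewrite le_eqVlt; apply/orP; left; apply/eqP; field.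
by rewrite gt_eqF.
Qed.

(** * The weight and its gradient *)

Section weight.
Context {R : realType} {n : nat}.
Implicit Types (c : R) (x : 'rV[R]_n).

Definition weight c x : R := (Num.sqrt (1 + c ^+ 2 * dotrV x x))^-1.

Lemma weight_arg_gt0 c x : 0 < 1 + c ^+ 2 * dotrV x x.
Proof. by rewrite ltr_pwDl// mulr_ge0 ?sqr_ge0 ?dotrV_ge0. Qed.

Lemma weight_gt0 c x : 0 < weight c x.
Proof. by rewrite invr_gt0 sqrtr_gt0 weight_arg_gt0. Qed.

Lemma weight_sqr c x : weight c x ^+ 2 = (1 + c ^+ 2 * dotrV x x)^-1.
Proof. by rewrite exprVn sqr_sqrtr ?(ltW (weight_arg_gt0 _ _)). Qed.

Lemma weight_sqrE c x : weight c x ^+ 2 * (1 + c ^+ 2 * dotrV x x) = 1.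
Proof. by rewrite weight_sqr mulVf// gt_eqF// weight_arg_gt0. Qed.

Lemma weight_le1 c x : weight c x <= 1.
Proof.
rewrite -(@ler_pXn2r _ 2%N) ?nnegrE ?(ltW (weight_gt0 _ _))// expr1n weight_sqr.
by rewrite invf_le1 ?weight_arg_gt0// lerDl mulr_ge0 ?sqr_ge0 ?dotrV_ge0.
Qed.

Lemma weight_grad c :
  has_grad (weight c) (fun i x => - (c ^+ 2 * x ord0 i * weight c x ^+ 3)).
Proof.
pose s x : R := 1 + c ^+ 2 * dotrV x x.
have [cs ds] : has_grad s (fun i x => 2 * c ^+ 2 * x ord0 i).
  apply: has_grad_eq (has_gradD (has_grad_cst 1)
     (has_gradM (has_grad_cst (c ^+ 2)) has_grad_dotrV)) => i x.
  by rewrite /=; ring.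
have cw : continuous (weight c).
  apply: continuous_inv => [|x]; last by rewrite gt_eqF// sqrtr_gt0 weight_arg_gt0.
  move=> x; apply: (@continuous_comp _ _ _ s Num.sqrt); first exact: cs.
  exact: sqrt_continuous.
split=> // i; split=> [|x].
  apply: continuous_opp; apply: continuous_mul; last exact: continuous_exp.
  by apply: continuous_mul; [exact: cst_continuous|exact: continuous_coord].
have sx0 := weight_arg_gt0 c x.
have q0 : Num.sqrt (s x) != 0 by rewrite gt_eqF// sqrtr_gt0.
have dphi : is_derive (s x) (1 : R) (fun t => (Num.sqrt t)^-1)
    (- (Num.sqrt (s x)) ^- 2 * (2 * Num.sqrt (s x))^-1).
  exact: is_deriveV q0 (is_derive1_sqrt sx0).
have := is_derive_comp dphi ((ds i).2 x).
suff -> : - Num.sqrt (s x) ^- 2 * (2 * Num.sqrt (s x))^-1 * (2 * c ^+ 2 * x ord0 i) =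
   - (c ^+ 2 * x ord0 i * weight c x ^+ 3) by [].
have : Num.sqrt (s x) != 0 by rewrite gt_eqF// sqrtr_gt0.
by rewrite /weight -/(s x) => ?; field.
Qed.

End weight.

(** * Multiplier identities *)

Section integral_ccont.
Context {R : realType} {n : nat}.
Implicit Types (f g : 'rV[R]_n -> R).

Definition integ f : R := \int[lebesgue_rV n]_x f x.

Lemma integD f g : ccont f -> ccont g ->
  integ (fun x => f x + g x) = integ f + integ g.
Proof. by move=> cf cg; apply: RintegralD => //; exact: ccont_integrable. Qed.

Lemma integZ (c : R) f : ccont f -> integ (fun x => c * f x) = c * integ f.
Proof. by move=> cf; apply: RintegralZl => //; exact: ccont_integrable. Qed.

Lemma integ_le f g : ccont f -> ccont g -> (forall x, f x <= g x) ->
  integ f <= integ g.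
Proof.
by move=> cf cg fg; apply: le_Rintegral => //; exact: ccont_integrable.
Qed.

Lemma integ_ge0 f : (forall x, 0 <= f x) -> 0 <= integ f.
Proof. by move=> f0; apply: Rintegral_ge0. Qed.

Lemma integ0 : integ (fun=> 0) = 0.
Proof. by rewrite /integ /Rintegral integral0. Qed.

Lemma ccontZ (c : R) f : ccont f -> ccont (fun x => c * f x).
Proof. by move=> cf; apply: ccontMl => //; exact: cst_continuous. Qed.

Lemma integ_sum I (r : seq I) (F : I -> 'rV[R]_n -> R) :
  (forall i, ccont (F i)) ->
  integ (fun x => \sum_(i <- r) F i x) = \sum_(i <- r) integ (F i).
Proof.
move=> cF; elim: r => [|i r IHr].
  by under eq_fun do rewrite big_nil; rewrite big_nil integ0.
under eq_fun do rewrite big_cons.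
by rewrite big_cons -IHr integD//; exact: ccont_sum.
Qed.

Fixpoint all_snd_ccont (H : seq (R * ('rV[R]_n -> R))) : Prop :=
  if H is p :: H' then ccont p.2 /\ all_snd_ccont H' else True.

(** Passage from pointwise inequalities to integral ones. Divergences enter the list as ordinary
    entries and then drop out because their integrals are 0. *)
Lemma integ_le_comb f (H : seq (R * ('rV[R]_n -> R))) : ccont f ->
  all_snd_ccont H -> (forall x, f x <= \sum_(p <- H) p.1 * p.2 x) ->
  integ f <= \sum_(p <- H) p.1 * integ p.2.
Proof.
move=> cf cH fH.
have [cS <-] : ccont (fun x => \sum_(p <- H) p.1 * p.2 x) /\
    integ (fun x => \sum_(p <- H) p.1 * p.2 x) = \sum_(p <- H) p.1 * integ p.2.
  elim: H cH {fH} => [_|p H IH [cp /IH[cS E]]] /=.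
    under eq_fun do rewrite big_nil.
    by rewrite big_nil integ0; split=> //; exact: ccont0.
  under eq_fun do rewrite big_cons.
  rewrite big_cons -E -integZ// integD//; last exact: ccontZ.
  by split=> //; apply: ccontD => //; exact: ccontZ.
exact: integ_le.
Qed.

Lemma integ_div (G : 'I_n -> 'rV[R]_n -> R) (G' : 'I_n -> 'I_n -> 'rV[R]_n -> R)
    (T : 'rV[R]_n -> R) :
  (forall i, ccont (G i)) -> (forall i, has_grad (G i) (G' i)) ->
  (forall x, T x = \sum_(i < n) G' i i x) -> ccont T /\ integ T = 0.
Proof.
move=> cG dG TE.
have cG' i : ccont (G' i i).
  by apply: partial_ccont (cG i) _ _; [exact: ((dG i).2 i).2|exact: ((dG i).2 i).1].
have -> : T = (fun x => \sum_(i < n) G' i i x) by apply/funext.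
split; first exact: ccont_sum.
rewrite integ_sum// big1// => i _.
rewrite /integ /Rintegral.
by rewrite (integral_partial0 (cG i) ((dG i).2 i).2 ((dG i).2 i).1).
Qed.

End integral_ccont.

Section multiplier_identities.
Context {R : realType} {n : nat}.
Context {a : 'rV[R]_n -> R} {da : 'I_n -> 'rV[R]_n -> R}
  {d2a : 'I_n -> 'I_n -> 'rV[R]_n -> R}.
Context (ca : ccont a) (ga : has_grad a da) (gda : forall i, has_grad (da i) (d2a i)).

Let cda i : ccont (da i).
Proof. by apply: partial_ccont ca _ _; [exact: (ga.2 i).2|exact: (ga.2 i).1]. Qed.

(* [T] is the divergence of [g a grad a]. *)
Lemma scalar_multiplier (g : 'rV[R]_n -> R) (dg : 'I_n -> 'rV[R]_n -> R) :
  has_grad g dg ->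
  let T x := g x * a x * (\sum_(i < n) d2a i i x) +
    g x * (\sum_(i < n) da i x ^+ 2) + a x * \sum_(i < n) dg i x * da i x in
  ccont T /\ integ T = 0.
Proof.
move=> gg T.
apply: (@integ_div _ _ (fun i x => g x * a x * da i x) _ T _
    (fun i => has_gradM (has_gradM gg ga) (gda i))) => [i|x].
  by apply: ccontMl => //; apply: continuous_mul; [exact: gg.1|exact: ga.1].
rewrite /T !mulr_sumr -!big_split /=; apply: eq_bigr => i _; ring.
Qed.

(* [T] is the divergence of [(Y . grad a) grad a - 1/2 |grad a|^2 Y]. *)
Lemma vector_multiplier (Y : 'I_n -> 'rV[R]_n -> R)
    (dY : 'I_n -> 'I_n -> 'rV[R]_n -> R) :
  (forall i k x, d2a i k x = d2a k i x) -> (forall k, has_grad (Y k) (dY k)) ->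
  let T x := (\sum_(i < n) d2a i i x) * (\sum_(k < n) Y k x * da k x) +
    (\sum_(i < n) \sum_(k < n) dY k i x * (da i x * da k x)) -
    2^-1 * (\sum_(k < n) dY k k x) * (\sum_(i < n) da i x ^+ 2) in
  ccont T /\ integ T = 0.
Proof.
move=> sym gY T.
have gD := has_grad_sum (index_enum 'I_n) (fun k => has_gradM (gY k) (gda k)).
have gS := has_grad_sum (index_enum 'I_n) (fun k => has_gradM (gda k) (gda k)).
have gG i := has_gradD (has_gradM (gda i) gD)
  (has_gradM (has_gradM (has_grad_cst (- 2^-1)) (gY i)) gS).
apply: (@integ_div _ _ _ _ T _ gG) => [i|x].
  apply: ccontD; first by apply: ccontM => //; exact: gD.1.
  apply: ccontMl; last by apply: ccont_sum => k; apply: ccontM => //; exact: (cda k).1.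
  by apply: continuous_mul; [exact: cst_continuous|exact: (gY i).1].
rewrite /T.
(* The second derivatives produced by [Y . grad a] and by [1/2 |grad a|^2] cancel, by symmetry of
   the Hessian. *)
have E : \sum_(i < n) da i x * (\sum_(k < n) Y k x * d2a k i x) =
    \sum_(i < n) Y i x * (\sum_(k < n) da k x * d2a k i x).
  under eq_bigr do rewrite mulr_sumr.
  rewrite exchange_big; apply: eq_bigr => i _; rewrite mulr_sumr.
  by apply: eq_bigr => k _; rewrite (sym i k); ring.
have -> : \sum_(i < n) da i x ^+ 2 = \sum_(i < n) da i x * da i x.
  by apply: eq_bigr => i _; rewrite expr2.
rewrite mulr_suml -!mulrA mulr_suml mulr_sumr -sumrN -!big_split /=.
set S := \sum_(i < n) da i x * da i x; set D := \sum_(k < n) Y k x * da k x.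
transitivity (\sum_(i < n) (d2a i i x * D + \sum_(k < n) dY k i x * (da i x * da k x)
   - 2^-1 * (dY i i x * S)) + (\sum_(i < n) da i x * (\sum_(k < n) Y k x * d2a k i x) -
    \sum_(i < n) Y i x * (\sum_(k < n) da k x * d2a k i x))).
  by rewrite E subrr addr0.
rewrite -sumrB -big_split /=; apply: eq_bigr => i _.
rewrite big_split /= [X in _ = _ + X](_ : _ = - (2^-1 * (dY i i x * S)) -
   Y i x * (\sum_(k < n) da k x * d2a k i x)); last first.
  rewrite (_ : \sum_(k < n) (_ + _) = 2 * \sum_(k < n) da k x * d2a k i x).
    by field.
  by rewrite mulr_sumr; apply: eq_bigr => k _; ring.
rewrite [X in d2a i i x * _ + da i x * (X + _)](_ : _ =
  \sum_(k < n) dY k i x * da k x)//.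
rewrite (_ : \sum_(k < n) dY k i x * (da i x * da k x) =
  da i x * \sum_(k < n) dY k i x * da k x).
  by rewrite -/D; ring.
by rewrite mulr_sumr; apply: eq_bigr => k _; ring.
Qed.

(* [T] is the divergence of [a^2 F]. *)
Lemma divergence_square (F : 'I_n -> 'rV[R]_n -> R)
    (dF : 'I_n -> 'I_n -> 'rV[R]_n -> R) :
  (forall k, has_grad (F k) (dF k)) ->
  let T x := (\sum_(i < n) dF i i x) * a x ^+ 2 +
    2 * a x * (\sum_(i < n) F i x * da i x) in
  ccont T /\ integ T = 0.
Proof.
move=> gF T.
apply: (@integ_div _ _ (fun i x => F i x * (a x * a x)) _ T _
    (fun i => has_gradM (gF i) (has_gradM ga ga))) => [i|x].
  by apply: ccontMl; [exact: (gF i).1|exact: ccontM ca ga.1].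
rewrite /T mulr_suml mulr_sumr -!big_split /=; apply: eq_bigr => i _; ring.
Qed.

End multiplier_identities.

(** * Pointwise inequalities *)

Section pointwise_estimates.
Context {R : realType}.

Lemma amgm (e x y : R) : 0 < e -> `|x * y| <= 2^-1 * (e * x ^+ 2 + e^-1 * y ^+ 2).
Proof.
move=> e0; have ei0 : 0 < e^-1 by rewrite invr_gt0.
have E : e * e^-1 = 1 by rewrite divff// gt_eqF.
have h1 : 0 <= e^-1 * (e * x - y) ^+ 2 by rewrite mulr_ge0 ?sqr_ge0// ltW.
have h2 : 0 <= e^-1 * (e * x + y) ^+ 2 by rewrite mulr_ge0 ?sqr_ge0// ltW.
have E1 : e^-1 * (e * x - y) ^+ 2 = e * x ^+ 2 - 2 * (x * y) + e^-1 * y ^+ 2.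
  by field; rewrite gt_eqF.
have E2 : e^-1 * (e * x + y) ^+ 2 = e * x ^+ 2 + 2 * (x * y) + e^-1 * y ^+ 2.
  by field; rewrite gt_eqF.
by rewrite ler_norml; apply/andP; split; lra.
Qed.

Lemma cauchy_schwarz_sum n (x y : 'I_n -> R) :
  (\sum_(i < n) x i * y i) ^+ 2 <= (\sum_(i < n) x i ^+ 2) * (\sum_(i < n) y i ^+ 2).
Proof.
set D := \sum_(i < n) x i * y i; set N := \sum_(i < n) x i ^+ 2.
set G := \sum_(i < n) y i ^+ 2.
have N0 : 0 <= N by apply: sumr_ge0 => i _; exact: sqr_ge0.
have [N_eq0|NN0] := eqVneq N 0.
  have x0 i : x i = 0.
    move/eqP: N_eq0; rewrite psumr_eq0; last by move=> k _; exact: sqr_ge0.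
    by move=> /allP/(_ i); rewrite mem_index_enum sqrf_eq0 => /(_ isT)/eqP.
  by rewrite /D big1 ?expr0n /= ?N_eq0 ?mul0r// => i _; rewrite x0 mul0r.
(* Up to the factor [N], this is the distance of [y] to its projection on the line of [x],
   squared. *)
have : 0 <= \sum_(i < n) (N * y i - D * x i) ^+ 2.
  by apply: sumr_ge0 => i _; exact: sqr_ge0.
have -> : \sum_(i < n) (N * y i - D * x i) ^+ 2 = N * (N * G - D ^+ 2).
  have -> : N * (N * G - D ^+ 2) = N ^+ 2 * G + (- 2 * N * D) * D + D ^+ 2 * N.
    by ring.
  have -> : N ^+ 2 * G = \sum_(i < n) N ^+ 2 * y i ^+ 2 by rewrite mulr_sumr.
  have -> : (- 2 * N * D) * D = \sum_(i < n) (- 2 * N * D) * (x i * y i).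
    by rewrite mulr_sumr.
  have -> : D ^+ 2 * N = \sum_(i < n) D ^+ 2 * x i ^+ 2 by rewrite mulr_sumr.
  rewrite -!big_split /=.
  by apply: eq_bigr => i _; ring.
by rewrite pmulr_rge0 ?subr_ge0// lt_neqAle eq_sym NN0.
Qed.

(** Young's inequality with parameter [p / e]: the factor [p] makes [v^2] small and is repaid by
    [y^2 <= p G]. The hypothesis carries [e^2] so that a factor [e] survives the division by [e]. *)
Lemma amgm_short_range (e p v a y G q C : R) : 0 < e -> 0 < p ->
  y ^+ 2 <= p * G -> p * v ^+ 2 <= e ^+ 2 + C * q ->
  `|v * a * y| <= 2^-1 * (e * a ^+ 2 + e^-1 * C * (q * a ^+ 2) + e * G).
Proof.
move=> e0 p0 yG vq.
have ep : 0 < p / e by rewrite divr_gt0.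
apply: (le_trans (amgm (v * a) y ep)); rewrite ler_wpM2l ?invr_ge0//.
apply: lerD.
  have -> : p / e * (v * a) ^+ 2 = e^-1 * a ^+ 2 * (p * v ^+ 2) by ring.
  have -> : e * a ^+ 2 + e^-1 * C * (q * a ^+ 2) = e^-1 * a ^+ 2 * (e ^+ 2 + C * q).
    by field; rewrite gt_eqF.
  by rewrite ler_wpM2l// mulr_ge0 ?sqr_ge0// invr_ge0 ltW.
rewrite invf_div mulrAC ler_pdivrMr// -mulrA ler_wpM2l ?(ltW e0)//.
by rewrite mulrC.
Qed.

(** The product is split as [(rho / c) (c y)]: the size [1/c] of the multiplier is charged to the
    residual. *)
Lemma amgm_source (e c rho y G : R) : 0 < e -> 0 < c -> (c * y) ^+ 2 <= G ->
  `|rho * y| <= 2^-1 * (e^-1 * (c ^- 2 * rho ^+ 2) + e * G).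
Proof.
move=> e0 c0 yG; have cc : c != 0 by rewrite gt_eqF.
have -> : rho * y = (c^-1 * rho) * (c * y) by field.
have ei : 0 < e^-1 by rewrite invr_gt0.
apply: (le_trans (amgm _ _ ei)); rewrite ler_wpM2l ?invr_ge0// exprMn exprVn invrK.
by rewrite lerD2l ler_wpM2l// ltW.
Qed.

(** Dictionary: [nn] is the dimension, [m] the weight, [N = |x|^2], [G = |grad a|^2],
    [D = x . grad a], [X = x . grad U], [d = div (x m)], [v] the short range part, [rho] the
    residual, [q] the weight near the origin, and [T] a combination of divergences. The gradient
    form in [T] dominates [m^3 G]; all other terms are errors. *)
Lemma gradient_estimate_pointwise (nn K C e c a v rho m N G D q X T : R) :
  0 <= nn -> 0 < e -> 0 < c -> c <= 1 -> 0 < m -> m <= 1 -> 0 <= N ->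
  m ^+ 2 * (1 + c ^+ 2 * N) = 1 -> 0 <= G -> D ^+ 2 <= N * G -> 0 <= K ->
  (1 + N) * v ^+ 2 <= e ^+ 2 + C * q -> `|X| <= K * q ->
  let d := (nn - 1) * m + m ^+ 3 in
  T = (m * G - c ^+ 2 * m ^+ 3 * D ^+ 2) +
      2^-1 * (a * (- (c ^+ 2 * m ^+ 3) * (nn - 1 + 3 * m ^+ 2) * D)) -
      2^-1 * (m * X * a ^+ 2) + (v * a - rho) * (m * D + 2^-1 * d * a) ->
  m ^+ 3 * G <= T + ((nn + 2) * (c + 2 * e)) * a ^+ 2 + ((nn + 2) * (c + 2 * e)) * G
    + (nn + 2) * (e^-1 * (c ^- 2 * rho ^+ 2)) +
    K * (q * a ^+ 2) + (nn + 2) * (e^-1 * C * (q * a ^+ 2)).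
Proof.
move=> nn0 e0 c0 c1 m0 m1 N0 mE G0 DG K0 vq Xq d TE.
have a20 := sqr_ge0 a.
have m30 : 0 < m ^+ 3 by rewrite exprn_gt0.
have m2 : m ^+ 2 <= 1 by rewrite expr_le1// ltW.
have m20 : 0 <= m ^+ 2 by exact: sqr_ge0.
have m31 : m ^+ 3 <= 1 by rewrite expr_le1// ltW.
(* The constant [nn + 2] bounds both [m^2 (nn - 1 + 3 m^2)] and [d] in absolute value. *)
have k0 : 0 <= nn + 2 by lra.
(* Writing [m] as [m^3 (1 + c^2 N)] leaves [m^3 G] plus [c^2 m^3 (N G - D^2)], which is nonnegative
   by Cauchy-Schwarz. *)
have Q : m ^+ 3 * G <= m * G - c ^+ 2 * m ^+ 3 * D ^+ 2.
  have -> : m * G = m ^+ 3 * G + c ^+ 2 * m ^+ 3 * (N * G).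
    by rewrite -[m in LHS]mulr1 -mE; ring.
  by rewrite -addrA lerDl -mulrBr mulr_ge0 ?subr_ge0// mulr_ge0 ?sqr_ge0// ltW.
(* Since [c m |x| <= 1], this is a component of the gradient with a bounded coefficient. *)
pose z := c * m * D.
have zG : z ^+ 2 <= G.
  have -> : z ^+ 2 = m ^+ 2 * (c ^+ 2 * D ^+ 2) by rewrite /z; ring.
  have -> : G = m ^+ 2 * (G + c ^+ 2 * (N * G)).
    by rewrite -[LHS]mul1r -mE; ring.
  by rewrite ler_wpM2l// ler_wpDl// ler_wpM2l// sqr_ge0.
have t1 : `|2^-1 * (a * (- (c ^+ 2 * m ^+ 3) * (nn - 1 + 3 * m ^+ 2) * D))| <=
    2^-1 * (c * (nn + 2)) * (2^-1 * (a ^+ 2 + G)).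
  have -> : 2^-1 * (a * (- (c ^+ 2 * m ^+ 3) * (nn - 1 + 3 * m ^+ 2) * D)) =
    2^-1 * (c * (- m ^+ 2 * (nn - 1 + 3 * m ^+ 2))) * (a * z) by rewrite /z; ring.
  rewrite normrM; apply: ler_pM => //.
    rewrite normrM (gtr0_norm (_ : 0 < 2^-1)) ?invr_gt0// ler_wpM2l ?invr_ge0//.
    rewrite normrM (gtr0_norm c0) ler_wpM2l ?(ltW c0)// mulNr normrN normrM.
    rewrite ger0_norm// -[leRHS]mul1r ler_pM// ler_norml; apply/andP; split; lra.
  apply: (le_trans (amgm a z ltr01)).
  by rewrite invr1 !mul1r ler_wpM2l ?invr_ge0// lerD2l.
have t2 : `|2^-1 * (m * X * a ^+ 2)| <= 2^-1 * K * (q * a ^+ 2).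
  rewrite normrM (gtr0_norm (_ : 0 < 2^-1)) ?invr_gt0// -[leRHS]mulrA.
  rewrite ler_wpM2l ?invr_ge0// [leRHS]mulrA normrM (ger0_norm a20) ler_wpM2r//.
  rewrite normrM (gtr0_norm m0) -[leRHS]mul1r ler_pM// ltW//.
have p1 : 0 < 1 + N by lra.
have t3 : `|v * a * (m * D)| <= 2^-1 * (e * a ^+ 2 + e^-1 * C * (q * a ^+ 2) + e * G).
  apply: amgm_short_range vq => //.
  rewrite exprMn -[leRHS]mul1r ler_pM ?sqr_ge0//.
  by apply: (le_trans DG); rewrite ler_wpM2r// lerDr.
have t4 : `|rho * (m * D)| <= 2^-1 * (e^-1 * (c ^- 2 * rho ^+ 2) + e * G).
  by apply: amgm_source => //; rewrite mulrA.
have d1 : `|2^-1 * d| <= 2^-1 * (nn + 2).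
  rewrite normrM (gtr0_norm (_ : 0 < 2^-1)) ?invr_gt0// ler_wpM2l ?invr_ge0//.
  have : nn * m <= nn by rewrite ler_piMr.
  have : 0 <= nn * m by rewrite mulr_ge0// ltW.
  by rewrite /d ler_norml => ? ?; apply/andP; split; lra.
have t5 : `|(2^-1 * d) * (v * a * a)| <= 2^-1 * (nn + 2) *
    (2^-1 * (e * a ^+ 2 + e^-1 * C * (q * a ^+ 2) + e * a ^+ 2)).
  rewrite normrM ler_pM//; apply: amgm_short_range vq => //.
  by rewrite mulrDl mul1r lerDl mulr_ge0.
have t6 : `|(2^-1 * d) * (rho * a)| <= 2^-1 * (nn + 2) *
    (2^-1 * (e^-1 * (c ^- 2 * rho ^+ 2) + e * a ^+ 2)).
  rewrite normrM ler_pM//; apply: amgm_source => //.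
  by rewrite exprMn -[leRHS]mul1r ler_wpM2r// expr_le1// ltW.
move: t1 t2 t3 t4 t5 t6; rewrite !ler_norml.
move=> /andP[t1 _] /andP[_ t2] /andP[t3 _] /andP[_ t4] /andP[t5 _] /andP[_ t6].
have q0 : 0 <= K * q by apply: le_trans Xq.
have Cq0 : 0 <= (K * (q * a ^+ 2)) by rewrite mulrA mulr_ge0.
have Cq : 0 <= e * a ^+ 2 + e^-1 * C * (q * a ^+ 2).
  have -> : e * a ^+ 2 + e^-1 * C * (q * a ^+ 2) = e^-1 * a ^+ 2 * (e ^+ 2 + C * q).
    by field; rewrite gt_eqF.
  apply: mulr_ge0; first by rewrite mulr_ge0// invr_ge0 ltW.
  by apply: le_trans vq; rewrite mulr_ge0 ?sqr_ge0// ltW.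
have h1 := mulr_ge0 nn0 Cq.
have h2 : 0 <= e^-1 * (c ^- 2 * rho ^+ 2).
  by rewrite mulr_ge0 ?invr_ge0 ?(ltW e0)// mulr_ge0 ?sqr_ge0// invr_ge0 sqr_ge0.
have h3 := mulr_ge0 nn0 h2.
have h4 : 0 <= c * a ^+ 2 by rewrite mulr_ge0// ltW.
have h5 : 0 <= c * G by rewrite mulr_ge0// ltW.
have h6 : 0 <= e * G by rewrite mulr_ge0// ltW.
have h7 : 0 <= e * a ^+ 2 by rewrite mulr_ge0// ltW.
have h8 := mulr_ge0 nn0 h4.
have h9 := mulr_ge0 nn0 h5.
have h10 := mulr_ge0 nn0 h6.
have h11 := mulr_ge0 nn0 h7.
apply: (le_trans Q).
have -> : m * G - c ^+ 2 * m ^+ 3 * D ^+ 2 = T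
  - 2^-1 * (a * (- (c ^+ 2 * m ^+ 3) * (nn - 1 + 3 * m ^+ 2) * D))
  + 2^-1 * (m * X * a ^+ 2) - v * a * (m * D) + rho * (m * D)
  - (2^-1 * d) * (v * a * a) + (2^-1 * d) * (rho * a).
  by rewrite TE; ring.
(* From here on the nonlinear products are generalized to atoms, so that a linear combination of the
   bounds concludes. *)
clear TE Q zG d1.
move: t1 t2 t3 t4 t5 t6.
move: (2^-1 * (a * _)) (2^-1 * (m * X * _)) (v * a * (m * D)) (rho * (m * D))
  (2^-1 * d * (v * a * a)) (2^-1 * d * (rho * a)) => s1 s2 s3 s4 s5 s6.
move: h2 h3 Cq h1 Cq0; rewrite -!(mulrA e^-1).
move: (e^-1 * (c ^- 2 * rho ^+ 2)) => rc.
move: (q * a ^+ 2) => qa.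
rewrite !(mulrA e^-1).
lra.
Qed.

Lemma weighted_radial (c m N G D : R) : m ^+ 2 * (1 + c ^+ 2 * N) = 1 -> 0 <= G ->
  D ^+ 2 <= N * G -> (c * m * D) ^+ 2 <= G.
Proof.
move=> mE G0 DG.
have -> : (c * m * D) ^+ 2 = m ^+ 2 * (c ^+ 2 * D ^+ 2) by ring.
have -> : G = m ^+ 2 * (G + c ^+ 2 * (N * G)).
  by rewrite -[LHS]mul1r -mE; ring.
by rewrite ler_wpM2l ?sqr_ge0// ler_wpDl// ler_wpM2l// sqr_ge0.
Qed.

(** Here [U] is [Vinf - E], [P = grad U . grad a], and [T] is the divergence of [m^3 U a grad a]
    once the Laplacian has been replaced through the equation. Errors containing the gradient keep
    the factor [m^3], so the gradient estimate can absorb them. *)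
Lemma energy_estimate_pointwise (nn K C e c a v rho m N G D P q T U : R) :
  0 < e -> 0 < c -> c <= 1 -> 0 < m -> m <= 1 -> 0 <= N ->
  m ^+ 2 * (1 + c ^+ 2 * N) = 1 -> 0 <= G -> D ^+ 2 <= N * G -> 0 <= K ->
  P ^+ 2 <= nn * K ^+ 2 * G -> `|U| <= K ->
  (1 + N) * v ^+ 2 <= e ^+ 2 + C * q ->
  T = m ^+ 3 * U * a * ((U + v) * a - rho) + m ^+ 3 * U * G +
      a * (- 3 * c ^+ 2 * m ^+ 5 * U * D + m ^+ 3 * P) ->
  m ^+ 3 * U ^+ 2 * a ^+ 2 <= T + (4 * K + 1) * e * a ^+ 2 +
    (K + e^-1 * (2 * K + nn * K ^+ 2)) * (m ^+ 3 * G) +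
    K * e^-1 * (c ^- 2 * rho ^+ 2) + 2^-1 * K * e^-1 * C * (q * a ^+ 2).
Proof.
move=> e0 c0 c1 m0 m1 N0 mE G0 DG K0 PG UK vq TE.
have a20 := sqr_ge0 a.
have ei0 : 0 < e^-1 by rewrite invr_gt0.
have m30 : 0 < m ^+ 3 by rewrite exprn_gt0.
have m31 : m ^+ 3 <= 1 by rewrite expr_le1// ltW.
have zG := weighted_radial mE G0 DG.
have m3U : `|m ^+ 3 * U| <= K.
  by rewrite normrM (gtr0_norm m30) -[leRHS]mul1r ler_pM// ltW.
have s1 : `|m ^+ 3 * U * (v * a * a)| <=
    K * (2^-1 * (e * a ^+ 2 + e^-1 * C * (q * a ^+ 2) + e * a ^+ 2)).
  rewrite normrM ler_pM//; apply: amgm_short_range vq => //; first lra.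
  by rewrite mulrDl mul1r lerDl mulr_ge0.
have s2 : `|m ^+ 3 * U * (rho * a)| <=
    K * (2^-1 * (e^-1 * (c ^- 2 * rho ^+ 2) + e * a ^+ 2)).
  rewrite normrM ler_pM//; apply: amgm_source => //.
  by rewrite exprMn -[leRHS]mul1r ler_wpM2r// expr_le1// ltW.
have s3 : `|U * (m ^+ 3 * G)| <= K * (m ^+ 3 * G).
  by rewrite normrM (ger0_norm (_ : 0 <= m ^+ 3 * G)) ?ler_wpM2r ?mulr_ge0// ltW.
have ea2 : m ^+ 3 * (e * a ^+ 2) <= e * a ^+ 2 by rewrite ler_piMl// mulr_ge0// ltW.
have s4 : `|3 * (c * m * U) * (m ^+ 3 * (a * (c * m * D)))| <=
    3 * K * (2^-1 * (e * a ^+ 2 + e^-1 * (m ^+ 3 * G))).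
  rewrite normrM; apply: ler_pM => //.
    rewrite normrM (ger0_norm (_ : 0 <= 3))// ler_wpM2l// normrM.
    by rewrite -[leRHS]mul1r ler_pM// normrM !gtr0_norm// -[leRHS]mul1r ler_pM// ltW.
  rewrite normrM (gtr0_norm m30).
  apply: (le_trans (ler_wpM2l (ltW m30) (amgm a (c * m * D) e0))).
  have h : m ^+ 3 * (e^-1 * (c * m * D) ^+ 2) <= e^-1 * (m ^+ 3 * G).
    by rewrite mulrCA ler_wpM2l ?(ltW ei0)// ler_wpM2l// ltW.
  lra.
have s5 : `|m ^+ 3 * (a * P)| <=
    2^-1 * (e * a ^+ 2 + e^-1 * (nn * K ^+ 2 * (m ^+ 3 * G))).
  rewrite normrM (gtr0_norm m30).
  apply: (le_trans (ler_wpM2l (ltW m30) (amgm a P e0))).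
  have h : m ^+ 3 * (e^-1 * P ^+ 2) <= e^-1 * (nn * K ^+ 2 * (m ^+ 3 * G)).
    by rewrite mulrCA ler_wpM2l ?(ltW ei0)// [leRHS]mulrCA ler_wpM2l// ltW.
  lra.
have -> : m ^+ 3 * U ^+ 2 * a ^+ 2 = T - m ^+ 3 * U * (v * a * a) +
    m ^+ 3 * U * (rho * a) - U * (m ^+ 3 * G) +
    3 * (c * m * U) * (m ^+ 3 * (a * (c * m * D))) - m ^+ 3 * (a * P).
  by rewrite TE; ring.
clear TE.
have mG0 : 0 <= m ^+ 3 * G by rewrite mulr_ge0// ltW.
have rc0 : 0 <= c ^- 2 * rho ^+ 2.
  by apply: mulr_ge0; [rewrite invr_ge0 sqr_ge0|exact: sqr_ge0].
have h2 := mulr_ge0 (ltW e0) a20; have h1 := mulr_ge0 K0 h2.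
have h3 := mulr_ge0 K0 (mulr_ge0 (ltW ei0) mG0).
have h4 := mulr_ge0 K0 (mulr_ge0 (ltW ei0) rc0).
have h5 : 0 <= e^-1 * (nn * K ^+ 2 * (m ^+ 3 * G)).
  apply: (mulr_ge0 (ltW ei0)); rewrite mulrCA; apply: (mulr_ge0 (ltW m30)).
  by apply: le_trans PG; exact: sqr_ge0.
move: s1 s2 s3 s4 s5; rewrite !ler_norml.
move=> /andP[s1 _] /andP[_ s2] /andP[s3 _] /andP[_ s4] /andP[s5 _].
move: s1 s2 s3 s4 s5.
move: (m ^+ 3 * U * (v * a * a)) (m ^+ 3 * U * (rho * a)) (U * (m ^+ 3 * G))
 (3 * (c * m * U) * _) (m ^+ 3 * (a * P)) => r1 r2 r3 r4 r5.
move: h3 h4 h5 mG0 rc0; move: (m ^+ 3 * G) (c ^- 2 * rho ^+ 2) (q * a ^+ 2) => mG rc qa.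
lra.
Qed.

(** Here [S = |grad U|^2], [P = grad U . grad a], and [d], [Q] are the divergence of
    [m^3 |x|^2 grad U] and its Jacobian evaluated on [grad a]. The combination [T1 - 2 T2] removes
    the product of [U a] with [m^3 N P], which is not small, and leaves the force term
    [m^3 N S a^2]. *)
Lemma angular_estimate_pointwise (nn K C e c a v rho m N G P S Q d q T1 T2 U : R) :
  0 < e -> 0 < c -> 0 < m -> m <= 1 -> 0 <= N ->
  m ^+ 2 * (1 + c ^+ 2 * N) = 1 -> 0 <= G -> 0 <= K -> 0 <= nn ->
  N * P ^+ 2 <= nn * K ^+ 2 * G ->
  `|d| <= 6 * nn * K * m ^+ 3 -> `|Q| <= 6 * nn * K * (m ^+ 3 * G) ->
  (1 + N) * v ^+ 2 <= e ^+ 2 + C * q ->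
  T1 = (d * U + m ^+ 3 * N * S) * a ^+ 2 + 2 * (U * a) * (m ^+ 3 * N * P) ->
  T2 = ((U + v) * a - rho) * (m ^+ 3 * N * P) + Q - 2^-1 * d * G ->
  m ^+ 3 * N * S * a ^+ 2 <= (T1 - 2 * T2) +
    (3 * nn * K * e^-1) * (m ^+ 3 * U ^+ 2 * a ^+ 2) +
    ((3 * nn * K + 1) * e) * a ^+ 2 + (2 * nn * K ^+ 2 * e) * G +
    (e^-1 * C) * (q * a ^+ 2) + e^-1 * (c ^- 2 * rho ^+ 2) +
    (18 * nn * K) * (m ^+ 3 * G).
Proof.
move=> e0 c0 m0 m1 N0 mE G0 K0 nn0 PG dK QK vq T1E T2E.
have a20 := sqr_ge0 a.
have ei0 : 0 < e^-1 by rewrite invr_gt0.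
have m30 : 0 < m ^+ 3 by rewrite exprn_gt0.
have m31 : m ^+ 3 <= 1 by rewrite expr_le1// ltW.
have m21 : m ^+ 2 <= 1 by rewrite expr_le1// ltW.
have m61 : m ^+ 6 <= 1 by rewrite expr_le1// ltW.
have nKG : 0 <= nn * K ^+ 2 * G.
  by apply: le_trans PG; rewrite mulr_ge0// sqr_ge0.
pose P' := m ^+ 3 * N * P.
have P'1 : P' ^+ 2 <= (1 + N) * (nn * K ^+ 2 * G).
  have -> : P' ^+ 2 = m ^+ 6 * (N * (N * P ^+ 2)) by rewrite /P'; ring.
  apply: (@le_trans _ _ (1 * (N * (nn * K ^+ 2 * G)))); last first.
    by rewrite mul1r ler_wpM2r// lerDr.
  rewrite ler_pM ?exprn_ge0 ?(ltW m0)//; first by rewrite mulr_ge0// mulr_ge0// sqr_ge0.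
  by rewrite ler_wpM2l.
have P'2 : (c * P') ^+ 2 <= nn * K ^+ 2 * G.
  have -> : (c * P') ^+ 2 = (m ^+ 2 * m ^+ 2) * (m ^+ 2 * (c ^+ 2 * N)) * (N * P ^+ 2).
    by rewrite /P'; ring.
  have mcN : m ^+ 2 * (c ^+ 2 * N) <= 1.
    by rewrite -mE mulrDr mulr1 lerDr sqr_ge0.
  have m20 : 0 <= m ^+ 2 by exact: sqr_ge0.
  have mcN0 : 0 <= m ^+ 2 * (c ^+ 2 * N) by rewrite mulr_ge0// mulr_ge0// sqr_ge0.
  have NP0 : 0 <= N * P ^+ 2 by rewrite mulr_ge0// sqr_ge0.
  apply: (le_trans _ PG); rewrite -[leRHS]mul1r ler_wpM2r//.
  by apply: mulr_ile1 => //; [exact: mulr_ge0|exact: mulr_ile1].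
have s1 : `|d * (U * a * a)| <= 6 * nn * K * m ^+ 3 *
    (2^-1 * (e^-1 * (U * a) ^+ 2 + e * a ^+ 2)).
  rewrite normrM ler_pM//.
  by have := amgm (U * a) a ei0; rewrite invrK.
have s1' : 6 * nn * K * m ^+ 3 * (2^-1 * (e^-1 * (U * a) ^+ 2 + e * a ^+ 2)) <=
    3 * nn * K * e^-1 * (m ^+ 3 * U ^+ 2 * a ^+ 2) + 3 * nn * K * (e * a ^+ 2).
  have : 3 * nn * K * (m ^+ 3 * (e * a ^+ 2)) <= 3 * nn * K * (e * a ^+ 2).
    rewrite ler_wpM2l ?mulr_ge0//.
    by rewrite ler_piMl// mulr_ge0// ltW.
  have -> : (U * a) ^+ 2 = U ^+ 2 * a ^+ 2 by ring.
  lra.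
have s2 : `|v * a * P'| <=
    2^-1 * (e * a ^+ 2 + e^-1 * C * (q * a ^+ 2) + e * (nn * K ^+ 2 * G)).
  by apply: amgm_short_range vq => //; lra.
have s3 : `|rho * P'| <=
    2^-1 * (e^-1 * (c ^- 2 * rho ^+ 2) + e * (nn * K ^+ 2 * G)).
  exact: amgm_source.
have s4 : `|d * G| <= 6 * nn * K * (m ^+ 3 * G).
  by rewrite normrM (ger0_norm G0) mulrA ler_wpM2r.
have -> : m ^+ 3 * N * S * a ^+ 2 = T1 - 2 * T2 - d * (U * a * a) +
    2 * (v * a * P') - 2 * (rho * P') + 2 * Q - d * G.
  by rewrite T1E T2E /P'; field.
clear T1E T2E.
move: s1 s2 s3 s4 QK; rewrite !ler_norml.
move=> /andP[s1 _] /andP[_ s2] /andP[s3 _] /andP[s4 _] /andP[_ QK].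
move: s1 s1' s2 s3 s4 QK.
move: (d * (U * a * a)) (v * a * P') (rho * P') (d * G) => r1 r2 r3 r4.
move: (m ^+ 3 * G) (c ^- 2 * rho ^+ 2) (q * a ^+ 2) => mG rc qa.
move: (_ * (2^-1 * (e^-1 * (U * a) ^+ 2 + e * a ^+ 2))) => s.
move: (m ^+ 3 * U ^+ 2 * a ^+ 2) => w3.
lra.
Qed.

End pointwise_estimates.

(** * Estimates on test functions *)

(** The data of class C^2 that the multiplier identities use, with derivatives as explicit fields;
    [smooth_testfn] builds it from a smooth function of compact support. *)
Record testfn (R : realType) (n : nat) := Testfn {
  tfun :> 'rV[R]_n -> R;
  tgrad : 'I_n -> 'rV[R]_n -> R;
  thess : 'I_n -> 'I_n -> 'rV[R]_n -> R;
  tfun_ccont : ccont tfun;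
  tfun_grad : has_grad tfun tgrad;
  tgrad_grad : forall i, has_grad (tgrad i) (thess i);
  thess_sym : forall i k x, thess i k x = thess k i x }.

Lemma combine_bounds {R : realType} (k A1 A2 A3 x y w r s z : R) :
  0 <= k -> 0 <= A1 -> 0 <= A2 -> 0 <= A3 -> 0 <= y -> 0 <= w -> 0 <= r ->
  0 <= s -> 0 <= z ->
  k * x + A1 * w + A2 * r + A3 * s <=
  k * (x + y) + (A1 + A2 + A3) * (w + (z + s + r)).
Proof.
move=> k0 A10 A20 A30 y0 w0 r0 s0 z0; rewrite -subr_ge0.
rewrite (_ : _ - _ = k * y + A1 * (z + s + r) + A2 * (w + z + s) +
  A3 * (w + z + r)); last by ring.
by rewrite !addr_ge0// mulr_ge0// !addr_ge0.
Qed.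

Section energy_estimates.
Context {R : realType} {n : nat}.
Local Notation rV := 'rV[R]_n.
Context (U v : rV -> R) (dU : 'I_n -> rV -> R) (ddU : 'I_n -> 'I_n -> rV -> R).
Context (K : R) (K0 : 0 <= K).
Context (gU : has_grad U dU) (gdU : forall i, has_grad (dU i) (ddU i)).
Context (cv : continuous v).
Context (UK : forall x, `|U x| <= K) (dUK : forall i x, `|dU i x| <= K).
Context (dUrK : forall i x, enorm x * `|dU i x| <= K).
Context (ddUK : forall i k x, enorm x ^+ 2 * `|ddU i k x| <= K).

Let q (x : rV) : R := (1 + dotrV x x)^-1.

Context (radial : forall x : rV, `|\sum_(i < n) x ord0 i * dU i x| <= K * q x).
Context (vq : forall e : R, 0 < e -> exists2 C : R, 0 <= C &
  forall x : rV, (1 + dotrV x x) * v x ^+ 2 <= e + C * q x).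

Implicit Types (t : testfn R n) (c eta : R) (x : rV).

Let L t x := \sum_(i < n) thess t i i x.
Let G t x := \sum_(i < n) tgrad t i x ^+ 2.
Definition residual t x := - L t x + (U x + v x) * t x.
Let E0 t := integ (fun x => t x ^+ 2).
Let E1 t := integ (G t).
Let Er t := integ (fun x => residual t x ^+ 2).
Let Eq t := integ (fun x => q x * t x ^+ 2).
Let B t := E0 t + E1 t.
Let Z c t := c * B t + Eq t + c ^- 2 * Er t.

Let cq : continuous q.
Proof.
apply: continuous_inv => [|x]; last by rewrite gt_eqF// ltr_pwDl ?dotrV_ge0.
by apply: continuous_add; [exact: cst_continuous|exact: continuous_dotrV].
Qed.

Let q_ge0 x : 0 <= q x.
Proof. by rewrite invr_ge0 addr_ge0 ?dotrV_ge0. Qed.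

Let cw c : continuous (weight c : rV -> R).
Proof. exact: (weight_grad c).1. Qed.

Let ct t : continuous t. Proof. exact: (tfun_grad t).1. Qed.

Let ccg t i : ccont (tgrad t i).
Proof.
apply: partial_ccont (tfun_ccont t) _ _; first exact: ((tfun_grad t).2 i).2.
exact: ((tfun_grad t).2 i).1.
Qed.

Let ccsq (f : rV -> R) : ccont f -> ccont (fun x => f x ^+ 2).
Proof.
by move=> cf; under eq_fun do rewrite expr2; apply: ccontM => //; exact: cf.1.
Qed.

Let ccG t : ccont (G t).
Proof. by apply: ccont_sum => i; exact: ccsq. Qed.

Let ccL t : ccont (L t).
Proof.
apply: ccont_sum => i; apply: partial_ccont (ccg t i) _ _.
  exact: ((tgrad_grad t i).2 i).2.
exact: ((tgrad_grad t i).2 i).1.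
Qed.

Lemma ccont_residual t : ccont (residual t).
Proof.
apply: ccontD; first exact/ccontN/ccL.
apply: ccontMl (tfun_ccont t).
by apply: continuous_add => //; exact: gU.1.
Qed.

Let ccr t : ccont (fun x => residual t x ^+ 2).
Proof. exact/ccsq/ccont_residual. Qed.

Let cca t : ccont (fun x => t x ^+ 2).
Proof. exact/ccsq/tfun_ccont. Qed.

Let ccq t : ccont (fun x => q x * t x ^+ 2).
Proof. exact: ccontMl. Qed.

Let E0_ge0 t : 0 <= E0 t.
Proof. by apply: integ_ge0 => x; exact: sqr_ge0. Qed.

Let G_ge0 t x : 0 <= G t x.
Proof. by apply: sumr_ge0 => i _; exact: sqr_ge0. Qed.

Let E1_ge0 t : 0 <= E1 t.
Proof. exact: integ_ge0. Qed.

Let Er_ge0 t : 0 <= Er t.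
Proof. by apply: integ_ge0 => x; exact: sqr_ge0. Qed.

Let Eq_ge0 t : 0 <= Eq t.
Proof. by apply: integ_ge0 => x; rewrite mulr_ge0 ?sqr_ge0. Qed.

Let B_ge0 t : 0 <= B t. Proof. by rewrite addr_ge0. Qed.

Let Z_ge0 c t : 0 < c -> 0 <= Z c t.
Proof.
move=> c0; rewrite addr_ge0// ?mulr_ge0 ?invr_ge0 ?sqr_ge0//.
by rewrite addr_ge0// mulr_ge0// ltW.
Qed.

Let Le t x : L t x = (U x + v x) * t x - residual t x.
Proof. by rewrite /residual; ring. Qed.

(** The multiplier is [t] itself, with [U] and [v] bounded. In [mass_estimate] this makes [B t]
    bounded. *)
Lemma gradient_bound : exists2 M : R, 0 <= M &
  forall t, E1 t <= M * E0 t + Er t.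
Proof.
have [C C0 vC] := vq ltr01.
exists (K + C + 2) => [|t]; first by rewrite !addr_ge0.
have [cT IT] := scalar_multiplier (tfun_ccont t) (tfun_grad t) (tgrad_grad t)
  (has_grad_cst 1).
have := @integ_le_comb _ _ (G t) [:: (1, _); (K + C + 2, _); (1, _)] (ccG t)
  (conj cT (conj (cca t) (conj (ccr t) I))).
rewrite !big_cons !big_nil /= IT addr0 mulr0 add0r mul1r; apply => x.
rewrite !big_cons big_nil /= !mul1r addr0.
have -> : \sum_(i < n) 0 * tgrad t i x = 0 by rewrite big1// => i _; rewrite mul0r.
rewrite mulr0 addr0 -/(L t x) -/(G t x) Le.
have v2 : v x ^+ 2 <= 1 + C.
  have qx1 : q x <= 1 by rewrite /q invf_le1 ?ltr_pwDl ?dotrV_ge0// lerDl dotrV_ge0.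
  apply: (@le_trans _ _ ((1 + dotrV x x) * v x ^+ 2)).
    by rewrite ler_peMl ?sqr_ge0// lerDl dotrV_ge0.
  by apply: (le_trans (vC x)); rewrite lerD2l ler_piMr.
have v1 : `|v x| <= 1 + C.
  by have := amgm (v x) 1 ltr01; rewrite mulr1 invr1 !mul1r expr1n; lra.
have := UK x; move: v1; rewrite !ler_norml => /andP[h1 _] /andP[h2 _].
have h3 : - ((U x + v x) * t x ^+ 2) <= (K + C + 1) * t x ^+ 2.
  by rewrite -mulNr ler_wpM2r ?sqr_ge0//; lra.
have := amgm (residual t x) (t x) ltr01.
rewrite invr1 !mul1r ler_norml => /andP[_ h4].
have := sqr_ge0 (residual t x); have := sqr_ge0 (t x).
lra.
Qed.

(* On families with [B t] bounded, [W c t] is [o(1)] as soon as [c], the mass of [t]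
   near the origin and [c^-1] times the norm of the residual are. *)
Definition negligible (W : R -> testfn R n -> R) := forall eta, 0 < eta ->
  exists2 C : R, 0 <= C & forall c t, 0 < c -> c <= 1 ->
    W c t <= eta * B t + C * Z c t.

(** The constant [C] multiplying [W] is fixed before the accuracy required of [W] is chosen; asking
    for [eta / 2 / (C + 1)] then costs at most [eta / 2]. *)
Lemma negligible_trans (W W' : R -> testfn R n -> R) :
  negligible W ->
  (forall eta, 0 < eta -> exists2 C : R, 0 <= C &
    forall c t, 0 < c -> c <= 1 -> W' c t <= eta * B t + C * (W c t + Z c t)) ->
  negligible W'.
Proof.
move=> nW WW' eta eta0; have eta2 : 0 < eta / 2 by rewrite divr_gt0.
have [C C0 CW] := WW' _ eta2.
have e' : 0 < eta / 2 / (C + 1) by rewrite divr_gt0// ltr_wpDl.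
have [C' C'0 C'W] := nW _ e'.
exists (C * (C' + 1)) => [|c t c0 c1]; first by rewrite mulr_ge0// addr_ge0.
apply: (le_trans (CW _ _ c0 c1)).
have h1 : C * W c t <= C * (eta / 2 / (C + 1) * B t + C' * Z c t).
  by rewrite ler_wpM2l//; exact: C'W.
have h2 : C * (eta / 2 / (C + 1) * B t) <= eta / 2 * B t.
  rewrite mulrA ler_wpM2r// mulrCA ler_piMr ?(ltW eta2)//.
  by rewrite ler_pdivrMr ?mul1r ?lerDl// ltr_wpDl.
lra.
Qed.

Lemma negligibleD (W W' : R -> testfn R n -> R) :
  negligible W -> negligible W' -> negligible (fun c t => W c t + W' c t).
Proof.
move=> nW nW' eta eta0; have eta2 : 0 < eta / 2 by rewrite divr_gt0.
have [[C C0 CW] [C' C'0 CW']] := (nW _ eta2, nW' _ eta2).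
exists (C + C') => [|c t c0 c1]; first exact: addr_ge0.
have := CW c t c0 c1; have := CW' c t c0 c1 => /=; lra.
Qed.

Let weight_facts c x : [/\ 0 < weight c x, weight c x <= 1,
  weight c x ^+ 2 * (1 + c ^+ 2 * dotrV x x) = 1 & 0 <= dotrV x x].
Proof.
by split; [exact: weight_gt0|exact: weight_le1|exact: weight_sqrE|exact: dotrV_ge0].
Qed.

Let W1 c t := integ (fun x => weight c x ^+ 3 * G t x).

Let ccW1 c t : ccont (fun x => weight c x ^+ 3 * G t x).
Proof. by apply: ccontMl => //; exact: continuous_exp. Qed.

Let radial_CS t x :
  (\sum_(i < n) x ord0 i * tgrad t i x) ^+ 2 <= dotrV x x * G t x.
Proof.
have := cauchy_schwarz_sum (fun i => x ord0 i) (fun i => tgrad t i x).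
by congr (_ <= _ * _); apply: eq_bigr => i _; rewrite expr2.
Qed.

Let sum_delta (i : 'I_n) (f : 'I_n -> R) : \sum_(k < n) (i == k)%:R * f k = f i.
Proof.
rewrite (bigD1 i)//= eqxx mul1r big1 ?addr0// => k ki.
by rewrite eq_sym (negPf ki) mul0r.
Qed.

(* The multiplier [x / sqrt (1 + c^2 |x|^2)] is the gradient of a convex function
   whose Hessian is at least [weight c ^+ 3], it is bounded by [1 / c], and [U] is
   constant along it outside the unit ball. *)
Section radial_identities.
Context (c : R) (t : testfn R n).
Let w : rV -> R := weight c.
Let D x := \sum_(i < n) x ord0 i * tgrad t i x.
Let d x := (n%:R - 1) * w x + w x ^+ 3.
Let Y (i : 'I_n) (x : rV) := x ord0 i * w x.

Let gw : has_grad w (fun i x => - (c ^+ 2 * x ord0 i * w x ^+ 3)).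
Proof. exact: weight_grad. Qed.

Let gY i := has_gradM (has_grad_coord i) gw.

Let divY x : \sum_(i < n) ((i == i)%:R * w x +
    x ord0 i * - (c ^+ 2 * x ord0 i * w x ^+ 3)) = d x.
Proof.
have [_ _ wE _] := weight_facts c x.
rewrite big_split /= (eq_bigr (fun=> w x)) => [|i _]; last by rewrite eqxx mul1r.
rewrite sumr_const card_ord -mulr_natl.
rewrite (eq_bigr (fun i => - (c ^+ 2 * w x ^+ 3) * (x ord0 i * x ord0 i))); last first.
  by move=> i _; ring.
rewrite -mulr_sumr -/(dotrV x x) /d.
(* One of the [n] copies of [w] is expanded with [w^2 (1 + c^2 |x|^2) = 1]; its second half cancels
   the derivative of the weight and leaves [w^3]. *)
have -> : n%:R * w x = (n%:R - 1) * w x + w x * (w x ^+ 2 * (1 + c ^+ 2 * dotrV x x)).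
  by rewrite wE; ring.
by ring.
Qed.

Let YD x : \sum_(k < n) Y k x * tgrad t k x = w x * D x.
Proof. by rewrite mulr_sumr; apply: eq_bigr => k _; rewrite /Y; ring. Qed.

(** The part of the multiplier given by half the divergence [d] of [Y]; its term [2^-1 d G] is there
    to cancel the opposite one in [radial_vector]. *)
Lemma radial_scalar : exists T, [/\ ccont T, integ T = 0 & forall x, T x =
  2^-1 * d x * t x * L t x + 2^-1 * d x * G t x +
  t x * (2^-1 * (- (c ^+ 2 * w x ^+ 3) * (n%:R - 1 + 3 * w x ^+ 2)) * D x)].
Proof.
have gd := has_gradM (has_grad_cst (2^-1 : R))
  (has_gradD (has_gradM (has_grad_cst (n%:R - 1)) gw) (has_gradM (has_gradM gw gw) gw)).
have [cT IT] := scalar_multiplier (tfun_ccont t) (tfun_grad t) (tgrad_grad t) gd.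
eexists; split; [exact: cT|exact: IT|move=> x /=].
have -> : d x = (n%:R - 1) * w x + w x * w x * w x by rewrite /d; ring.
congr (_ + _ * _); rewrite mulr_sumr; apply: eq_bigr => i _; ring.
Qed.

Lemma radial_vector : exists T, [/\ ccont T, integ T = 0 & forall x, T x =
  L t x * (w x * D x) + (w x * G t x - c ^+ 2 * w x ^+ 3 * D x ^+ 2) -
  2^-1 * d x * G t x].
Proof.
have [cT IT] := vector_multiplier (tfun_ccont t) (tfun_grad t) (tgrad_grad t)
  (thess_sym t) gY.
eexists; split; [exact: cT|exact: IT|move=> x /=].
rewrite divY YD; congr (_ + _ - _).
have -> : w x * G t x - c ^+ 2 * w x ^+ 3 * D x ^+ 2 = \sum_(i < n)
    (w x * tgrad t i x ^+ 2 + (- (c ^+ 2 * w x ^+ 3) * D x) * (x ord0 i * tgrad t i x)).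
  by rewrite big_split /= -!mulr_sumr -/(D x) -/(G t x); ring.
apply: eq_bigr => i _.
rewrite (eq_bigr (fun k => (i == k)%:R * (w x * (tgrad t i x * tgrad t k x)) +
  (- (c ^+ 2 * w x ^+ 3) * (x ord0 i * tgrad t i x)) * (x ord0 k * tgrad t k x))).
  by rewrite big_split /= sum_delta -mulr_sumr -/(D x); ring.
by move=> k _; ring.
Qed.

(** The divergence of [t^2 U Y] trades the product [U t (Y . grad t)] for terms without derivatives
    of [t]. *)
Lemma radial_square : exists T, [/\ ccont T, integ T = 0 & forall x, T x =
  (d x * U x + w x * \sum_(i < n) x ord0 i * dU i x) * t x ^+ 2 +
  2 * t x * (U x * (w x * D x))].
Proof.
have [cT IT] := divergence_square (tfun_ccont t) (tfun_grad t)
  (fun i => has_gradM (gY i) gU).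
eexists; split; [exact: cT|exact: IT|move=> x /=].
congr (_ * _ + _ * _).
  rewrite -divY mulr_suml mulr_sumr -big_split /=; apply: eq_bigr => i _; ring.
by rewrite -YD mulr_sumr; apply: eq_bigr => i _; rewrite /Y; ring.
Qed.

End radial_identities.

Lemma gradient_negligible : negligible W1.
Proof.
move=> eta eta0; pose k : R := n%:R + 2.
have k0 : 0 < k by rewrite ltr_wpDl.
(* The coefficient of [B t] will be [k (c + 2 e)]: the part [2 k e] is [eta], and [k c] is absorbed
   by [Z]. *)
pose e := eta / (2 * k).
have e0 : 0 < e by rewrite divr_gt0// mulr_gt0.
have [C C0 vC] := vq (exprn_gt0 2 e0).
have ei0 : 0 < e^-1 by rewrite invr_gt0.
exists (k + k * e^-1 + K + k * (e^-1 * C)) => [|c t c0 c1].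
  by rewrite !addr_ge0// ?mulr_ge0// ltW.
have [T1 [cT1 IT1 T1E]] := radial_scalar c t.
have [T2 [cT2 IT2 T2E]] := radial_vector c t.
have [T3 [cT3 IT3 T3E]] := radial_square c t.
have := @integ_le_comb _ _ (fun x => weight c x ^+ 3 * G t x)
  [:: (1, T1); (1, T2); (- 2^-1, T3); (k * (c + 2 * e), fun x => t x ^+ 2);
   (k * (c + 2 * e), G t); (k * e^-1 * c ^- 2, fun x => residual t x ^+ 2);
   (K + k * (e^-1 * C), fun x => q x * t x ^+ 2)] (ccW1 c t)
  (conj cT1 (conj cT2 (conj cT3 (conj (cca t) (conj (ccG t) (conj (ccr t)
    (conj (ccq t) I))))))).
rewrite !big_cons !big_nil /= IT1 IT2 IT3 addr0 !mulr0 !add0r => H.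
have {}H : W1 c t <= k * (c + 2 * e) * B t + k * e^-1 * (c ^- 2 * Er t) +
    (K + k * (e^-1 * C)) * Eq t.
  apply: (le_trans (H _)); last by rewrite /B /E0 /E1 /Er /Eq; lra.
  move=> x; rewrite !big_cons big_nil /= addr0 !mul1r.
  have [w0 w1 wE N0] := weight_facts c x.
  have n0 : 0 <= n%:R :> R by [].
  have DG := radial_CS t x.
  set w := weight c x in w0 w1 wE *.
  set D := \sum_(i < n) x ord0 i * tgrad t i x in DG *.
  set d := (n%:R - 1) * w + w ^+ 3.
  (* The terms in [d G] cancel between the first two identities. Once the Laplacian is replaced
     through the equation, the third one removes every undifferentiated [U], so the long range
     potential enters only through [x . grad U]. *)
  have TE : T1 x + T2 x - 2^-1 * T3 x = (w * G t x - c ^+ 2 * w ^+ 3 * D ^+ 2) +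
      2^-1 * (t x * (- (c ^+ 2 * w ^+ 3) * (n%:R - 1 + 3 * w ^+ 2) * D)) -
      2^-1 * (w * (\sum_(i < n) x ord0 i * dU i x) * t x ^+ 2) +
      (v x * t x - residual t x) * (w * D + 2^-1 * d * t x).
    by rewrite T1E T2E T3E Le -/w -/D -/d; field.
  have := gradient_estimate_pointwise n0 e0 c0 c1 w0 w1 N0 wE (G_ge0 t x) DG K0
    (vC x) (radial x) TE.
  by rewrite -/k; lra.
apply: (le_trans H); rewrite /Z.
have -> : eta = k * (2 * e) by rewrite /e; field; rewrite gt_eqF.
have h1 : 0 <= c ^- 2 * Er t by rewrite mulr_ge0 ?invr_ge0 ?sqr_ge0.
have h2 : 0 <= c * B t by rewrite mulr_ge0// ltW.
have k0' := ltW k0.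
have g1 := mulr_ge0 k0' h1; have g2 := mulr_ge0 K0 h1.
have g3 := mulr_ge0 (mulr_ge0 k0' (mulr_ge0 (ltW ei0) C0)) h1.
have g4 := mulr_ge0 (mulr_ge0 k0' (ltW ei0)) h2; have g5 := mulr_ge0 K0 h2.
have g6 := mulr_ge0 (mulr_ge0 k0' (mulr_ge0 (ltW ei0) C0)) h2.
have g7 := mulr_ge0 k0' (Eq_ge0 t).
have g8 := mulr_ge0 (mulr_ge0 k0' (ltW ei0)) (Eq_ge0 t).
lra.
Qed.

Let W3 c t := integ (fun x => weight c x ^+ 3 * U x ^+ 2 * t x ^+ 2).

Let ccW3 c t : ccont (fun x => weight c x ^+ 3 * U x ^+ 2 * t x ^+ 2).
Proof.
apply: ccontMl => //; apply: continuous_mul; first exact: continuous_exp.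
by apply: continuous_exp; exact: gU.1.
Qed.

Let gw3 c : has_grad (fun x => weight c x ^+ 3)
  (fun i x => - 3 * c ^+ 2 * x ord0 i * weight c x ^+ 5).
Proof.
have gw := @weight_grad R n c.
under eq_fun do rewrite exprS expr2.
by apply: has_grad_eq (has_gradM gw (has_gradM gw gw)) => i x /=; ring.
Qed.

Let grad_U_CS t x : (\sum_(i < n) dU i x * tgrad t i x) ^+ 2 <=
  (\sum_(i < n) dU i x ^+ 2) * G t x.
Proof. exact: (cauchy_schwarz_sum (fun i => dU i x)). Qed.

Let grad_U_sq x : \sum_(i < n) dU i x ^+ 2 <= n%:R * K ^+ 2.
Proof.
apply: (@le_trans _ _ (\sum_(i < n) K ^+ 2)).
  by apply: ler_sum => i _; rewrite -real_normK ?num_real// lerXn2r ?nnegrE.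
by rewrite sumr_const card_ord mulr_natl.
Qed.

Let radius_grad_U_sq x : dotrV x x * \sum_(i < n) dU i x ^+ 2 <= n%:R * K ^+ 2.
Proof.
apply: (@le_trans _ _ (\sum_(i < n) K ^+ 2)); last first.
  by rewrite sumr_const card_ord mulr_natl.
rewrite mulr_sumr; apply: ler_sum => i _; rewrite -enorm_sqr -exprMn.
rewrite -real_normK ?num_real// lerXn2r ?nnegrE// normrM.
by rewrite (ger0_norm (enorm_ge0 x)).
Qed.

Lemma potential_scalar c t : exists T, [/\ ccont T, integ T = 0 & forall x, T x =
  weight c x ^+ 3 * U x * t x * L t x + weight c x ^+ 3 * U x * G t x +
  t x * (- 3 * c ^+ 2 * weight c x ^+ 5 * U x * (\sum_(i < n) x ord0 i * tgrad t i x)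
    + weight c x ^+ 3 * \sum_(i < n) dU i x * tgrad t i x)].
Proof.
have [cT IT] := scalar_multiplier (tfun_ccont t) (tfun_grad t) (tgrad_grad t)
  (has_gradM (gw3 c) gU).
eexists; split; [exact: cT|exact: IT|move=> x /=].
congr (_ + _ * _); rewrite !mulr_sumr -big_split /=.
by apply: eq_bigr => i _; ring.
Qed.

Lemma energy_negligible : negligible W3.
Proof.
apply: negligible_trans gradient_negligible _ => eta eta0.
(* The coefficient of [e a^2] in [energy_estimate_pointwise]. *)
pose k : R := 4 * K + 1; have k0 : 0 < k by rewrite ltr_wpDl// mulr_ge0.
pose e := eta / k; have e0 : 0 < e by rewrite divr_gt0.
have [C C0 vC] := vq (exprn_gt0 2 e0).
have ei0 : 0 < e^-1 by rewrite invr_gt0.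
have n0 : 0 <= n%:R :> R by [].
pose A := K + e^-1 * (2 * K + n%:R * K ^+ 2).
have A0 : 0 <= A.
  by rewrite addr_ge0// mulr_ge0 ?(ltW ei0)// addr_ge0// mulr_ge0// sqr_ge0.
have Ke0 : 0 <= K * e^-1 by rewrite mulr_ge0// ltW.
have KC0 : 0 <= 2^-1 * K * e^-1 * C by rewrite -!mulrA !mulr_ge0// ltW.
exists (A + K * e^-1 + 2^-1 * K * e^-1 * C) => [|c t c0 c1].
  by apply: addr_ge0 => //; exact: addr_ge0.
have [T [cT IT TE]] := potential_scalar c t.
have := @integ_le_comb _ _ _
  [:: (1, T); (k * e, fun x => t x ^+ 2); (A, fun x => weight c x ^+ 3 * G t x);
   (K * e^-1 * c ^- 2, fun x => residual t x ^+ 2);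
   (2^-1 * K * e^-1 * C, fun x => q x * t x ^+ 2)] (ccW3 c t)
  (conj cT (conj (cca t) (conj (ccW1 c t) (conj (ccr t) (conj (ccq t) I))))).
rewrite !big_cons !big_nil /= IT addr0 !mulr0 !add0r => H.
have {}H : W3 c t <= k * e * E0 t + A * W1 c t + K * e^-1 * (c ^- 2 * Er t) +
    2^-1 * K * e^-1 * C * Eq t.
  apply: (le_trans (H _)); last by rewrite /E0 /W1 /Er /Eq; lra.
  move=> x; rewrite !big_cons big_nil /= addr0 !mul1r.
  have [w0 w1 wE N0] := weight_facts c x.
  have DG := radial_CS t x.
  have PG : (\sum_(i < n) dU i x * tgrad t i x) ^+ 2 <= n%:R * K ^+ 2 * G t x.
    by apply: (le_trans (grad_U_CS t x)); rewrite ler_wpM2r.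
  have TE' : T x = weight c x ^+ 3 * U x * t x *
      ((U x + v x) * t x - residual t x) + weight c x ^+ 3 * U x * G t x +
      t x * (- 3 * c ^+ 2 * weight c x ^+ 5 * U x *
        (\sum_(i < n) x ord0 i * tgrad t i x) +
        weight c x ^+ 3 * (\sum_(i < n) dU i x * tgrad t i x)).
    by rewrite TE Le.
  have := energy_estimate_pointwise e0 c0 c1 w0 w1 N0 wE (G_ge0 t x) DG K0 PG (UK x)
    (vC x) TE'.
  by rewrite -/k -/A; lra.
apply: (le_trans H); rewrite /Z.
have -> : eta = k * e by rewrite /e; field; rewrite gt_eqF.
have h1 : 0 <= c ^- 2 * Er t by rewrite mulr_ge0 ?invr_ge0 ?sqr_ge0.
have h2 : 0 <= c * B t by rewrite mulr_ge0// ltW.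
have h3 : 0 <= W1 c t.
  apply: integ_ge0 => x; apply: mulr_ge0 => //; apply: exprn_ge0.
  exact/ltW/weight_gt0.
by apply: combine_bounds => //; rewrite mulr_ge0 ?(ltW k0)// ltW.
Qed.

Let W2 c t := integ (fun x => weight c x ^+ 3 * dotrV x x *
  (\sum_(i < n) dU i x ^+ 2) * t x ^+ 2).

Let ccW2 c t : ccont (fun x => weight c x ^+ 3 * dotrV x x *
  (\sum_(i < n) dU i x ^+ 2) * t x ^+ 2).
Proof.
apply: ccontMl => //; apply: continuous_mul.
  apply: continuous_mul; first exact: continuous_exp.
  exact: continuous_dotrV.
by apply: continuous_sum => i; apply: continuous_exp; exact: (gU.2 i).1.
Qed.

(* The multiplier [weight c ^+ 3 * |x|^2 * grad U] sees the force: pairing it with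
   [grad U] produces the weight [|x|^2 |grad U|^2]. *)
Section angular_identities.
Context (c : R) (t : testfn R n).
Let w : rV -> R := weight c.
Let P x := \sum_(i < n) dU i x * tgrad t i x.
Let Y (k : 'I_n) (x : rV) := w x ^+ 3 * dotrV x x * dU k x.
Definition dangular (k i : 'I_n) (x : rV) :=
  (- 3 * c ^+ 2 * x ord0 i * w x ^+ 5 * dotrV x x + w x ^+ 3 * (2 * x ord0 i)) *
  dU k x + w x ^+ 3 * dotrV x x * ddU k i x.

Let gY k : has_grad (Y k) (dangular k).
Proof. exact: has_gradM (has_gradM (gw3 c) has_grad_dotrV) (gdU k). Qed.

(** The growth of [|x|^2] is absorbed by the decay of the first two derivatives of [U], and
    [w^2 c^2 |x|^2 <= 1] handles the derivative of the weight. The constant is [2 + 3] from the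
    first derivatives plus 1 from the second. *)
Lemma dangular_bound k i x : 0 < c -> `|dangular k i x| <= 6 * K * w x ^+ 3.
Proof.
move=> c0; have [w0 w1 wE N0] := weight_facts c x.
have w30 : 0 < w x ^+ 3 by rewrite exprn_gt0.
have xdU : `|x ord0 i * dU k x| <= K.
  rewrite normrM; apply: le_trans (dUrK k x).
  by rewrite ler_wpM2r// coord_le_enorm.
have wcN : w x ^+ 2 * (c ^+ 2 * dotrV x x) <= 1.
  by rewrite -wE mulrDr mulr1 lerDr sqr_ge0.
have wcN0 : 0 <= w x ^+ 2 * (c ^+ 2 * dotrV x x).
  by rewrite mulr_ge0 ?sqr_ge0// mulr_ge0 ?sqr_ge0.
have -> : dangular k i x = w x ^+ 3 *
    ((2 - 3 * (w x ^+ 2 * (c ^+ 2 * dotrV x x))) * (x ord0 i * dU k x) +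
     enorm x ^+ 2 * ddU k i x).
  by rewrite /dangular -enorm_sqr; ring.
rewrite normrM (gtr0_norm w30) mulrC ler_wpM2r ?(ltW w30)//.
apply: (le_trans (ler_normD _ _)).
have h1 : `|enorm x ^+ 2 * ddU k i x| <= K.
  by rewrite normrM (ger0_norm (sqr_ge0 _)).
have h2 : `|(2 - 3 * (w x ^+ 2 * (c ^+ 2 * dotrV x x))) * (x ord0 i * dU k x)| <=
    5 * K.
  by rewrite normrM ler_pM// ler_norml; apply/andP; split; lra.
lra.
Qed.

Let divY x := \sum_(k < n) dangular k k x.
Let hessY x := \sum_(i < n) \sum_(k < n) dangular k i x * (tgrad t i x * tgrad t k x).

Let YP x : \sum_(k < n) Y k x * tgrad t k x = w x ^+ 3 * dotrV x x * P x.
Proof. by rewrite mulr_sumr; apply: eq_bigr => k _; rewrite /Y; ring. Qed.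

Lemma divY_bound x : 0 < c -> `|divY x| <= 6 * n%:R * K * w x ^+ 3.
Proof.
move=> c0; apply: (le_trans (ler_norm_sum _ _ _)).
apply: (@le_trans _ _ (\sum_(i < n) 6 * K * w x ^+ 3)).
  by apply: ler_sum => i _; exact: dangular_bound.
by rewrite sumr_const card_ord -mulr_natl le_eqVlt; apply/orP; left; apply/eqP; ring.
Qed.

Lemma hessY_bound x : 0 < c -> `|hessY x| <= 6 * n%:R * K * (w x ^+ 3 * G t x).
Proof.
move=> c0; apply: (le_trans (ler_norm_sum _ _ _)).
have w30 : 0 <= w x ^+ 3 by rewrite exprn_ge0// ltW// weight_gt0.
apply: (@le_trans _ _ (\sum_(i < n) \sum_(k < n)
    6 * K * w x ^+ 3 * (2^-1 * (tgrad t i x ^+ 2 + tgrad t k x ^+ 2)))).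
  apply: ler_sum => i _; apply: (le_trans (ler_norm_sum _ _ _)).
  apply: ler_sum => k _; rewrite normrM; apply: ler_pM => //.
    exact: dangular_bound.
  by have := amgm (tgrad t i x) (tgrad t k x) ltr01; rewrite invr1 !mul1r.
rewrite le_eqVlt; apply/orP; left; apply/eqP.
under eq_bigr => i _.
  rewrite -mulr_sumr -mulr_sumr big_split /= sumr_const card_ord -/(G t x).
  over.
rewrite -mulr_sumr -mulr_sumr big_split /= sumr_const card_ord sumrMnl -/(G t x).
by rewrite -[G t x *+ n]mulr_natl; field.
Qed.

Lemma angular_vector : exists T, [/\ ccont T, integ T = 0 & forall x, T x =
  L t x * (w x ^+ 3 * dotrV x x * P x) + hessY x - 2^-1 * divY x * G t x].
Proof.
have [cT IT] := vector_multiplier (tfun_ccont t) (tfun_grad t) (tgrad_grad t)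
  (thess_sym t) gY.
eexists; split; [exact: cT|exact: IT|move=> x /=].
by rewrite YP.
Qed.

Lemma angular_square : exists T, [/\ ccont T, integ T = 0 & forall x, T x =
  (divY x * U x + w x ^+ 3 * dotrV x x * \sum_(i < n) dU i x ^+ 2) * t x ^+ 2 +
  2 * (U x * t x) * (w x ^+ 3 * dotrV x x * P x)].
Proof.
have [cT IT] := divergence_square (tfun_ccont t) (tfun_grad t)
  (fun i => has_gradM (gY i) gU).
eexists; split; [exact: cT|exact: IT|move=> x /=].
congr (_ * _ + _).
  rewrite mulr_suml mulr_sumr -big_split /=; apply: eq_bigr => i _.
  by rewrite /Y; ring.
rewrite -YP !mulr_sumr; apply: eq_bigr => i _; rewrite /Y; ring.
Qed.

End angular_identities.

Lemma angular_negligible : negligible W2.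
Proof.
apply: negligible_trans (negligibleD gradient_negligible energy_negligible) _.
move=> eta eta0.
have n0 : 0 <= n%:R :> R by [].
have nK0 : 0 <= 3 * n%:R * K by rewrite !mulr_ge0.
have nK20 : 0 <= 2 * n%:R * K ^+ 2 by rewrite !mulr_ge0// sqr_ge0.
(* The sum of the coefficients of [e a^2] and [e G] in the pointwise bound. *)
pose k : R := 3 * n%:R * K + 1 + 2 * n%:R * K ^+ 2.
have k0 : 0 < k by rewrite ltr_wpDr// ltr_wpDl.
pose e := eta / k; have e0 : 0 < e by rewrite divr_gt0.
have [C C0 vC] := vq (exprn_gt0 2 e0).
have ei0 : 0 < e^-1 by rewrite invr_gt0.
pose A := 18 * n%:R * K + 3 * n%:R * K * e^-1.
have A1 : 0 <= 18 * n%:R * K by rewrite !mulr_ge0.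
have A2 : 0 <= 3 * n%:R * K * e^-1 by rewrite mulr_ge0// ltW.
have A0 : 0 <= A by exact: addr_ge0.
have eC : 0 <= e^-1 * C by rewrite mulr_ge0// ltW.
exists (A + e^-1 + e^-1 * C) => [|c t c0 c1].
  by apply: addr_ge0 => //; apply: addr_ge0 => //; exact: ltW.
have [T1 [cT1 IT1 T1E]] := angular_square c t.
have [T2 [cT2 IT2 T2E]] := angular_vector c t.
have := @integ_le_comb _ _ _
  [:: (1, T1); (- 2, T2);
   (3 * n%:R * K * e^-1, fun x => weight c x ^+ 3 * U x ^+ 2 * t x ^+ 2);
   ((3 * n%:R * K + 1) * e, fun x => t x ^+ 2);
   (2 * n%:R * K ^+ 2 * e, G t);
   (e^-1 * C, fun x => q x * t x ^+ 2);
   (e^-1 * c ^- 2, fun x => residual t x ^+ 2);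
   (18 * n%:R * K, fun x => weight c x ^+ 3 * G t x)] (ccW2 c t)
  (conj cT1 (conj cT2 (conj (ccW3 c t) (conj (cca t) (conj (ccG t) (conj (ccq t)
    (conj (ccr t) (conj (ccW1 c t) I)))))))).
rewrite !big_cons !big_nil /= IT1 IT2 addr0 !mulr0 !add0r => H.
have {}H : W2 c t <= 3 * n%:R * K * e^-1 * W3 c t + (3 * n%:R * K + 1) * e * E0 t +
    2 * n%:R * K ^+ 2 * e * E1 t + e^-1 * C * Eq t + e^-1 * (c ^- 2 * Er t) +
    18 * n%:R * K * W1 c t.
  apply: (le_trans (H _)); last by rewrite /E0 /E1 /W1 /W3 /Er /Eq; lra.
  move=> x; rewrite !big_cons big_nil /= addr0 !mul1r.
  have [w0 w1 wE N0] := weight_facts c x.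
  have PG : dotrV x x * (\sum_(i < n) dU i x * tgrad t i x) ^+ 2 <=
      n%:R * K ^+ 2 * G t x.
    apply: (@le_trans _ _ (dotrV x x * ((\sum_(i < n) dU i x ^+ 2) * G t x))).
      by rewrite ler_wpM2l.
    by rewrite mulrA ler_wpM2r.
  have T2E' := T2E x; rewrite Le in T2E'.
  have := angular_estimate_pointwise e0 c0 w0 w1 N0 wE (G_ge0 t x) K0 n0 PG
    (divY_bound x c0) (hessY_bound t x c0) (vC x) (T1E x) T2E'.
  lra.
apply: (le_trans H).
have w30 x : 0 <= weight c x ^+ 3.
  by apply: exprn_ge0; exact/ltW/weight_gt0.
have h1 : 0 <= W1 c t by apply: integ_ge0 => x; exact: mulr_ge0.
have h3 : 0 <= W3 c t.
  apply: integ_ge0 => x; apply: mulr_ge0; last exact: sqr_ge0.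
  by apply: mulr_ge0 => //; exact: sqr_ge0.
have h2 : 0 <= c * B t by rewrite mulr_ge0// ltW.
have h4 : 0 <= c ^- 2 * Er t by rewrite mulr_ge0 ?invr_ge0 ?sqr_ge0.
apply: (@le_trans _ _ (eta * B t + A * (W1 c t + W3 c t) +
    e^-1 * (c ^- 2 * Er t) + e^-1 * C * Eq t)).
  have -> : eta = k * e by rewrite /e; field; rewrite gt_eqF.
  have g1 := mulr_ge0 A1 h3; have g2 := mulr_ge0 A2 h1.
  have g3 : 0 <= (3 * n%:R * K + 1) * e * E1 t.
    by rewrite mulr_ge0// mulr_ge0 ?(ltW e0)// addr_ge0.
  have g4 : 0 <= (2 * n%:R * K ^+ 2) * e * E0 t.
    by rewrite mulr_ge0// mulr_ge0 ?(ltW e0).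
  by rewrite /B /A /k; lra.
have := @combine_bounds R eta A e^-1 (e^-1 * C) (B t) 0 (W1 c t + W3 c t)
  (c ^- 2 * Er t) (Eq t) (c * B t) (ltW eta0) A0 (ltW ei0) eC (lexx 0)
  (addr_ge0 h1 h3) h4 (Eq_ge0 t) h2.
by rewrite addr0.
Qed.

Context (kappa : R) (kappa0 : 0 < kappa) (noncritical : forall x, 2 <= enorm x ->
  kappa <= U x ^+ 2 + dotrV x x * \sum_(i < n) dU i x ^+ 2).

Let W0 c t := integ (fun x => weight c x ^+ 3 * t x ^+ 2).

Lemma mass_negligible : negligible W0.
Proof.
apply: negligible_trans (negligibleD angular_negligible energy_negligible) _.
(* Beyond radius 2 noncriticality applies, at the price of [kappa^-1]. Inside, [w^3 <= 1 <= 5 q]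
   because [1 + |x|^2 <= 5]. *)
move=> eta eta0; exists (kappa^-1 + 5) => [|c t c0 c1].
  by rewrite addr_ge0// invr_ge0 ltW.
have ki0 : 0 < kappa^-1 by rewrite invr_gt0.
have ccW0 : ccont (fun x => weight c x ^+ 3 * t x ^+ 2).
  by apply: ccontMl => //; exact: continuous_exp.
have := @integ_le_comb _ _ _
  [:: (kappa^-1, fun x => weight c x ^+ 3 * dotrV x x *
         (\sum_(i < n) dU i x ^+ 2) * t x ^+ 2);
      (kappa^-1, fun x => weight c x ^+ 3 * U x ^+ 2 * t x ^+ 2);
      (5, fun x => q x * t x ^+ 2)] ccW0
  (conj (ccW2 c t) (conj (ccW3 c t) (conj (ccq t) I))).
rewrite !big_cons !big_nil /= addr0 => H.
have w30 x : 0 <= weight c x ^+ 3.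
  by apply: exprn_ge0; exact/ltW/weight_gt0.
have S0 x : 0 <= \sum_(i < n) dU i x ^+ 2.
  by apply: sumr_ge0 => i _; exact: sqr_ge0.
have {}H : W0 c t <= kappa^-1 * (W2 c t + W3 c t) + 5 * Eq t.
  apply: (le_trans (H _)); last by rewrite mulrDr addrA.
  move=> x; rewrite !big_cons big_nil /= addr0.
  have a20 := sqr_ge0 (t x).
  have -> : kappa^-1 * (weight c x ^+ 3 * dotrV x x *
       (\sum_(i < n) dU i x ^+ 2) * t x ^+ 2) +
      (kappa^-1 * (weight c x ^+ 3 * U x ^+ 2 * t x ^+ 2) + 5 * (q x * t x ^+ 2)) =
      (weight c x ^+ 3 * (kappa^-1 * (U x ^+ 2 + dotrV x x *
         (\sum_(i < n) dU i x ^+ 2))) + 5 * q x) * t x ^+ 2.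
    by ring.
  rewrite ler_wpM2r//.
  have [x2|x2] := leP 2 (enorm x).
    rewrite ler_wpDr ?mulr_ge0// ler_peMr// mulrC ler_pdivlMr// mul1r.
    exact: noncritical.
  rewrite ler_wpDl//.
    rewrite mulr_ge0// mulr_ge0 ?(ltW ki0)// addr_ge0 ?sqr_ge0//.
    by rewrite mulr_ge0 ?dotrV_ge0.
  apply: (@le_trans _ _ 1); first by apply: exprn_ile1;
    [exact/ltW/weight_gt0|exact: weight_le1].
  rewrite /q ler_pdivlMr ?ltr_pwDl ?dotrV_ge0// mul1r -enorm_sqr.
  have : enorm x ^+ 2 <= 2 ^+ 2 by rewrite lerXn2r ?nnegrE ?enorm_ge0// ltW.
  lra.
apply: (le_trans H).
have h2 : 0 <= c * B t by rewrite mulr_ge0// ltW.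
have h4 : 0 <= c ^- 2 * Er t by rewrite mulr_ge0 ?invr_ge0 ?sqr_ge0.
have h1 : 0 <= W2 c t + W3 c t.
  apply: addr_ge0; apply: integ_ge0 => x; apply: mulr_ge0 (sqr_ge0 _).
    by apply: mulr_ge0 => //; apply: mulr_ge0 => //; exact: dotrV_ge0.
  by apply: mulr_ge0 => //; exact: sqr_ge0.
have := @combine_bounds R eta kappa^-1 0 5 (B t) 0 (W2 c t + W3 c t)
  (c ^- 2 * Er t) (Eq t) (c * B t) (ltW eta0) (ltW ki0) (lexx 0) (ler0n _ 5)
  (lexx 0) h1 h4 (Eq_ge0 t) h2.
rewrite !addr0 mul0r addr0; apply: le_trans.
by rewrite -[leLHS]add0r -addrA lerD2r mulr_ge0// ltW.
Qed.

Lemma mass_estimate (eta : R) : 0 < eta -> exists2 s : R, 0 < s &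
  forall c t, 0 < c -> c < s -> integ (fun x => t x ^+ 2) <= 4 ->
  integ (fun x => residual t x ^+ 2) <= s * c ^+ 2 ->
  integ (fun x => (1 + dotrV x x)^-1 * t x ^+ 2) <= s ->
  integ (fun x => weight c x ^+ 3 * t x ^+ 2) <= eta.
Proof.
move=> eta0; have [M M0 E1M] := gradient_bound.
(* A bound for [B t]: 4 for the mass, and [gradient_bound] with a residual at most 1 for the
   gradient. *)
pose M' := 4 + (M * 4 + 1); have M'0 : 0 < M'.
  by rewrite /M' addr_gt0// ltr_wpDl// mulr_ge0.
have e0 : 0 < eta / 2 / M' by rewrite !divr_gt0.
have [C C0 CW] := mass_negligible e0.
(* [Z] is at most [s (M' + 2)], so [s D <= eta] makes its contribution at most [eta / 2]; [C + 1]
   keeps [D] positive. *)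
pose D := 2 * (C + 1) * (M' + 2).
have D0 : 0 < D.
  by apply: mulr_gt0; [rewrite mulr_gt0// ltr_wpDl|exact: addr_gt0].
exists (Num.min 1 (eta / D)) => [|c t c0]; first by rewrite lt_min ltr01 divr_gt0.
set s := Num.min _ _ => cs E04 Ers Eqs.
have s0 : 0 < s by rewrite lt_min ltr01 divr_gt0.
have s1 : s <= 1 by rewrite ge_min lexx.
have sD : s * D <= eta by rewrite -ler_pdivlMr// ge_min lexx orbT.
have c1 : c <= 1 by rewrite (le_trans (ltW cs)).
have Er' : c ^- 2 * Er t <= s.
  by rewrite mulrC ler_pdivrMr// exprn_gt0.
have Er1 : Er t <= 1.
  apply: (le_trans Ers); rewrite mulr_ile1 ?sqr_ge0 ?(ltW s0)//.
  by rewrite expr_le1// ltW.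
have BM : B t <= M'.
  rewrite /B /M' lerD//; apply: (le_trans (E1M t)); rewrite lerD//.
  by rewrite ler_wpM2l.
apply: (le_trans (CW c t c0 c1)).
have h1 : eta / 2 / M' * B t <= eta / 2.
  by rewrite mulrAC ler_pdivrMr// ler_wpM2l// divr_ge0// ltW.
have h2 : Z c t <= s * (M' + 2).
  have : c * B t <= s * M' by rewrite ler_pM ?(ltW c0)// ltW.
  have Eqs' : Eq t <= s := Eqs.
  have -> : s * (M' + 2) = s * M' + s + s by ring.
  by move=> cB; apply: lerD => //; exact: lerD.
have h3 : C * Z c t <= (C + 1) * (s * (M' + 2)).
  by rewrite ler_pM ?Z_ge0// lerDl.
by move: sD; rewrite /D; lra.
Qed.

End energy_estimates.

Lemma uniform_bound (R : realType) (n : nat) (T : Type) (F : 'I_n -> T -> R) :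
  (forall i, exists2 K, 0 <= K & forall x, F i x <= K) ->
  exists2 K, 0 <= K & forall i x, F i x <= K.
Proof.
move=> H; have {}H i : exists K, 0 <= K /\ forall x, F i x <= K.
  by have [K K0 FK] := H i; exists K.
have [K KP] := choice H; exists (\sum_(i < n) K i).
  by apply: sumr_ge0 => i _; exact: (KP i).1.
move=> i x; rewrite (bigD1 i)//= (le_trans ((KP i).2 x))// lerDl.
by apply: sumr_ge0 => k _; exact: (KP k).1.
Qed.

(** * The bounds on the potential that the estimates require *)

Section long_range_potential.
Context {R : realType} {n : nat}.
Context (V Vinf Vs : 'rV[R]_n -> R).
Context (smooth_V : smooth V) (V_decomp : forall x, V x = Vinf x + Vs x).
Context (smooth_Vinf : smooth Vinf).
Context (Vinf_homog :
  forall x, 1 <= enorm x -> Vinf x = Vinf ((enorm x)^-1 *: x)).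
Context (Vs_decay : forall e : R, 0 < e ->
     exists M : R, forall x, M <= enorm x -> `|Vs x| <= e * (enorm x)^-1).
Context (E : R).

Let dV i : 'rV[R]_n -> R := partial i Vinf.
Let ddV i k : 'rV[R]_n -> R := partial k (partial i Vinf).

Lemma continuous_Vs : continuous Vs.
Proof.
have -> : Vs = (fun x => V x + - Vinf x).
  by apply/funext => x; rewrite V_decomp addrAC subrr add0r.
by apply: continuous_add; [|apply: continuous_opp]; exact: smooth_continuous.
Qed.

Lemma Vinf_bounded : exists2 K, 0 <= K & forall x, `|Vinf x - E| <= K.
Proof.
have [K K0 VK] := homogeneous_bound (Vinf_homogeneous Vinf_homog)
  (smooth_continuous smooth_Vinf).
exists (K + `|E|) => [|x]; first by rewrite addr_ge0.
rewrite (le_trans (ler_normB _ _))// lerD2r.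
by have := VK x; rewrite expr0 mul1r.
Qed.

Lemma Vinf_radius_grad_bounded : exists2 K, 0 <= K &
  forall i x, enorm x * `|dV i x| <= K.
Proof.
apply: uniform_bound => i.
have [K K0 VK] := homogeneous_bound
  (Vinf_partial_homogeneous smooth_Vinf Vinf_homog i)
  (smooth_continuous (smooth_partial i smooth_Vinf)).
by exists K => // x; have := VK x; rewrite expr1.
Qed.

Lemma Vinf_hess_bounded : exists2 K, 0 <= K &
  forall i k x, enorm x ^+ 2 * `|ddV i k x| <= K.
Proof.
have [K K0 KP] : exists2 K, 0 <= K & forall i (kx : 'I_n * 'rV[R]_n),
    enorm kx.2 ^+ 2 * `|ddV i kx.1 kx.2| <= K.
  apply: uniform_bound => i.
  have [K K0 KP] : exists2 K, 0 <= K & forall k x,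
      enorm x ^+ 2 * `|ddV i k x| <= K.
    apply: uniform_bound => k; apply: homogeneous_bound.
      exact: Vinf_partial2_homogeneous.
    by apply: smooth_continuous; exact/smooth_partial/smooth_partial.
  by exists K => // -[k x].
by exists K => // i k x; exact: KP i (k, x).
Qed.

Lemma Vinf_grad_bounded : exists2 K, 0 <= K &
  forall i x, `|dV i x| <= K.
Proof.
have [K1 K10 VK1] := Vinf_radius_grad_bounded.
apply: uniform_bound => i.
have [K K0 VK] := continuous_bounded_enorm_le 1
  (smooth_continuous (smooth_partial i smooth_Vinf)).
exists (K + K1) => [|x]; first exact: addr_ge0.
have [/VK h|x1] := leP (enorm x) 1; first by rewrite ler_wpDr.
apply: (@le_trans _ _ (enorm x * `|dV i x|)).
  by rewrite ler_peMl// ltW.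
by rewrite ler_wpDl.
Qed.

(** The radial derivative vanishes outside the unit ball, and inside it [1 + |x|^2 <= 2]. *)
Lemma Vinf_radial_bounded : exists2 K, 0 <= K & forall x : 'rV[R]_n,
  `|\sum_(i < n) x ord0 i * dV i x| <= K * (1 + dotrV x x)^-1.
Proof.
have cD : continuous (fun x : 'rV[R]_n => \sum_(i < n) x ord0 i * dV i x).
  apply: continuous_sum => i; apply: continuous_mul; first exact: continuous_coord.
  exact/smooth_continuous/smooth_partial.
have [K K0 VK] := continuous_bounded_enorm_le 1 cD.
exists (2 * K) => [|x]; first exact: mulr_ge0.
have p0 : 0 < 1 + dotrV x x by rewrite ltr_pwDl// dotrV_ge0.
have [x1|x1] := leP (enorm x) 1; last first.
  by rewrite (Vinf_radial smooth_Vinf Vinf_homog x1) normr0 !mulr_ge0// invr_ge0 ltW.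
rewrite ler_pdivlMr// mulrC ler_pM ?(ltW p0) ?VK// -enorm_sqr.
by have : enorm x ^+ 2 <= 1; [rewrite expr_le1 ?enorm_ge0|lra].
Qed.

Lemma mass_escapes : ~ critical_value_sphere Vinf E ->
  forall eta : R, 0 < eta -> exists2 s : R, 0 < s &
  forall c (t : testfn R n), 0 < c -> c < s -> integ (fun x => t x ^+ 2) <= 4 ->
  integ (fun x => (- (\sum_(i < n) thess t i i x) + (V x - E) * t x) ^+ 2) <=
    s * c ^+ 2 ->
  integ (fun x => (1 + dotrV x x)^-1 * t x ^+ 2) <= s ->
  integ (fun x => weight c x ^+ 3 * t x ^+ 2) <= eta.
Proof.
move=> ncrit eta eta0.
have [k k0 kP] := noncritical_lower_bound smooth_Vinf Vinf_homog ncrit.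
have [K1 K10 H1] := Vinf_bounded.
have [K2 K20 H2] := Vinf_radius_grad_bounded.
have [K3 K30 H3] := Vinf_hess_bounded.
have [K4 K40 H4] := Vinf_grad_bounded.
have [K5 K50 H5] := Vinf_radial_bounded.
pose K := K1 + K2 + K3 + K4 + K5.
have gU : has_grad (fun x => Vinf x - E) dV.
  apply: has_grad_eq (has_gradD (smooth_grad smooth_Vinf) (has_grad_cst (- E))).
  by move=> i x; rewrite addr0.
have gdU i : has_grad (dV i) (ddV i) by exact/smooth_grad/smooth_partial.
have K0 : 0 <= K by rewrite /K; lra.
have UK (x : 'rV[R]_n) : `|Vinf x - E| <= K.
  by apply: (le_trans (H1 x)); rewrite /K; lra.
have rdUK i x : enorm x * `|dV i x| <= K.
  by apply: (le_trans (H2 i x)); rewrite /K; lra.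
have ddUK i k' x : enorm x ^+ 2 * `|ddV i k' x| <= K.
  by apply: (le_trans (H3 i k' x)); rewrite /K; lra.
have dUK i x : `|dV i x| <= K by apply: (le_trans (H4 i x)); rewrite /K; lra.
have radK (x : 'rV[R]_n) : `|\sum_(i < n) x ord0 i * dV i x| <= K * (1 + dotrV x x)^-1.
  apply: (le_trans (H5 x)); rewrite ler_wpM2r ?invr_ge0 ?addr_ge0 ?dotrV_ge0//.
  by rewrite /K; lra.
have [s s0 sP] := mass_estimate K0 gU gdU continuous_Vs UK dUK rdUK ddUK radK
  (short_range_bound continuous_Vs Vs_decay) k0 kP eta0.
exists s => // c t c0 cs h1 h2 h3; apply: sP => //.
move: h2; congr (integ _ <= _); apply/funext => x.
by rewrite /residual V_decomp; congr ((_ + _ * _) ^+ 2); ring.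
Qed.

End long_range_potential.

(** * Square integrable functions *)

Section square_integrable.
Context {R : realType} {n : nat}.
Implicit Types (u w : 'rV[R]_n -> R[i]).

Definition normsq (z : R[i]) : R := complex.Re z ^+ 2 + complex.Im z ^+ 2.

Lemma normsq_ge0 z : 0 <= normsq z.
Proof. by rewrite addr_ge0 ?sqr_ge0. Qed.

Lemma normsqD z1 z2 : normsq (z1 + z2) <= 2 * normsq z1 + 2 * normsq z2.
Proof.
case: z1 z2 => [a b] [c d]; rewrite /normsq /=.
have := sqr_ge0 (a - c); have := sqr_ge0 (b - d); lra.
Qed.

Lemma normsqZ (r : R) z : normsq (r%:C * z) = r ^+ 2 * normsq z.
Proof. by case: z => a b; rewrite /normsq /= !mul0r subr0 addr0; ring. Qed.

Lemma L2norm_extE u : (L2norm_ext u =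
  (\int[lebesgue_rV n]_x (normsq (u x))%:E) `^ 2^-1)%E.
Proof.
rewrite /L2norm_ext unlock; congr (_ `^ _)%E; apply: eq_integral => x _ /=; congr EFin.
case: (u x) => a b; rewrite /ComplexField.Normc.normc /normsq /=.
rewrite powR_mulrn ?normr_ge0// ger0_norm ?sqrtr_ge0// sqr_sqrtr//.
by rewrite addr_ge0 ?sqr_ge0.
Qed.

Lemma measurable_normsq u :
  measurable_fun [set: 'rV[R]_n] (fun x => complex.Re (u x)) ->
  measurable_fun [set: 'rV[R]_n] (fun x => complex.Im (u x)) ->
  measurable_fun [set: 'rV[R]_n] (fun x => normsq (u x)).
Proof. by move=> mR mI; apply: measurable_funD; exact: measurable_funX. Qed.

Lemma L2P u : L2 u <-> [/\
  measurable_fun [set: 'rV[R]_n] (fun x => complex.Re (u x)),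
  measurable_fun [set: 'rV[R]_n] (fun x => complex.Im (u x)) &
  (lebesgue_rV n).-integrable [set: 'rV[R]_n] (fun x => (normsq (u x))%:E)].
Proof.
have I0 : (0 <= \int[lebesgue_rV n]_x (normsq (u x))%:E)%E.
  by apply: integral_ge0 => x _; rewrite lee_fin normsq_ge0.
have absE : (\int[lebesgue_rV n]_x `|(normsq (u x))%:E| =
    \int[lebesgue_rV n]_x (normsq (u x))%:E)%E.
  by apply: eq_integral => x _; rewrite gee0_abs// lee_fin normsq_ge0.
split=> -[mR mI fu]; split => //.
  apply/integrableP; split.
    by apply/measurable_EFinP; exact: measurable_normsq.
  rewrite absE; move: fu; rewrite L2norm_extE.
  case: (\int[_]_x _)%E I0 => //= [r _ _|_]; first by rewrite ltry.
  by rewrite invr_eq0 pnatr_eq0.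
move: fu => /integrableP[_]; rewrite absE L2norm_extE.
by case: (\int[_]_x _)%E I0 => //= r _ _; rewrite ltry.
Qed.

Lemma L2norm_ge0 u : 0 <= L2norm u.
Proof. by rewrite fine_ge0// L2norm_extE poweR_ge0. Qed.

Lemma L2norm_sqr u : L2 u -> L2norm u ^+ 2 = integ (fun x => normsq (u x)).
Proof.
move=> /L2P[mR mI /integrable_fin_num]; rewrite /L2norm L2norm_extE /integ /Rintegral.
have I0 : (0 <= \int[lebesgue_rV n]_x (normsq (u x))%:E)%E.
  by apply: integral_ge0 => x _; rewrite lee_fin normsq_ge0.
move=> /(_ measurableT); case: (\int[_]_x _)%E I0 => //= r; rewrite lee_fin => r0 _.
by rewrite powR12_sqrt// sqr_sqrtr.
Qed.

Lemma L2_le (C : R) u w z :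
  measurable_fun [set: 'rV[R]_n] (fun x => complex.Re (z x)) ->
  measurable_fun [set: 'rV[R]_n] (fun x => complex.Im (z x)) ->
  L2 u -> L2 w ->
  (forall x, normsq (z x) <= C * normsq (u x) + C * normsq (w x)) -> L2 z.
Proof.
move=> mR mI /L2P[_ _ iu] /L2P[_ _ iw] zle; apply/L2P; split => //.
apply: (@le_integrable _ _ _ _ _ _ _
   (fun x => (C%:E * (normsq (u x))%:E + C%:E * (normsq (w x))%:E)%E)) => //.
- by apply/measurable_EFinP; exact: measurable_normsq.
- move=> x _; rewrite -!EFinM -EFinD !abse_EFin lee_fin ger0_norm ?normsq_ge0//.
  by rewrite (le_trans (zle x))// ler_norm.
- by apply: integrableD => //; exact: integrableZl.
Qed.

Lemma L2D u w : L2 u -> L2 w -> L2 (fun x => u x + w x).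
Proof.
move=> hu hw; have [[mR mI _] [mR' mI' _]] := (hu, hw).
apply: (@L2_le 2 u w) => // [||x]; last exact: normsqD.
- rewrite (_ : (fun x => _) =
      (fun x => complex.Re (u x)) \+ (fun x => complex.Re (w x))).
    exact: measurable_funD.
  by apply/funext => x /=; case: (u x) (w x) => [? ?] [? ?].
- rewrite (_ : (fun x => _) =
      (fun x => complex.Im (u x)) \+ (fun x => complex.Im (w x))).
    exact: measurable_funD.
  by apply/funext => x /=; case: (u x) (w x) => [? ?] [? ?].
Qed.

Lemma L2M (g : 'rV[R]_n -> R) (C : R) u :
  measurable_fun [set: 'rV[R]_n] g -> (forall x, g x ^+ 2 <= C) -> L2 u ->
  L2 (fun x => (g x)%:C * u x).
Proof.
move=> mg gC hu; have [mR mI _] := hu.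
apply: (@L2_le C u u) => // [||x]; last first.
  rewrite normsqZ; apply: (@le_trans _ _ (C * normsq (u x))).
    by rewrite ler_wpM2r ?normsq_ge0.
  by rewrite lerDl mulr_ge0 ?normsq_ge0// (le_trans _ (gC x))// sqr_ge0.
- rewrite (_ : (fun x => _) = g \* (fun x => complex.Im (u x))).
    exact: measurable_funM.
  by apply/funext => x /=; case: (u x) => [? ?] /=; rewrite mul0r addr0.
- rewrite (_ : (fun x => _) = g \* (fun x => complex.Re (u x))).
    exact: measurable_funM.
  by apply/funext => x /=; case: (u x) => [? ?] /=; rewrite mul0r subr0.
Qed.

Lemma L2Z (r : R) u : L2 u -> L2 (fun x => r%:C * u x).
Proof. by move=> hu; apply: (@L2M (fun=> r) (r ^+ 2)). Qed.

Lemma L2B u w : L2 u -> L2 w -> L2 (fun x => u x - w x).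
Proof.
move=> hu hw; rewrite (_ : (fun x => _) = (fun x => u x + (-1)%:C * w x)).
  by apply: L2D => //; exact: L2Z.
by apply/funext => x; rewrite rmorphN rmorph1 mulN1r.
Qed.

Lemma ccont_L2 u : ccont (fun x => complex.Re (u x)) ->
  ccont (fun x => complex.Im (u x)) -> L2 u.
Proof.
move=> cR cI; apply/L2P; split; [exact: continuous_measurable_rV cR.1|
  exact: continuous_measurable_rV cI.1|].
apply: (@ccont_integrable R n (fun x => normsq (u x))).
by apply: ccontD; under eq_fun do rewrite expr2; apply: ccontM => //;
  [exact: cR.1|exact: cI.1].
Qed.

Lemma L2_integrable u : L2 u ->
  (lebesgue_rV n).-integrable [set: 'rV[R]_n] (EFin \o (fun x => normsq (u x))).
Proof. by move=> /L2P[]. Qed.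

Lemma le_integ (f g : 'rV[R]_n -> R) :
  (lebesgue_rV n).-integrable [set: 'rV[R]_n] (EFin \o f) ->
  (lebesgue_rV n).-integrable [set: 'rV[R]_n] (EFin \o g) ->
  (forall x, f x <= g x) -> integ f <= integ g.
Proof. by move=> fi gi fg; exact: le_Rintegral. Qed.

(** Three functions are allowed because the residual of an approximant is a sum of three errors; see
    [domain_estimate]. *)
Lemma integ_le_normsq (f : 'rV[R]_n -> R) (a b c : R) u w z :
  measurable_fun [set: 'rV[R]_n] f -> (forall x, 0 <= f x) ->
  L2 u -> L2 w -> L2 z ->
  (forall x, f x <= a * normsq (u x) + b * normsq (w x) + c * normsq (z x)) ->
  integ f <= a * L2norm u ^+ 2 + b * L2norm w ^+ 2 + c * L2norm z ^+ 2.
Proof.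
move=> mf f0 hu hw hz fle.
have iZ (k : R) v : L2 v ->
    (lebesgue_rV n).-integrable [set: 'rV[R]_n] (EFin \o (fun x => k * normsq (v x))).
  move=> /L2_integrable iv.
  rewrite (_ : _ \o _ = (fun x => k%:E * (normsq (v x))%:E)%E)//.
  exact: integrableZl.
have iD (g h : 'rV[R]_n -> R) :
    (lebesgue_rV n).-integrable [set: 'rV[R]_n] (EFin \o g) ->
    (lebesgue_rV n).-integrable [set: 'rV[R]_n] (EFin \o h) ->
    (lebesgue_rV n).-integrable [set: 'rV[R]_n] (EFin \o (fun x => g x + h x)).
  move=> gi hi; rewrite (_ : _ \o _ = (fun x => (g x)%:E + (h x)%:E)%E)//.
  exact: integrableD.
have ig := iD _ _ (iD _ _ (iZ a u hu) (iZ b w hw)) (iZ c z hz).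
have fi : (lebesgue_rV n).-integrable [set: 'rV[R]_n] (EFin \o f).
  apply: le_integrable ig => //; first exact/measurable_EFinP.
  by move=> x _; rewrite !abse_EFin lee_fin ger0_norm// (le_trans (fle x))// ler_norm.
apply: (le_trans (le_integ fi ig fle)).
rewrite (L2norm_sqr hu) (L2norm_sqr hw) (L2norm_sqr hz) /integ.
rewrite RintegralD//; [|exact/iD/iZ/hw/iZ|exact: iZ].
rewrite RintegralD//; [|exact: iZ|exact: iZ].
by rewrite !RintegralZl//; exact: L2_integrable.
Qed.

End square_integrable.

(** * From the operator domain to test functions *)

Section approximation.
Context {R : realType} {n : nat}.

Definition smooth_testfn (a : 'rV[R]_n -> R) (sa : smooth a) (ca : ccont a) :
    testfn R n :=
  @Testfn R n a (fun i => partial i a) (fun i k => partial k (partial i a))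
    ca (smooth_grad sa) (fun i => smooth_grad (smooth_partial i sa))
    (fun i k x => partialC k i x sa).

Lemma ccont_laplacian (a : 'rV[R]_n -> R) :
  smooth a -> ccont a -> ccont (laplacian a).
Proof.
move=> sa ca; apply: ccont_sum => i.
have cai : ccont (partial i a).
  by apply: partial_ccont ca _ _; [exact: ((smooth_grad sa).2 i).2|
    exact: ((smooth_grad sa).2 i).1].
have si := smooth_grad (smooth_partial i sa).
by apply: partial_ccont cai _ _; [exact: (si.2 i).2|exact: (si.2 i).1].
Qed.

Lemma test_function_ccont (phi : 'rV[R]_n -> R[i]) : test_function phi ->
  ccont (fun x => complex.Re (phi x)) /\ ccont (fun x => complex.Im (phi x)).
Proof.
move=> [sR sI [M phi0]]; split; (split; first exact: smooth_continuous);
  by exists M => x /phi0 ->.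
Qed.

Lemma schroedinger0E (V : 'rV[R]_n -> R) (phi : 'rV[R]_n -> R[i]) x :
  schroedinger0 V phi x =
  (- laplacian (fun y => complex.Re (phi y)) x + V x * complex.Re (phi x)) +i*
  (- laplacian (fun y => complex.Im (phi y)) x + V x * complex.Im (phi x)).
Proof.
rewrite /schroedinger0; case: (phi x) => a b /=.
by congr (_ +i* _); rewrite mul0r ?subr0 ?addr0.
Qed.

Lemma L2_schroedinger0 (V : 'rV[R]_n -> R) (phi : 'rV[R]_n -> R[i]) :
  continuous V -> test_function phi -> L2 (schroedinger0 V phi).
Proof.
move=> cV tphi; have [cR cI] := test_function_ccont tphi.
have [sR sI _] := tphi.
by apply: ccont_L2; under eq_fun do rewrite schroedinger0E /=;
  apply: ccontD; [exact/ccontN/ccont_laplacian|exact: ccontMl| |exact: ccontMl];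
  exact/ccontN/ccont_laplacian.
Qed.

(** [u] is replaced by a test function close in graph norm. Its real and imaginary parts satisfy the
    assumptions of the real estimate, which is passed as a hypothesis, and the bound returns to [u]
    up to the approximation error. *)
Lemma domain_estimate (V : 'rV[R]_n -> R) (E s eta c c' : R) (j : R -> R)
    (u f : 'rV[R]_n -> R[i]) :
  continuous V -> 0 < s -> 0 < eta -> 0 < c -> 0 < c' ->
  (forall t : testfn R n, integ (fun x => t x ^+ 2) <= 4 ->
    integ (fun x => (- (\sum_(i < n) thess t i i x) + (V x - E) * t x) ^+ 2) <=
      s * c ^+ 2 ->
    integ (fun x => (1 + dotrV x x)^-1 * t x ^+ 2) <= s ->
    integ (fun x => weight c x ^+ 3 * t x ^+ 2) <= eta) ->
  continuous j -> (forall r, 0 <= j r <= 1) ->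
  (forall r, r <= 2^-1 -> j r = 0) -> (forall r, 1 <= r -> j r = 1) ->
  schroedinger V u (fun x => E%:C * u x + f x) -> L2norm u = 1 ->
  6 * L2norm f ^+ 2 <= s * c ^+ 2 ->
  2 * L2norm (fun x => (1 - cutoff j c' x)%:C * u x) ^+ 2 + 8 * c' ^+ 2 <= s / 2 ->
  L2norm (fun x => (1 - cutoff j c x)%:C * u x) ^+ 2 <= 18 * eta.
Proof.
move=> cV s0 eta0 c0 c'0 key cj j01 j0 j1 [hu hEuf [phi [tphi phiu phif]]] u1 fs c's.
have hf : L2 f.
  rewrite (_ : f = (fun x => (E%:C * u x + f x) - E%:C * u x)).
    by apply: L2B => //; exact: L2Z.
  by apply/funext => x; rewrite addrC addKr.
have ccut k : continuous (cutoff j k : 'rV[R]_n -> R).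
  move=> x; apply: (@continuous_comp _ _ _ (fun y : 'rV[R]_n => k * enorm y) j).
    by apply: continuous_mul; [exact: cst_continuous|exact: continuous_enorm].
  exact: cj.
have hcut k : L2 (fun x => (1 - cutoff j k x)%:C * u x).
  apply: (@L2M _ _ (fun x => 1 - cutoff j k x) 1) => // [|x].
    apply: continuous_measurable_rV; apply: continuous_add.
      exact: cst_continuous.
    exact/continuous_opp/ccut.
  have /andP[? ?] := j01 (k * enorm x).
  by rewrite expr_le1 /cutoff//; lra.
(* The squared graph distance allowed: 1 gives mass at most [2 + 2 d <= 4], [s / 4] bounds the error
   in the mass near the origin, [eta] the error in the conclusion, and the last term makes
   [3 d (1 + E^2)] at most half of the allowed residual. *)
pose d := Num.min (Num.min 1 (s / 4)) (Num.min eta (s * c ^+ 2 / (6 * (1 + E ^+ 2)))).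
have E20 : 0 <= E ^+ 2 by exact: sqr_ge0.
have d0 : 0 < d.
  rewrite !lt_min ltr01 eta0 !divr_gt0//= ?mulr_gt0 ?exprn_gt0//.
  by rewrite ltr_wpDr.
have d1 : d <= 1 by rewrite !ge_min lexx.
have ds : d <= s / 4 by rewrite !ge_min lexx !orbT.
have deta : d <= eta by rewrite !ge_min lexx !orbT.
have dE : 6 * (d * (1 + E ^+ 2)) <= s * c ^+ 2.
  rewrite mulrCA -ler_pdivlMr ?mulr_gt0 ?ltr_wpDr//.
  by rewrite !ge_min lexx !orbT.
have sd0 : 0 < Num.sqrt d by rewrite sqrtr_gt0.
have [k [ku kf]] : exists k, L2norm (fun x => phi k x - u x) < Num.sqrt d /\
   L2norm (fun x => schroedinger0 V (phi k) x - (E%:C * u x + f x)) < Num.sqrt d.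
  have /cvgr_lt/(_ _ sd0) n1 := phiu.
  have /cvgr_lt/(_ _ sd0) n2 := phif.
  by have [k _ kP] := filterI n1 n2; exists k; exact: (kP k (leqnn k)).
have [cR cI] := test_function_ccont (tphi k).
have [sR sI _] := tphi k.
have hphi : L2 (phi k) by exact: ccont_L2.
set w := (fun x => phi k x - u x) in ku.
have hw : L2 w by exact: L2B.
set g := (fun x => _ - _) in kf.
have hg : L2 g by apply: L2B => //; exact: L2_schroedinger0.
have wd : L2norm w ^+ 2 <= d.
  rewrite -[leRHS]sqr_sqrtr ?(ltW d0)// lerXn2r ?nnegrE ?L2norm_ge0 ?sqrtr_ge0//.
  exact: ltW.
have gd : L2norm g ^+ 2 <= d.
  rewrite -[leRHS]sqr_sqrtr ?(ltW d0)// lerXn2r ?nnegrE ?L2norm_ge0 ?sqrtr_ge0//.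
  exact: ltW.
have phiE x : phi k x = u x + w x by rewrite /w addrC subrK.
have normsq_phi x : normsq (phi k x) <= 2 * normsq (u x) + 2 * normsq (w x).
  by rewrite phiE normsqD.
pose q (x : 'rV[R]_n) : R := (1 + dotrV x x)^-1.
have q0 x : 0 <= q x by rewrite invr_ge0 addr_ge0 ?dotrV_ge0.
have q1 x : q x <= 1.
  by rewrite invf_le1 ?ltr_pwDl ?dotrV_ge0// lerDl dotrV_ge0.
have cq : continuous q.
  apply: continuous_inv => [|x]; last by rewrite gt_eqF// ltr_pwDl ?dotrV_ge0.
  by apply: continuous_add; [exact: cst_continuous|exact: continuous_dotrV].
(* Where [c' |x| <= 1/2] the cutoff vanishes and [q <= 1]; elsewhere [q <= |x|^-2 <= 4 c'^2]. *)
have normsq_q x : q x * normsq (u x) <=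
    normsq ((1 - cutoff j c' x)%:C * u x) + 4 * c' ^+ 2 * normsq (u x).
  rewrite normsqZ; have [small|big] := leP (c' * enorm x) 2^-1.
    rewrite /cutoff (j0 _ small) subr0 expr1n mul1r ler_wpDr//.
      by rewrite mulr_ge0 ?normsq_ge0// mulr_ge0 ?sqr_ge0.
    by rewrite ler_piMl ?normsq_ge0.
  apply: ler_wpDl; first by rewrite mulr_ge0 ?sqr_ge0 ?normsq_ge0.
  apply: (ler_wpM2r (normsq_ge0 _)).
  have h : (2^-1) ^+ 2 <= (c' * enorm x) ^+ 2.
    by rewrite lerXn2r ?nnegrE ?mulr_ge0 ?enorm_ge0 ?(ltW c'0)// ltW.
  rewrite /q -div1r ler_pdivrMr ?ltr_pwDl ?dotrV_ge0//.
  have := sqr_ge0 c'; move: h; rewrite exprMn enorm_sqr; lra.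
(* Stated for any [a] dominated, together with its residual, by [phi k]: since [V] and [E] are real,
   this covers both the real and the imaginary part. *)
have part (a : 'rV[R]_n -> R) (sa : smooth a) (ca : ccont a) :
    (forall x, a x ^+ 2 <= normsq (phi k x)) ->
    (forall x, (- laplacian a x + (V x - E) * a x) ^+ 2 <=
       normsq (schroedinger0 V (phi k) x - E%:C * phi k x)) ->
    integ (fun x => weight c x ^+ 3 * a x ^+ 2) <= eta.
  move=> aphi arho; have msq (b : 'rV[R]_n -> R) : continuous b ->
      measurable_fun [set: 'rV[R]_n] (fun x => b x ^+ 2).
    by move=> cb; apply: continuous_measurable_rV; exact: continuous_exp.
  apply: (key (smooth_testfn sa ca)) => /=.
  - have := @integ_le_normsq R n (fun x => a x ^+ 2) 2 2 0 u w w (msq _ ca.1)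
      (fun x => sqr_ge0 _) hu hw hw.
    rewrite u1 => H; apply: (le_trans (H _)); last by lra.
    by move=> x; rewrite mul0r addr0 (le_trans (aphi x)).
  - have crho : continuous (fun x => - laplacian a x + (V x - E) * a x).
      apply: continuous_add; first exact/continuous_opp/(ccont_laplacian sa ca).1.
      apply: continuous_mul; last exact: ca.1.
      by apply: continuous_add => //; exact: cst_continuous.
    have := @integ_le_normsq R n (fun x => (- laplacian a x + (V x - E) * a x) ^+ 2)
      3 3 (3 * E ^+ 2) g f w (msq _ crho) (fun x => sqr_ge0 _) hg hf hw.
    move=> H; apply: (le_trans (H _)); last first.
      have : E ^+ 2 * L2norm w ^+ 2 <= E ^+ 2 * d by rewrite ler_wpM2l.
      by move: dE; rewrite mulrDr mulr1; lra.
    move=> x; apply: (le_trans (arho x)).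
    (* The residual of the approximant is the approximation error of the image, the given source,
       and [-E] times the approximation error of [u]. The factor 3 is that of the square of a sum of
       three terms. *)
    have -> : schroedinger0 V (phi k) x - E%:C * phi k x =
        g x + f x + (- E)%:C * w x.
      by rewrite /g /w rmorphN; ring.
    have -> : 3 * E ^+ 2 * normsq (w x) = 3 * normsq ((- E)%:C * w x).
      by rewrite normsqZ sqrrN mulrA.
    case: (g x) (f x) ((- E)%:C * w x) => [a1 b1] [a2 b2] [a3 b3].
    rewrite /normsq /=.
    have := sqr_ge0 (a1 - a2); have := sqr_ge0 (a1 - a3); have := sqr_ge0 (a2 - a3).
    have := sqr_ge0 (b1 - b2); have := sqr_ge0 (b1 - b3); have := sqr_ge0 (b2 - b3).
    lra.
  - have mqa : measurable_fun [set: 'rV[R]_n] (fun x => q x * a x ^+ 2).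
      apply: continuous_measurable_rV; apply: continuous_mul => //.
      by apply: continuous_exp; exact: ca.1.
    have := @integ_le_normsq R n _ 2 (8 * c' ^+ 2) 2 _ u w mqa
      (fun x => mulr_ge0 (q0 x) (sqr_ge0 _)) (hcut c') hu hw.
    rewrite u1 expr1n mulr1 => H; apply: (le_trans (H _)); last by lra.
    move=> x; apply: (@le_trans _ _ (q x * (2 * normsq (u x) + 2 * normsq (w x)))).
      by rewrite ler_wpM2l// (le_trans (aphi x)).
    have : q x * normsq (w x) <= normsq (w x) by rewrite ler_piMl ?normsq_ge0.
    by have := normsq_q x; lra.
have partR := part _ sR cR.
have {}partR : integ (fun x => weight c x ^+ 3 * complex.Re (phi k x) ^+ 2) <= eta.
  apply: partR => x; first by rewrite /normsq lerDl sqr_ge0.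
  rewrite schroedinger0E /normsq; case: (phi k x) => a b /=.
  rewrite mul0r subr0 ler_wpDr ?sqr_ge0// le_eqVlt; apply/orP; left; apply/eqP.
  by congr (_ ^+ 2); ring.
have partI := part _ sI cI.
have {}partI : integ (fun x => weight c x ^+ 3 * complex.Im (phi k x) ^+ 2) <= eta.
  apply: partI => x; first by rewrite /normsq lerDr sqr_ge0.
  rewrite schroedinger0E /normsq; case: (phi k x) => a b /=.
  rewrite !mul0r subr0 addr0 ler_wpDl ?sqr_ge0// le_eqVlt; apply/orP; left; apply/eqP.
  by congr (_ ^+ 2); ring.
rewrite (L2norm_sqr (hcut c)).
have cw3 : continuous (fun x : 'rV[R]_n => weight c x ^+ 3).
  by apply: continuous_exp; exact: (weight_grad c).1.
have ccsq (a : 'rV[R]_n -> R) : ccont a -> ccont (fun x => weight c x ^+ 3 * a x ^+ 2).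
  move=> ca; apply: ccontMl => //; under eq_fun do rewrite expr2.
  by apply: ccontM => //; exact: ca.1.
have wphi : integ (fun x => weight c x ^+ 3 * normsq (phi k x)) <= 2 * eta.
  under eq_fun do rewrite /normsq mulrDr.
  by rewrite integD; [lra|exact: ccsq|exact: ccsq].
have cwphi : ccont (fun x => weight c x ^+ 3 * normsq (phi k x)).
  by under eq_fun do rewrite /normsq mulrDr; apply: ccontD; exact: ccsq.
have iw8 := ccont_integrable (ccontZ 8 cwphi).
have iw2 : (lebesgue_rV n).-integrable [set: 'rV[R]_n]
    (EFin \o (fun x => 2 * normsq (w x))).
  rewrite (_ : _ \o _ = (fun x => 2%:E * (normsq (w x))%:E)%E)//.
  by apply: integrableZl => //; exact: L2_integrable.
have iS : (lebesgue_rV n).-integrable [set: 'rV[R]_n]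
    (EFin \o (fun x => 8 * (weight c x ^+ 3 * normsq (phi k x)) + 2 * normsq (w x))).
  rewrite (_ : _ \o _ = (fun x => (8 * (weight c x ^+ 3 * normsq (phi k x)))%:E +
     (2 * normsq (w x))%:E)%E)//.
  exact: integrableD.
(* The 8 is 2, from writing [u] as [phi k] minus the error, times the 4 of [jw]. The total is at
   most [8 (2 eta) + 2 d], hence at most [18 eta]. *)
apply: (@le_trans _ _ (integ (fun x => 8 * (weight c x ^+ 3 * normsq (phi k x))
    + 2 * normsq (w x)))); last first.
  rewrite /integ RintegralD// -/(integ _) -/(integ _) integZ//.
  rewrite (_ : integ (fun x => 2 * normsq (w x)) = 2 * L2norm w ^+ 2); last first.
    by rewrite (L2norm_sqr hw) /integ RintegralZl//; exact: L2_integrable.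
  lra.
apply: le_integ => // [|x]; first exact: L2_integrable.
rewrite normsqZ.
have [w0 w1 wE] : [/\ 0 < weight c x, weight c x <= 1 &
    weight c x ^+ 2 * (1 + c ^+ 2 * dotrV x x) = 1].
  by split; [exact: weight_gt0|exact: weight_le1|exact: weight_sqrE].
have /andP[j_ge0 j_le1] := j01 (c * enorm x).
(* Where [1 - j] does not vanish, [c |x| < 1]; then [w >= w^2 >= 1/2], so [w^3 >= 1/4]. *)
have jw : (1 - cutoff j c x) ^+ 2 <= 4 * weight c x ^+ 3.
  have [big|small] := leP 1 (c * enorm x).
    by rewrite /cutoff (j1 _ big) subrr expr0n /= mulr_ge0// exprn_ge0// ltW.
  apply: (@le_trans _ _ 1); first by rewrite expr_le1 /cutoff//; lra.
  have h : c ^+ 2 * dotrV x x <= 1.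
    by rewrite -enorm_sqr -exprMn expr_le1 ?mulr_ge0 ?enorm_ge0 ?(ltW c0)// ltW.
  have h1 : 2^-1 <= weight c x ^+ 2.
    rewrite weight_sqr lef_pV2 ?posrE ?weight_arg_gt0//; lra.
  have h2 : 2^-1 <= weight c x.
    by rewrite (le_trans h1)// expr2 ler_piMl// ltW.
  have h3 : 2^-1 * 2^-1 <= weight c x ^+ 3.
    by rewrite exprS ler_pM.
  lra.
have u2 : normsq (u x) <= 2 * normsq (phi k x) + 2 * normsq (w x).
  have -> : u x = phi k x + (-1)%:C * w x.
    by rewrite rmorphN rmorph1 mulN1r phiE addrK.
  by rewrite (le_trans (normsqD _ _))// normsqZ sqrrN expr1n mul1r.
have jj1 : (1 - cutoff j c x) ^+ 2 <= 1 by rewrite expr_le1 /cutoff//; lra.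
apply: (le_trans (ler_wpM2l (sqr_ge0 _) u2)).
have := ler_wpM2r (normsq_ge0 (phi k x)) jw.
have := ler_wpM2r (normsq_ge0 (w x)) jj1.
lra.
Qed.

End approximation.

(** * Conclusion, by choosing [h] small *)

Theorem theorem1p4 (R : realType) (n : nat) (n_gt0 : (0 < n)%N)
  (V Vinf Vs : 'rV[R]_n -> R)
  (smooth_V : smooth V)
  (V_decomp : forall x, V x = Vinf x + Vs x)
  (smooth_Vinf : smooth Vinf)
  (Vinf_homog : forall x, 1 <= enorm x -> Vinf x = Vinf ((enorm x)^-1 *: x))
  (Vs_decay : forall e : R, 0 < e ->
     exists M : R, forall x, M <= enorm x -> `|Vs x| <= e * (enorm x)^-1)
  (j : R -> R)
  (smooth_j : smooth1 j)
  (j_range : forall r, 0 <= j r <= 1)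
  (j_eq0 : forall r, r <= 2^-1 -> j r = 0)
  (j_eq1 : forall r, 1 <= r -> j r = 1)
  (E : R)
  (u Rh Rh' : R -> 'rV[R]_n -> R[i])
  (u_eq : forall h, 0 < h < 1 ->
     schroedinger V (u h) (fun x => E%:C * u h x + Rh h x))
  (u_norm : forall h, 0 < h < 1 -> L2norm (u h) = 1)
  (c1 c2 : R -> R)
  (* (i) *)
  (c1_gt0 : forall h, 0 < h < 1 -> 0 < c1 h)
  (c2_gt0 : forall h, 0 < h < 1 -> 0 < c2 h)
  (c2_incr : forall h h', 0 < h -> h < h' -> h' < 1 -> c2 h < c2 h')
  (c1_le_c2 : forall h, 0 < h < 1 -> 0 <= c1 h <= c2 h)
  (c2_lim : c2 h @[h --> 0^'+] --> (0 : R))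
  (* (ii) *)
  (Rh'_L2 : forall h, 0 < h < 1 -> L2 (Rh' h))
  (u_split : forall h, 0 < h < 1 ->
     {ae lebesgue_rV n, forall x,
        u h x = (cutoff j (c2 h) x)%:C * u h x + Rh' h x})
  (Rh'_lim : L2norm (Rh' h) @[h --> 0^'+] --> (0 : R))
  (* (iii) *)
  (c2_pow : exists h0 delta : R, [/\ 0 < h0, 1 < delta < 2 &
     forall h, 0 < h < 1 -> h < h0 -> c2 h `^ delta < c1 h])
  (* (iv) *)
  (Rh_lim : L2norm (Rh h) / c1 h @[h --> 0^'+] --> (0 : R)) :
  critical_value_sphere Vinf E \/
  (L2norm (fun x => (1 - cutoff j (c2 h) x)%:C * u h x) @[h --> 0^'+]
     --> (0 : R) ->
   L2norm (fun x => (1 - cutoff j (c1 h) x)%:C * u h x) @[h --> 0^'+]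
     --> (0 : R)).
Proof.
have [crit|ncrit] := pselect (critical_value_sphere Vinf E); [by left|right].
move=> c2_mass; apply/cvgrPdist_lt => eps eps0.
(* [domain_estimate] bounds the squared norm by [18 eta], here [eps^2 / 2]. *)
have eta0 : 0 < eps ^+ 2 / 36 by rewrite divr_gt0// exprn_gt0.
have [s s0 escape] := mass_escapes smooth_V V_decomp smooth_Vinf Vinf_homog
  Vs_decay ncrit eta0.
have cj : continuous j.
  by move=> r; apply: differentiable_continuous; apply/derivable1_diffP;
     exact: (smooth_j 0).
(* With each square at most [s / 32], the mass condition [2 + 8] costs [10 s / 32 <= s / 2] and the
   residual [6 s / 32 <= s]. *)
have e1 : 0 < Num.sqrt (s / 32) by rewrite sqrtr_gt0 divr_gt0.
have sq32 (r : R) : 0 <= r -> r < Num.sqrt (s / 32) -> r ^+ 2 <= s / 32.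
  move=> r0 rs; rewrite -[leRHS]sqr_sqrtr ?divr_ge0 ?(ltW s0)//.
  by rewrite lerXn2r ?nnegrE ?sqrtr_ge0// ltW.
have /cvgr_lt/(_ _ s0) near_s := c2_lim.
have /cvgr_lt/(_ _ e1) near_c2 := c2_lim.
have /cvgr_lt/(_ _ e1) near_mass := c2_mass.
have /cvgr_lt/(_ _ e1) near_Rh := Rh_lim.
near=> h.
have h01 : 0 < h < 1.
  by apply/andP; split; near: h; [exact: nbhs_right_gt|exact: nbhs_right_lt].
have c1h := c1_gt0 _ h01; have c2h := c2_gt0 _ h01.
have /andP[_ c12] := c1_le_c2 _ h01.
have c1s : c1 h < s by apply: (le_lt_trans c12); near: h.
have c2s : c2 h ^+ 2 <= s / 32 by apply: sq32 (ltW c2h) _; near: h.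
have ms : L2norm (fun x => (1 - cutoff j (c2 h) x)%:C * u h x) ^+ 2 <= s / 32.
  by apply: sq32 (L2norm_ge0 _) _; near: h.
have Rs : (L2norm (Rh h) / c1 h) ^+ 2 <= s / 32.
  by apply: sq32; [rewrite divr_ge0 ?L2norm_ge0// ltW|near: h].
have Rs' : 6 * L2norm (Rh h) ^+ 2 <= s * c1 h ^+ 2.
  move: Rs; rewrite expr_div_n ler_pdivrMr ?exprn_gt0// => Rs.
  have : 0 <= s * c1 h ^+ 2 by rewrite mulr_ge0 ?sqr_ge0// ltW.
  lra.
have cs : 2 * L2norm (fun x => (1 - cutoff j (c2 h) x)%:C * u h x) ^+ 2 +
    8 * c2 h ^+ 2 <= s / 2 by lra.
have := domain_estimate (smooth_continuous smooth_V) s0 eta0 c1h c2h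
  (fun t => escape _ t c1h c1s) cj j_range j_eq0 j_eq1 (u_eq _ h01) (u_norm _ h01)
  Rs' cs.
set M := L2norm _ => M_le.
rewrite sub0r normrN ger0_norm ?L2norm_ge0//.
rewrite -(@ltr_pXn2r _ 2%N) ?nnegrE ?L2norm_ge0 ?(ltW eps0)//.
apply: (le_lt_trans M_le).
have := exprn_gt0 2 eps0; lra.
Unshelve. all: by end_near. Qed.
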